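(* The projected Aubry set $\mathcal{A}=\{x\in\mathbb{T}^d: h(x,x)=0\}$ is nonempty.
   Context: Setting: $1\le m\le d$, $\mathbb{T}^d=\mathbb{R}^d/\mathbb{Z}^d$. $f_1,\dots,f_m$ smooth vector fields on $\mathbb{T}^d$ satisfying the Hörmander condition; $F(x)=[f_1(x)|\cdots|f_m(x)]$. (F): $F\in C^{1,1}$, rank $F(x)=m$. Admissible pairs $(\gamma,u)$: $\gamma$ absolutely continuous, $u\in L^2$, $\dot\gamma=F(\gamma)u$ a.e.; $\Gamma^{x\to y}_{0,t}$ those on $[0,t]$ from $x$ to $y$. (L): $L\in C^2(\mathbb{T}^d\times\mathbb{R}^m)$, $D^2_uL\ge0$, $L(x,u)\ge K_1|u|^\sigma-K_2$ ($\sigma>1$). $H(x,p)=\sup_u\{\langle F^*(x)p,u\rangle-L(x,u)\}$. (S): no singular minimizing controls other than zero for $V^T(x)=\inf\{\int_0^TL(\gamma,u):\gamma(0)=x\}$. $\bar c=\lim_{T\to\infty}V^T(x)/T$. $A_t(x,y)=\inf_{\Gamma^{x\to y}_{0,t}}\int_0^tL$. Peierls barrier $h(x,y)=\liminf_{t\to\infty}[A_t(x,y)-\bar c t]$. Assumptions (F), (L), (S) are in force. *)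

(* Defs.v *)
From HB Require Import structures.
From mathcomp Require Import all_boot all_order all_algebra.
From mathcomp Require Import all_classical all_reals all_analysis.
Set Implicit Arguments. Unset Strict Implicit. Unset Printing Implicit Defensive.
Import Order.TTheory GRing.Theory Num.Theory.
Import numFieldNormedType.Exports.
Local Open Scope classical_set_scope.
Local Open Scope ring_scope.

Section SubRiemannianWeakKAM.
Variable R : realType.

Fixpoint Dlist {V W : normedModType R} (vs : seq V) (g : V -> W) : V -> W :=
  match vs with
  | [::] => g
  | v :: vs' => fun x => 'D_v (Dlist vs' g) x
  end.

Definition Ck {V W : normedModType R} (k : nat) (g : V -> W) : Prop :=
  forall vs : seq V, (size vs <= k)%N ->
    continuous (Dlist vs g) /\
    ((size vs < k)%N -> forall (v x : V), derivable (Dlist vs g) x v).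

Definition smooth {V W : normedModType R} (g : V -> W) : Prop :=
  forall k, Ck k g.

(** * The torus T^d = R^d / Z^d, represented by Z^d-Zd_periodic objects on R^d *)

Definition intvec {d : nat} (z : 'rV[int]_d) : 'rV[R]_d :=
  map_mx (fun k : int => k%:~R) z.

Definition torus_eq {d : nat} (x y : 'rV[R]_d) : Prop :=
  exists z : 'rV[int]_d, y = x + intvec z.

Definition Zd_periodic {d : nat} {W : Type} (g : 'rV[R]_d -> W) : Prop :=
  forall (x : 'rV[R]_d) (z : 'rV[int]_d), g (x + intvec z) = g x.

Definition Fu {d m : nat} (f : 'I_m -> 'rV[R]_d -> 'rV[R]_d)
  (x : 'rV[R]_d) (u : 'rV[R]_m) : 'rV[R]_d :=
  \sum_(i < m) u 0 i *: f i x.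

Definition lie_bracket {d : nat} (X Y : 'rV[R]_d -> 'rV[R]_d) : 'rV[R]_d -> 'rV[R]_d :=
  fun x => 'D_(X x) Y x - 'D_(Y x) X x.

Inductive bracket_word (m : nat) : Type :=
  | BGen of 'I_m
  | BBr of bracket_word m & bracket_word m.

Fixpoint beval {d m : nat} (f : 'I_m -> 'rV[R]_d -> 'rV[R]_d)
  (w : bracket_word m) : 'rV[R]_d -> 'rV[R]_d :=
  match w with
  | BGen i => f i
  | BBr w1 w2 => lie_bracket (beval f w1) (beval f w2)
  end.

(* Hörmander condition: at every point, the Lie algebra generated by the f_i
   spans R^d (i.e. d brackets evaluated at x span R^d) *)
Definition Hormander {d m : nat} (f : 'I_m -> 'rV[R]_d -> 'rV[R]_d) : Prop :=
  forall x : 'rV[R]_d, exists ws : 'I_d -> bracket_word m,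
    row_full (\matrix_(j < d) beval f (ws j) x).

Definition condF {d m : nat} (f : 'I_m -> 'rV[R]_d -> 'rV[R]_d) : Prop :=
  (forall i, Ck 1 (f i)) /\
  (exists K : R, forall i (x y v : 'rV[R]_d),
      `|'D_v (f i) x - 'D_v (f i) y| <= K * `|x - y| * `|v|) /\
  (forall x, row_free (\matrix_(i < m) f i x)).

Definition enorm {n : nat} (u : 'rV[R]_n) : R := Num.sqrt (\sum_(i < n) u 0 i ^+ 2).

Definition condL {d m : nat} (L : 'rV[R]_d -> 'rV[R]_m -> R) : Prop :=
  Ck 2 (fun p : 'rV[R]_d * 'rV[R]_m => L p.1 p.2) /\
  Zd_periodic L /\
  (forall (x : 'rV[R]_d) (u v : 'rV[R]_m), 0 <= 'D_v (fun w => 'D_v (L x) w) u) /\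
  (exists sigma K1 K2 : R, 1 < sigma /\ 0 < K1 /\
     forall x u, K1 * powR (enorm u) sigma - K2 <= L x u).

Definition abs_cont {d : nat} (g : R -> 'rV[R]_d) (a b : R) : Prop :=
  forall e : R, 0 < e -> exists2 del : R, 0 < del &
    forall (n : nat) (s t : 'I_n -> R),
      (forall k, a <= s k /\ s k <= t k /\ t k <= b) ->
      (forall k l : 'I_n, (k < l)%N -> t k <= s l) ->
      \sum_(k < n) (t k - s k) < del ->
      \sum_(k < n) `|g (t k) - g (s k)| < e.

Definition I0 (t : R) : set R := `[0%R, t]%classic.

Definition L2ctrl {m : nat} (u : R -> 'rV[R]_m) (t : R) : Prop :=
  forall i : 'I_m,
    measurable_fun (I0 t) (fun s => u s 0 i) /\
    (\int[lebesgue_measure]_(s in (I0 t)) ((u s 0 i) ^+ 2)%:E < +oo)%E.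

Definition admissible {d m : nat} (f : 'I_m -> 'rV[R]_d -> 'rV[R]_d) (t : R)
  (g : R -> 'rV[R]_d) (u : R -> 'rV[R]_m) : Prop :=
  abs_cont g 0 t /\ L2ctrl u t /\
  {ae lebesgue_measure, forall s, (I0 t) s ->
      derivable g s 1 /\ 'D_1 g s = Fu f (g s) (u s)}.

Definition cost {d m : nat} (L : 'rV[R]_d -> 'rV[R]_m -> R) (t : R)
  (g : R -> 'rV[R]_d) (u : R -> 'rV[R]_m) : \bar R :=
  \int[lebesgue_measure]_(s in (I0 t)) (L (g s) (u s))%:E.

Definition valueV {d m : nat} (f : 'I_m -> 'rV[R]_d -> 'rV[R]_d)
  (L : 'rV[R]_d -> 'rV[R]_m -> R) (T : R) (x : 'rV[R]_d) : \bar R :=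
  ereal_inf [set c | exists g u, admissible f T g u /\ g 0 = x /\ c = cost L T g u].

Definition actionA {d m : nat} (f : 'I_m -> 'rV[R]_d -> 'rV[R]_d)
  (L : 'rV[R]_d -> 'rV[R]_m -> R) (t : R) (x y : 'rV[R]_d) : \bar R :=
  ereal_inf [set c | exists g u, admissible f t g u /\ g 0 = x /\
                                 torus_eq y (g t) /\ c = cost L t g u].

(* critical value cbar = lim_{T -> oo} V^T(x)/T (computed at x = 0) *)
Definition cbar {d m : nat} (f : 'I_m -> 'rV[R]_d -> 'rV[R]_d)
  (L : 'rV[R]_d -> 'rV[R]_m -> R) : \bar R :=
  lim ((fun T : R => (valueV f L T 0 * (T^-1)%:E)%E) @ +oo%R).

Definition peierls {d m : nat} (f : 'I_m -> 'rV[R]_d -> 'rV[R]_d)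
  (L : 'rV[R]_d -> 'rV[R]_m -> R) (x y : 'rV[R]_d) : \bar R :=
  limf_einf (fun t : R => (actionA f L t x y - cbar f L * t%:E)%E) +oo%R.

Definition linearized_sol {d m : nat} (f : 'I_m -> 'rV[R]_d -> 'rV[R]_d) (T : R)
  (g : R -> 'rV[R]_d) (u v : R -> 'rV[R]_m) (xi : R -> 'rV[R]_d) : Prop :=
  xi 0 = 0 /\ abs_cont xi 0 T /\
  {ae lebesgue_measure, forall s, (I0 T) s ->
      derivable xi s 1 /\
      'D_1 xi s = \sum_(i < m) (u s 0 i *: 'D_(xi s) (f i) (g s)) + Fu f (g s) (v s)}.

(* u is singular: the differential of the end-point map u |-> gamma_u(T)
   (given by the linearized system) is not onto R^d *)
Definition singular {d m : nat} (f : 'I_m -> 'rV[R]_d -> 'rV[R]_d) (T : R)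
  (g : R -> 'rV[R]_d) (u : R -> 'rV[R]_m) : Prop :=
  exists p : 'rV[R]_d, p != 0 /\
    forall (v : R -> 'rV[R]_m) (xi : R -> 'rV[R]_d),
      L2ctrl v T -> linearized_sol f T g u v xi ->
      \sum_(j < d) p 0 j * xi T 0 j = 0.

Definition minimizing {d m : nat} (f : 'I_m -> 'rV[R]_d -> 'rV[R]_d)
  (L : 'rV[R]_d -> 'rV[R]_m -> R) (T : R) (x : 'rV[R]_d)
  (g : R -> 'rV[R]_d) (u : R -> 'rV[R]_m) : Prop :=
  admissible f T g u /\ g 0 = x /\ cost L T g u = valueV f L T x.

Definition condS {d m : nat} (f : 'I_m -> 'rV[R]_d -> 'rV[R]_d)
  (L : 'rV[R]_d -> 'rV[R]_m -> R) : Prop :=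
  forall (T : R) (x : 'rV[R]_d) (g : R -> 'rV[R]_d) (u : R -> 'rV[R]_m),
    0 < T -> minimizing f L T x g u -> singular f T g u ->
    {ae lebesgue_measure, forall s, (I0 T) s -> u s = 0}.

End SubRiemannianWeakKAM.

(* Main.v *)
(** A point of the Aubry set is found from controllability and a pigeonhole argument.

    Controllability. Let A be the ring of linear operators on smooth functions with
    bounded derivatives.  The flow of X acts on such functions as the truncated
    exponential of t X in A[t], and the group commutator of two series
    1 + x t^a + ... and 1 + y t^b + ... is 1 + (xy - yx) t^(a+b) + ...; hence every
    iterated bracket is the leading term of a finite composition of flows of the
    fields +- f_i.  By the Hörmander condition these moves reach, up to a relative
    error, every small displacement; iterating with halved errors and concatenating
    countably many pieces joins nearby points exactly, in a short time.

    Recurrence. Let c be the infimum of cost/time over the loops of the torus.  Since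
    any two points are joined at bounded cost, every path of duration t costs at least
    c t - C, which gives V^T(0)/T -> c and h >= 0 on the diagonal.  If h(x,x) > 0 for
    all x, then by compactness every path of duration t >= 1/delta whose end points
    are delta-close costs at least c t + delta, for some uniform delta > 0.  A path of
    duration N/delta visits one of the K cells of a fine grid at least N/K times at
    multiples of 1/delta, so its cost exceeds c N/delta by about delta N/K, which
    contradicts V^T(0)/T -> c. *)
Require Import Defs.
From HB Require Import structures.
From mathcomp Require Import all_boot all_order all_algebra.
From mathcomp Require Import all_classical all_reals all_analysis.
From mathcomp Require Import ring lra measurable_realfun.
Set Implicit Arguments. Unset Strict Implicit. Unset Printing Implicit Defensive.
Import Order.TTheory GRing.Theory Num.Theory.
Import numFieldNormedType.Exports.
Local Open Scope classical_set_scope.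
Local Open Scope ring_scope.

(** * Differentiability from continuous directional derivatives *)

Section DirectionalDerivatives.
Variables (R : realType) (d : nat).
Local Notation V := 'rV[R]_d.
Implicit Types (g h : V -> R) (x v w : V).

(** Three obstacles shape the proof. Picard iteration yields integral curves by bare existence, on a
    time interval common to all starting points, and says nothing on how they depend on the starting
    point. Bracket expansions are therefore stated for values of test functions at end points, with
    remainders uniform in the starting point; this is why periodicity is turned into global bounds
    on derivatives of all orders. The test functions themselves may be unbounded, because the
    coordinates must be among them: they are what yields the displacement. Next, a bracket of length
    l displaces by t^l X, and for even l no choice of t reverses the sign; every composite move is
    thus carried together with an inverse whose leading term is opposite. Finally, cost is
    controlled through time: steering uses only the controls 0 and +-e_i, along which L is bounded
    by some B, so a connection in time t costs at most B t and short connections are cheap. The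
    recurrence argument then sees nothing but a relation between a duration, two end points and an
    upper bound on the cost. *)

Lemma is_derive_line g x v (s : R) : derivable g (x + s *: v) v ->
  is_derive s 1 (fun t : R => g (x + t *: v)) ('D_v g (x + s *: v)).
Proof.
move=> dg.
have E : (fun h : R => h^-1 *: (((fun t : R => g (x + t *: v)) \o shift s) (h *: 1)
            - g (x + s *: v))) =
         (fun h : R => h^-1 *: ((g \o shift (x + s *: v)) (h *: v) - g (x + s *: v))).
  apply/funext => h /=; congr (_ *: (g _ - _)).
  by rewrite -[h%R *: (1:R)]/(h * 1) mulr1 scalerDl addrCA addrA addrC addrA.
by apply: DeriveDef; [rewrite /derivable E|rewrite /derive E].
Qed.

Lemma line_mvt g x v (s : R) : (forall y, derivable g y v) ->
  exists2 c : R, `|c| <= `|s| & g (x + s *: v) - g x = s * 'D_v g (x + c *: v).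
Proof.
move=> dg.
have D (t : R) : is_derive t 1 (fun t : R => g (x + t *: v)) ('D_v g (x + t *: v)).
  exact: is_derive_line.
have C (A : set R) : {within A, continuous (fun t : R => g (x + t *: v))}.
  apply: continuous_subspaceT => t.
  by apply: differentiable_continuous; apply/derivable1_diffP; have [] := D t.
have [s0|s0] := leP 0 s.
  have [c + E] := MVT_segment s0 (fun t _ => D t) (@C _).
  rewrite in_itv/= => /andP[c0 cs]; exists c; first by rewrite !ger0_norm.
  by move: E; rewrite scale0r addr0 subr0 mulrC.
have [c + E] := MVT_segment (ltW s0) (fun t _ => D t) (@C _).
rewrite in_itv/= => /andP[c0 cs]; exists c.
  by rewrite !ler0_norm ?lerN2 // ltW.
by move: E; rewrite scale0r addr0 sub0r mulrN mulrC => /eqP; rewrite -opprB eqr_opp => /eqP.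
Qed.

Lemma rV_norm_coord x i : `|x 0 i| <= `|x|.
Proof.
rewrite [leRHS]/Num.Def.normr/= mx_normrE.
exact: (le_bigmax _ (fun ij => `|x ij.1 ij.2|) (0, i)).
Qed.

Lemma rV_norm_le x (c : R) : 0 <= c -> (forall i, `|x 0 i| <= c) -> `|x| <= c.
Proof.
move=> c0 xc; rewrite [leLHS]/Num.Def.normr/= mx_normrE.
by apply: bigmax_le => // -[i j] _ /=; rewrite ord1.
Qed.

Definition basis_vec (i : 'I_d) : V := delta_mx 0 i.

(** Interpolates between 0 and [x] one coordinate at a time, so that an increment of a function
    telescopes into increments along basis vectors. *)
Definition prefix_row (k : nat) x : V := \row_i (if (i < k)%N then x 0 i else 0).

Lemma prefix_rowS x (k : 'I_d) :
  prefix_row k.+1 x = prefix_row k x + x 0 k *: basis_vec k.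
Proof.
apply/rowP => i; rewrite !mxE/= ltnS leq_eqVlt.
case: (eqVneq i k) => [->|ik]; first by rewrite eqxx ltnn /= mulr1 add0r.
have -> : (i == k :> nat) = false by apply/negbTE.
by rewrite /= mulr0 addr0.
Qed.

Lemma norm_prefix_row x k : `|prefix_row k x| <= `|x|.
Proof.
apply: rV_norm_le => // i; rewrite mxE; case: ifP => _; first exact: rV_norm_coord.
by rewrite normr0.
Qed.

Lemma norm_basis_vec i : `|basis_vec i| <= 1.
Proof.
apply: rV_norm_le => // j; rewrite mxE eqxx /=.
by case: (_ == _); rewrite ?normr0 ?normr1.
Qed.

Lemma row_sum_basis x : x = \sum_i x 0 i *: basis_vec i.
Proof. exact: row_sum_delta. Qed.

Definition partial_lin (a : 'I_d -> R) : V -> R := fun x => \sum_i x 0 i * a i.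

Lemma partial_lin_linear a : linear (partial_lin a).
Proof.
move=> c x y; rewrite /partial_lin scaler_sumr -big_split/=; apply: eq_bigr => i _.
by rewrite !mxE mulrDl /GRing.scale/= mulrA.
Qed.

Lemma continuous_sum (T : topologicalType) (I : Type) (r : seq I) (P : pred I)
    (F : I -> T -> R) : (forall i, P i -> continuous (F i)) ->
  continuous (fun z : T => \sum_(i <- r | P i) F i z).
Proof.
move=> cF z; rewrite /continuous_at; elim: r => [|i r IHr].
  by rewrite big_nil; under eq_fun do rewrite big_nil; exact: cvg_cst.
rewrite big_cons; under eq_fun do rewrite big_cons.
by case: ifPn => // Pi; apply: cvgD => //; exact: cF.
Qed.

Lemma C1_differentiable g x :
  (forall i y, derivable g y (basis_vec i)) ->
  (forall i, continuous ('D_(basis_vec i) g)) -> differentiable g x.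
Proof.
move=> dg cg.
pose df : {linear V -> R} := HB.pack (partial_lin (fun i => 'D_(basis_vec i) g x))
   (GRing.isLinear.Build _ _ _ _ _ (partial_lin_linear (fun i => 'D_(basis_vec i) g x))).
have dfc : continuous df.
  move=> y; rewrite /df /=.
  apply: continuous_sum => i _ z.
  apply: (@continuousM _ _ (fun u : V => u 0 i) (cst ('D_(basis_vec i) g x))).
    exact: coord_continuous.
  exact: cst_continuous.
suff E : (g : V -> R^o) \o shift x = cst (g x : R^o) + (df : V -> R^o) +o_ (0 : V) (id : V -> V).
  apply/diff_locallyP; rewrite (diff_unique dfc E); split => //.
apply/eqaddoP => e e0 /=.
(* Each of the [d] pieces errs by at most [e' * |h|]; the divisor [d.+1] also covers [d = 0]. *)
pose e' : R := e / (d.+1)%:R.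
have e'0 : 0 < e' by rewrite divr_gt0.
have : \forall y \near x, forall i, `|'D_(basis_vec i) g x - 'D_(basis_vec i) g y| <= e'.
  apply: (@filter_forall V 'I_d (fun i y => `|'D_(basis_vec i) g x - 'D_(basis_vec i) g y| <= e') (nbhs x) _) => i.
  by move/cvgrPdist_le : (cg i x) => /(_ _ e'0).
move=> /nbhs_ballP[r /= r0 H].
have r20 : 0 < r / 2 by rewrite divr_gt0.
have Hn : \forall h \near (0 : V), `|h| < r / 2.
  by apply/nbhs_ballP; exists (r / 2) => //= y; rewrite -ball_normE /= sub0r normrN.
apply: filterS Hn => h hr.
rewrite -[X in `|X|]/(g (h + x) - (g x + partial_lin (fun i => 'D_(basis_vec i) g x) h)).
have Eh : g (h + x) - g x =
   \sum_(k < d) (g (x + prefix_row k.+1 h) - g (x + prefix_row k h)).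
  rewrite -(big_mkord xpredT (fun k => g (x + prefix_row k.+1 h) - g (x + prefix_row k h))).
  rewrite telescope_sumr //; congr (g _ - g _).
    by rewrite addrC; congr (_ + _); apply/rowP => i; rewrite mxE ltn_ord.
  by rewrite -[LHS]addr0; congr (_ + _); apply/rowP => i; rewrite !mxE.
rewrite opprD addrA Eh /partial_lin -sumrB.
apply: (@le_trans _ _ (\sum_(k < d) (`|h| * e'))); last first.
  rewrite sumr_const card_ord -mulr_natr /e'.
  rewrite (_ : `|h| * (e / d.+1%:R) * d%:R = e * `|h| * (d%:R / d.+1%:R)); last by field.
  rewrite ler_piMr ?mulr_ge0 ?normr_ge0 ?ltW //.
  by rewrite ltr_pdivrMr // mul1r ltr_nat.
apply: (le_trans (ler_norm_sum _ _ _)); apply: ler_sum => k _.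
rewrite prefix_rowS addrA.
have [c ch ->] := @line_mvt g (x + prefix_row k h) (basis_vec k) (h 0 k) (dg k).
rewrite -mulrBr normrM ler_pM //; first exact: rV_norm_coord.
rewrite distrC; apply: H => /=.
rewrite -ball_normE /= -!addrA opprD addrA subrr add0r normrN.
apply: (le_lt_trans (ler_normD _ _)).
rewrite (splitr r) ltrD //; first by apply: le_lt_trans hr; exact: norm_prefix_row.
rewrite normrZ; apply: le_lt_trans hr; apply: (@le_trans _ _ `|c|).
  by rewrite ler_piMr // norm_basis_vec.
by apply: (le_trans ch); exact: rV_norm_coord.
Qed.

End DirectionalDerivatives.

(** * Symmetry of second derivatives, functions with bounded derivatives, Lie derivatives *)

Section SmoothBounded.
Variables (R : realType) (d : nat).
Local Notation V := 'rV[R]_d.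
Implicit Types (g h : V -> R) (x v w : V).

Lemma derive_coord_sum g x w : differentiable g x ->
  'D_w g x = \sum_i w 0 i * 'D_(basis_vec R i) g x.
Proof.
move=> dg; rewrite deriveE // {1}(row_sum_basis w) linear_sum; apply: eq_bigr => i _.
by rewrite linearZ deriveE.
Qed.

Lemma is_derive_along (c : R -> V) c' (s : R) g : is_derive s (1 : R) c c' ->
  differentiable g (c s) -> is_derive s (1 : R) (g \o c) ('D_c' g (c s)).
Proof.
move=> dc dg.
have dcs : differentiable c s by apply/derivable1_diffP; case: dc.
have dgc : differentiable (g \o c) s by exact: differentiable_comp.
apply: DeriveDef; first exact: diff_derivable.
rewrite deriveE // diff_comp //= deriveE //; congr ('d g (c s) _).
by rewrite -deriveE //; case: dc.
Qed.

Lemma shift_quotient g z x v :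
  (fun h : R => h^-1 *: (((fun y => g (y + z)) \o shift x) (h *: v) - g (x + z))) =
  (fun h : R => h^-1 *: ((g \o shift (x + z)) (h *: v) - g (x + z))).
Proof. by apply/funext => h /=; rewrite addrA. Qed.

Lemma derive_shiftE g z x v : 'D_v (fun y => g (y + z)) x = 'D_v g (x + z).
Proof. by rewrite /derive shift_quotient. Qed.

Lemma derivable_shift g z x v :
  derivable g (x + z) v -> derivable (fun y => g (y + z)) x v.
Proof. by rewrite /derivable shift_quotient. Qed.

(** The mean value theorem is applied first to the difference of [g] in direction [w], along [v],
    and then to ['D_v g] along [w]. *)
Lemma second_difference g x v w (s : R) :
  (forall y, derivable g y v) -> (forall y, derivable ('D_v g) y w) ->
  exists a b : R, [/\ `|a| <= `|s|, `|b| <= `|s| &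
    g (x + s *: v + s *: w) - g (x + s *: v) - (g (x + s *: w) - g x) =
    s * s * 'D_w ('D_v g) (x + a *: v + b *: w)].
Proof.
move=> dv dvw.
pose phi y := g (y + s *: w) - g y.
have dphi y : derivable phi y v.
  rewrite -[phi]/((fun y => g (y + s *: w)) - g); apply: derivableB => //.
  exact: derivable_shift.
have [a as_ E] := @line_mvt _ _ phi x v s dphi.
have [b bs E'] := @line_mvt _ _ ('D_v g) (x + a *: v) w s dvw.
exists a, b; split => //.
rewrite -mulrA -E' -derive_shiftE -deriveB //; last exact: derivable_shift.
Qed.

(** The second difference is symmetric in [v] and [w], so the two mixed derivatives coincide at two
    points close to [x]; continuity transfers this to [x]. *)
Lemma Schwarz g x v w :
  (forall y u, derivable g y u) -> (forall y u u', derivable ('D_u g) y u') ->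
  {for x, continuous ('D_w ('D_v g))} -> {for x, continuous ('D_v ('D_w g))} ->
  'D_w ('D_v g) x = 'D_v ('D_w g) x.
Proof.
move=> dg d2g cwv cvw; apply/eqP; rewrite -subr_eq0 -normr_le0.
apply/ler_addgt0Pl => e e0; rewrite addr0.
have e2 : 0 < e / 2 by rewrite divr_gt0.
move/cvgrPdist_le : cwv => /(_ _ e2)/nbhs_ballP[r1 /= r10 H1].
move/cvgrPdist_le : cvw => /(_ _ e2)/nbhs_ballP[r2 /= r20 H2].
pose M := `|v| + `|w| + 1.
have M0 : 0 < M by rewrite ltr_wpDl // addr_ge0.
(* Chosen so that [s * (|v| + |w|)] stays below both radii of continuity. *)
pose s := Num.min r1 r2 / (2 * M).
have s0 : 0 < s by rewrite divr_gt0 ?mulr_gt0 // lt_min r10.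
have small (a b : R) (p q : V) : `|p| + `|q| + 1 = M -> `|a| <= `|s| -> `|b| <= `|s| ->
   `|a *: p + b *: q| < Num.min r1 r2.
  move=> pq al bl; apply: (le_lt_trans (ler_normD _ _)).
  rewrite !normrZ; apply: (@le_lt_trans _ _ (s * (`|p| + `|q|))).
    by rewrite mulrDr lerD // ler_pM // (le_trans al, le_trans bl) // gtr0_norm.
  apply: (@lt_le_trans _ _ (s * M)); first by rewrite ltr_pM2l // -pq ltrDl.
  have -> : s * M = Num.min r1 r2 / 2 by rewrite /s invfM mulrA divfK // gt_eqF.
  by rewrite ler_pdivrMr // ler_peMr ?ler1n // ltW // lt_min r10.
have [a [b [al bl E]]] := @second_difference g x v w s (fun y => dg y v) (fun y => d2g y v w).
have [a' [b' [al' bl' E']]] := @second_difference g x w v s (fun y => dg y w) (fun y => d2g y w v).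
have EE : 'D_w ('D_v g) (x + a *: v + b *: w) = 'D_v ('D_w g) (x + a' *: w + b' *: v).
  have ss0 : s * s != 0 by rewrite mulf_neq0 ?gt_eqF.
  apply: (mulfI ss0); apply: (etrans (esym E)); apply: etrans E'.
  have -> : x + s *: w + s *: v = x + s *: v + s *: w by rewrite addrAC.
  move: (g (x + s *: v + s *: w)) (g (x + s *: v)) (g (x + s *: w)) (g x) => p q r t.
  ring.
have B1 : `|'D_w ('D_v g) x - 'D_w ('D_v g) (x + a *: v + b *: w)| <= e / 2.
  apply: H1; rewrite -ball_normE /= -!addrA opprD addrA subrr add0r normrN.
  by have := small a b v w erefl al bl; rewrite lt_min => /andP[].
have B2 : `|'D_v ('D_w g) x - 'D_v ('D_w g) (x + a' *: w + b' *: v)| <= e / 2.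
  apply: H2; rewrite -ball_normE /= -!addrA opprD addrA subrr add0r normrN.
  have := small a' b' w v _ al' bl'; rewrite lt_min => H; apply: (andP (H _)).2.
  by rewrite /M (addrC `|w|).
rewrite (splitr e); apply: le_trans (lerD B1 B2).
by rewrite EE [X in _ <= _ + X]distrC; apply: le_trans (ler_normD _ _); rewrite subrKA.
Qed.

Definition bounded_fct g := exists C : R, forall x, `|g x| <= C.

Fixpoint CkB (k : nat) g : Prop :=
  continuous g /\
  (if k is k'.+1 then forall v,
     [/\ forall x, derivable g x v, bounded_fct ('D_v g) & CkB k' ('D_v g)]
   else True).

Definition smoothB g := forall k, CkB k g.

Lemma smoothBP g : smoothB g <->
  continuous g /\
  forall v, [/\ forall x, derivable g x v, bounded_fct ('D_v g) & smoothB ('D_v g)].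
Proof.
split=> [sg|[cg dg] [|k]].
- split; first by case: (sg 0%N).
  move=> v; split; [by case: (sg 1%N) => _ /(_ v)[]|by case: (sg 1%N) => _ /(_ v)[]|].
  by move=> k; case: (sg k.+1) => _ /(_ v)[].
- by split.
- by split=> // v; have [] := dg v.
Qed.

Lemma smoothB_cont g : smoothB g -> continuous g.
Proof. by move=> /smoothBP[]. Qed.

Lemma smoothB_derivable g : smoothB g -> forall x v, derivable g x v.
Proof. by move=> /smoothBP[_ dg] x v; case: (dg v). Qed.

Lemma smoothB_derive g v : smoothB g -> smoothB ('D_v g).
Proof. by move=> /smoothBP[_ dg]; case: (dg v). Qed.

Lemma smoothB_bounded_derive g v : smoothB g -> bounded_fct ('D_v g).
Proof. by move=> /smoothBP[_ dg]; case: (dg v). Qed.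

Lemma smoothB_differentiable g : smoothB g -> forall x, differentiable g x.
Proof.
move=> sg x; apply: C1_differentiable => i; last exact/smoothB_cont/smoothB_derive.
by move=> y; exact: smoothB_derivable.
Qed.

Lemma smoothB_schwarz g x v w : smoothB g -> 'D_w ('D_v g) x = 'D_v ('D_w g) x.
Proof.
move=> sg; apply: Schwarz.
- by move=> y u; exact: smoothB_derivable.
- by move=> y u u'; apply: smoothB_derivable; exact: smoothB_derive.
- exact/smoothB_cont/smoothB_derive/smoothB_derive.
- exact/smoothB_cont/smoothB_derive/smoothB_derive.
Qed.

Lemma bounded_fct_cst (c : R) : bounded_fct (fun=> c).
Proof. by exists `|c|. Qed.

Lemma bounded_fctD g h : bounded_fct g -> bounded_fct h ->
  bounded_fct (fun x => g x + h x).
Proof.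
by move=> [C HC] [C' HC']; exists (C + C') => x; rewrite (le_trans (ler_normD _ _)) // lerD.
Qed.

Lemma bounded_fctM g h : bounded_fct g -> bounded_fct h ->
  bounded_fct (fun x => g x * h x).
Proof. by move=> [C HC] [C' HC']; exists (C * C') => x; rewrite normrM ler_pM. Qed.

Lemma sum_fct_ind (Q : (V -> R) -> Prop) (I : Type) (r : seq I) (P : pred I)
    (F : I -> V -> R) :
  Q (fun=> 0) -> (forall g h, Q g -> Q h -> Q (fun x => g x + h x)) ->
  (forall i, P i -> Q (F i)) -> Q (fun x => \sum_(i <- r | P i) F i x).
Proof.
move=> Q0 QD QF.
have -> : (fun x => \sum_(i <- r | P i) F i x) = \sum_(i <- r | P i) F i.
  by rewrite fct_sumE.
exact: (big_ind Q).
Qed.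

Lemma bounded_fct_sum (I : Type) (r : seq I) (P : pred I) (F : I -> V -> R) :
  (forall i, P i -> bounded_fct (F i)) -> bounded_fct (fun x => \sum_(i <- r | P i) F i x).
Proof. by apply: sum_fct_ind; [exact: bounded_fct_cst|exact: bounded_fctD]. Qed.

Lemma smoothB_cst (c : R) : smoothB (fun=> c).
Proof.
move=> k; elim: k c => [|k IHk] c; split=> //; try exact: cst_continuous.
move=> v; have E : 'D_v (fun=> c) = (fun _ : V => 0 : R).
  by apply/funext => x; exact: derive_cst.
split; rewrite ?E.
- by move=> x; exact: derivable_cst.
- exact: bounded_fct_cst.
- exact: IHk.
Qed.

Lemma CkBD k g h : CkB k g -> CkB k h -> CkB k (fun x => g x + h x).
Proof.
elim: k g h => [|k IHk] g h [cg dg] [ch dh]; split => //.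
- by move=> x; apply: continuousD; [exact: cg|exact: ch].
- by move=> x; apply: continuousD; [exact: cg|exact: ch].
move=> v; have [dgv bgv kgv] := dg v; have [dhv bhv khv] := dh v.
have E : 'D_v (fun x => g x + h x) = (fun x => 'D_v g x + 'D_v h x).
  by apply/funext => x; rewrite -[LHS]/('D_v (g + h) x) deriveD.
split; rewrite ?E; [|exact: bounded_fctD|exact: IHk].
by move=> x; exact: derivableD.
Qed.

Lemma smoothBD g h : smoothB g -> smoothB h -> smoothB (fun x => g x + h x).
Proof. by move=> sg sh k; exact: CkBD. Qed.

(** The factors must be bounded too, since each term of the derivative of a product keeps one factor
    undifferentiated. *)
Lemma CkBM k g h : bounded_fct g -> bounded_fct h -> smoothB g -> smoothB h ->
  CkB k (fun x => g x * h x).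
Proof.
elim: k g h => [|k IHk] g h bg bh sg sh.
  by split => // x; apply: continuousM; exact: smoothB_cont.
split=> [x|v]; first by apply: continuousM; exact: smoothB_cont.
have E : 'D_v (fun x => g x * h x) = (fun x => g x * 'D_v h x + h x * 'D_v g x).
  apply/funext => x; rewrite -[LHS]/('D_v (g * h) x) deriveM //.
  - exact: smoothB_derivable.
  - exact: smoothB_derivable.
split; rewrite ?E.
- by move=> x; apply: derivableM; exact: smoothB_derivable.
- by apply: bounded_fctD; apply: bounded_fctM => //; exact: smoothB_bounded_derive.
- by apply: CkBD; apply: IHk => //; first [exact: smoothB_bounded_derive|exact: smoothB_derive].
Qed.

Lemma smoothBM g h : bounded_fct g -> bounded_fct h -> smoothB g -> smoothB h ->
  smoothB (fun x => g x * h x).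
Proof. by move=> bg bh sg sh k; exact: CkBM. Qed.

Lemma smoothBZ (c : R) g : smoothB g -> smoothB (fun x => c * g x).
Proof.
move=> sg k; elim: k g sg => [|k IHk] g sg.
  by split => // x; apply: continuousM; [exact: cst_continuous|exact: smoothB_cont].
split=> [x|v]; first by apply: continuousM; [exact: cst_continuous|exact: smoothB_cont].
have E : 'D_v (fun x => c * g x) = (fun x => c * 'D_v g x).
  by apply/funext => x; rewrite -[LHS]/('D_v (c \*: g) x) deriveZ //; exact: smoothB_derivable.
split; rewrite ?E.
- by move=> x; rewrite -[X in derivable X]/(c \*: g); apply: derivableZ; exact: smoothB_derivable.
- by apply: bounded_fctM; [exact: bounded_fct_cst|exact: smoothB_bounded_derive].
- by apply: IHk; exact: smoothB_derive.
Qed.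

Lemma smoothB_sum (I : Type) (r : seq I) (P : pred I) (F : I -> V -> R) :
  (forall i, P i -> smoothB (F i)) -> smoothB (fun x => \sum_(i <- r | P i) F i x).
Proof. by apply: sum_fct_ind; [exact: smoothB_cst|exact: smoothBD]. Qed.

Lemma derive_coord i x v : 'D_v (fun y : V => y 0 i) x = v 0 i.
Proof.
have /matrixP/(_ 0 i) := derive_mx (@derivable_id _ V x v).
by rewrite derive_id mxE => ->.
Qed.

Lemma derivable_coord i x v : derivable (fun y : V => y 0 i) x v.
Proof. by apply: diff_derivable; exact: differentiable_coord. Qed.

Lemma smoothB_coord i : smoothB (fun x : V => x 0 i).
Proof.
apply/smoothBP; split; first exact: coord_continuous.
move=> v; have E : 'D_v (fun y : V => y 0 i) = (fun=> v 0 i).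
  by apply/funext => x; exact: derive_coord.
split; rewrite ?E; [|exact: bounded_fct_cst|exact: smoothB_cst].
by move=> x; exact: derivable_coord.
Qed.

(** Bounded components are what lets [Lie_der X] map [smoothB] to itself: they multiply the bounded
    derivatives of the test function. *)
Definition fieldB (X : V -> V) :=
  forall i, bounded_fct (fun x => X x 0 i) /\ smoothB (fun x => X x 0 i).

Definition Lie_der (X : V -> V) g : V -> R := fun x => 'D_(X x) g x.

Lemma Lie_derE X g : smoothB g ->
  Lie_der X g = fun x => \sum_i X x 0 i * 'D_(basis_vec R i) g x.
Proof.
by move=> sg; apply/funext => x; apply: derive_coord_sum; exact: smoothB_differentiable.
Qed.

Lemma Lie_der_bounded X g : fieldB X -> smoothB g -> bounded_fct (Lie_der X g).
Proof.
move=> fX sg; rewrite Lie_derE //; apply: bounded_fct_sum => i _.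
by apply: bounded_fctM; [case: (fX i)|exact: smoothB_bounded_derive].
Qed.

Lemma Lie_der_smoothB X g : fieldB X -> smoothB g -> smoothB (Lie_der X g).
Proof.
move=> fX sg; rewrite Lie_derE //; apply: smoothB_sum => i _.
have [bX sX] := fX i.
by apply: smoothBM => //; [exact: smoothB_bounded_derive|exact: smoothB_derive].
Qed.

Lemma field_derivable X : fieldB X -> forall x v, derivable X x v.
Proof.
move=> fX x v; apply/derivable_mxP => i j; rewrite ord1.
by apply: smoothB_derivable; case: (fX j).
Qed.

Lemma derive_fieldE X x v i : fieldB X ->
  ('D_v X x) 0 i = 'D_v (fun y => X y 0 i) x.
Proof. by move=> fX; rewrite derive_mx ?mxE //; exact: field_derivable. Qed.

Lemma lie_bracketE X Y x i : fieldB X -> fieldB Y ->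
  (lie_bracket X Y x) 0 i =
  Lie_der X (fun y => Y y 0 i) x - Lie_der Y (fun y => X y 0 i) x.
Proof. by move=> fX fY; rewrite !mxE !derive_fieldE. Qed.

Lemma fieldB_lie_bracket X Y : fieldB X -> fieldB Y -> fieldB (lie_bracket X Y).
Proof.
move=> fX fY i.
have E : (fun x => lie_bracket X Y x 0 i) =
  (fun x => Lie_der X (fun y => Y y 0 i) x + (-1) * Lie_der Y (fun y => X y 0 i) x).
  by apply/funext => x; rewrite lie_bracketE // mulN1r.
have [bX sX] := fX i; have [bY sY] := fY i; rewrite E; split.
  apply: bounded_fctD; first exact: Lie_der_bounded.
  by apply: bounded_fctM; [exact: bounded_fct_cst|exact: Lie_der_bounded].
by apply: smoothBD; [|apply: smoothBZ]; exact: Lie_der_smoothB.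
Qed.

Lemma derive_Lie_der X g x v : fieldB X -> smoothB g ->
  'D_v (Lie_der X g) x = \sum_i ('D_v (fun y => X y 0 i) x * 'D_(basis_vec R i) g x
     + X x 0 i * 'D_v ('D_(basis_vec R i) g) x).
Proof.
move=> fX sg; rewrite Lie_derE //.
have -> : (fun y => \sum_i X y 0 i * 'D_(basis_vec R i) g y) =
   \sum_i ((fun y => X y 0 i) * 'D_(basis_vec R i) g).
  by apply/funext => y; rewrite fct_sumE.
have dX i : derivable (fun y => X y 0 i) x v by apply: smoothB_derivable; case: (fX i).
have dg i : derivable ('D_(basis_vec R i) g) x v.
  by apply: smoothB_derivable; exact: smoothB_derive.
rewrite derive_sum; last by move=> i; exact: derivableM.
apply: eq_bigr => i _; rewrite deriveM // addrC; congr (_ + _).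
by rewrite mulrC.
Qed.

(** The second-order terms of the two compositions agree by [smoothB_schwarz]; the first-order terms
    that remain are those of the bracket. This is what makes a bracket of fields a commutator in a
    ring. *)
Lemma Lie_der_bracket X Y g : fieldB X -> fieldB Y -> smoothB g ->
  Lie_der (lie_bracket X Y) g =
  fun x => Lie_der X (Lie_der Y g) x - Lie_der Y (Lie_der X g) x.
Proof.
move=> fX fY sg; apply/funext => x.
have dg i u : 'D_u ('D_(basis_vec R i) g) x =
   \sum_j u 0 j * 'D_(basis_vec R j) ('D_(basis_vec R i) g) x.
  apply: derive_coord_sum; apply: smoothB_differentiable; exact: smoothB_derive.
have LL (X' Y' : V -> V) : fieldB Y' -> Lie_der X' (Lie_der Y' g) x =
    \sum_i Lie_der X' (fun y => Y' y 0 i) x * 'D_(basis_vec R i) g x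
    + \sum_i Y' x 0 i * 'D_(X' x) ('D_(basis_vec R i) g) x.
  by move=> fY'; rewrite -big_split; exact: derive_Lie_der.
rewrite (LL X Y fY) (LL Y X fX).
have BD : \sum_i Y x 0 i * 'D_(X x) ('D_(basis_vec R i) g) x =
          \sum_i X x 0 i * 'D_(Y x) ('D_(basis_vec R i) g) x.
  transitivity (\sum_i \sum_j Y x 0 i * (X x 0 j * 'D_(basis_vec R j) ('D_(basis_vec R i) g) x)).
    by apply: eq_bigr => i _; rewrite dg mulr_sumr.
  transitivity (\sum_j \sum_i Y x 0 i * (X x 0 j * 'D_(basis_vec R j) ('D_(basis_vec R i) g) x)).
    exact: exchange_big.
  apply: eq_bigr => i _; rewrite dg mulr_sumr; apply: eq_bigr => j _.
  by rewrite (smoothB_schwarz x (basis_vec R j) (basis_vec R i) sg) mulrCA.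
have sub_cancel (p q r t : R) : q = t -> p + q - (r + t) = p - r.
  by move=> ->; rewrite opprD addrACA subrr addr0.
apply: etrans (esym (sub_cancel _ _ _ _ BD)); apply: etrans (sumrB _ _ _ _).
rewrite (Lie_derE _ sg); apply: eq_bigr => i _.
by rewrite (lie_bracketE x i fX fY) mulrBl.
Qed.

End SmoothBounded.

(** * Periodic fields: boundedness and Lipschitz constants *)

Section Torus.
Variables (R : realType) (d : nat).
Local Notation V := 'rV[R]_d.

Definition unit_cube : set V := [set x | forall i, `[0, 1]%classic (x ord0 i)].

Lemma unit_cube_compact : compact unit_cube.
Proof.
apply: (@rV_compact (R : realType) d (fun=> `[0, 1]%classic)) => i.
exact: segment_compact.
Qed.

Definition floor_vec (x : V) : 'rV[int]_d := \row_i Num.floor (x 0 i).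

Lemma sub_floor_vec_cube (x : V) : unit_cube (x - intvec R (floor_vec x)).
Proof.
move=> i; rewrite /= in_itv /= !mxE subr_ge0 lerBlDr.
rewrite Num.Theory.floor_le // addrC ltW //.
by have := Num.Theory.lt_succ_floor (x 0 i); rewrite intrD addrC.
Qed.

Lemma intvecD (y z : 'rV[int]_d) : intvec R (y + z) = intvec R y + intvec R z.
Proof. by apply/rowP => i; rewrite !mxE rmorphD. Qed.

Lemma intvecN (z : 'rV[int]_d) : intvec R (- z) = - intvec R z.
Proof. by apply/rowP => i; rewrite !mxE rmorphN. Qed.

Lemma intvec0 : intvec R (0 : 'rV[int]_d) = 0.
Proof. by apply/rowP => i; rewrite !mxE. Qed.

Lemma cube_reduction (T : Type) (g : V -> T) (P : T -> Prop) : Zd_periodic g ->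
  (forall y, unit_cube y -> P (g y)) -> forall x, P (g x).
Proof.
move=> pg Pg x; rewrite -(subrK (intvec R (floor_vec x)) x) pg.
exact/Pg/sub_floor_vec_cube.
Qed.

Lemma periodic_bounded (g : V -> R) : Zd_periodic g -> continuous g -> bounded_fct g.
Proof.
move=> pg cg.
have ne : unit_cube !=set0 by exists 0 => i /=; rewrite in_itv /= mxE lexx ler01.
have cn : {within unit_cube, continuous (fun x : V => `|g x|)}.
  apply: continuous_subspaceT => x; apply: (@continuous_comp _ _ _ g (fun r : R => `|r|)).
    exact: cg.
  exact: norm_continuous.
have [c _ Hc] := compact_EVT_max ne unit_cube_compact cn.
exists `|g c|; apply: (@cube_reduction _ g (fun r => `|r| <= `|g c|)) => // y yC.
by apply: Hc; rewrite inE.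
Qed.

Lemma Zd_periodic_derive (W : normedModType R) (g : V -> W) v :
  Zd_periodic g -> Zd_periodic ('D_v g).
Proof.
move=> pg x z; rewrite /derive.
suff -> : (fun h : R => h^-1 *: ((g \o shift (x + intvec R z)) (h *: v) - g (x + intvec R z))) =
  (fun h : R => h^-1 *: ((g \o shift x) (h *: v) - g x)) by [].
by apply/funext => h /=; rewrite addrA !pg.
Qed.

Lemma Dlist_derive (W : normedModType R) (vs : seq V) v (g : V -> W) :
  Dlist vs ('D_v g) = Dlist (rcons vs v) g.
Proof. by elim: vs => //= w vs ->. Qed.

Lemma Ck_derive (W : normedModType R) k v (g : V -> W) : Ck k.+1 g -> Ck k ('D_v g).
Proof.
move=> kg vs sz; rewrite Dlist_derive.
have szr : (size (rcons vs v) <= k.+1)%N by rewrite size_rcons.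
have [c Hd] := kg _ szr; split => // lt; apply: Hd.
by rewrite size_rcons.
Qed.

(** Directional derivatives of a periodic field are periodic, so compactness of the unit cube bounds
    all of them by induction. *)
Lemma periodic_Ck_CkB k (X : V -> V) i : Zd_periodic X -> Ck k X ->
  bounded_fct (fun x => X x 0 i) /\ CkB k (fun x => X x 0 i).
Proof.
elim: k X => [|k IHk] X pX kX.
  have cX : continuous (fun x => X x 0 i).
    move=> x; apply: (@continuous_comp _ _ _ X (fun y : V => y 0 i)).
      exact: (kX [::] isT).1.
    exact: coord_continuous.
  split => //; apply: periodic_bounded => // x z; by rewrite pX.
have cX : continuous (fun x => X x 0 i).
  move=> x; apply: (@continuous_comp _ _ _ X (fun y : V => y 0 i)).
    exact: (kX [::] isT).1.
  exact: coord_continuous.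
split; first by apply: periodic_bounded => // x z; rewrite pX.
split => // v.
have dX x : derivable X x v by exact: (kX [::] isT).2.
have E : 'D_v (fun x => X x 0 i) = (fun x => ('D_v X x) 0 i).
  by apply/funext => x; rewrite derive_mx // mxE.
have [bD kD] := IHk ('D_v X) (Zd_periodic_derive v pX) (Ck_derive v kX).
split; rewrite ?E //.
by move=> x; move/derivable_mxP : (dX x); exact.
Qed.

Lemma periodic_smooth_fieldB (X : V -> V) : Zd_periodic X -> smooth X -> fieldB X.
Proof.
move=> pX sX i; split; first exact: (periodic_Ck_CkB i pX (sX 0%N)).1.
by move=> k; exact: (periodic_Ck_CkB i pX (sX k)).2.
Qed.

Lemma fieldB_bounded (X : V -> V) : fieldB X -> exists C : R, forall x, `|X x| <= C.
Proof.
move=> fX.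
have [C HC] := @choice 'I_d R (fun i C => forall x, `|X x 0 i| <= C) (fun i => (fX i).1).
exists (\sum_i `|C i|) => x; apply: rV_norm_le => [|i]; first exact: sumr_ge0.
rewrite (bigD1 i) //=; apply: (le_trans (HC i x)); apply: (le_trans (ler_norm _)).
by rewrite lerDl; exact: sumr_ge0.
Qed.

Lemma basis_expansion_bound (a : 'I_d -> R) (v : V) (C : R) :
  (forall i, `|a i| <= C) -> `|\sum_i v 0 i * a i| <= d%:R * C * `|v|.
Proof.
move=> aC; apply: (le_trans (ler_norm_sum _ _ _)).
apply: (@le_trans _ _ (\sum_(i < d) C * `|v|)).
  by apply: ler_sum => i _; rewrite normrM mulrC ler_pM // rV_norm_coord.
by rewrite sumr_const card_ord -(mulr_natl (C * `|v|)) mulrA.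
Qed.

Lemma smoothB_lipschitz (g : V -> R) : smoothB g ->
  exists2 K : R, 0 <= K & forall x y, `|g x - g y| <= K * `|x - y|.
Proof.
move=> sg.
have [C HC] := @choice 'I_d R (fun i C => forall x, `|'D_(basis_vec R i) g x| <= C)
  (fun i => smoothB_bounded_derive (basis_vec R i) sg).
pose M := \sum_i `|C i|.
have HM i x : `|'D_(basis_vec R i) g x| <= M.
  apply: (le_trans (HC i x)); rewrite /M (bigD1 i) //=.
  by apply: (le_trans (ler_norm _)); rewrite lerDl; exact: sumr_ge0.
exists (d%:R * M); first by rewrite mulr_ge0 // sumr_ge0.
move=> x y.
have [c _] := @line_mvt _ _ g y (x - y) 1 (fun z => @smoothB_derivable _ _ _ sg z (x - y)).
rewrite scale1r mul1r (addrC y) subrK => ->.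
rewrite derive_coord_sum; last exact: smoothB_differentiable.
exact: basis_expansion_bound.
Qed.

Lemma fieldB_lipschitz (X : V -> V) : fieldB X ->
  exists2 K : R, 0 <= K & forall x y, `|X x - X y| <= K * `|x - y|.
Proof.
move=> fX.
have [i|C HC] := @choice 'I_d R
    (fun i C => 0 <= C /\ forall x y, `|X x 0 i - X y 0 i| <= C * `|x - y|).
  by have [K K0 HK] := smoothB_lipschitz (fX i).2; exists K.
exists (\sum_i C i); first by apply: sumr_ge0 => i _; case: (HC i).
move=> x y; apply: rV_norm_le => [|i].
  by rewrite mulr_ge0 // sumr_ge0 // => i _; case: (HC i).
rewrite !mxE; apply: (le_trans ((HC i).2 x y)); rewrite ler_wpM2r // (bigD1 i) //=.
by rewrite lerDl sumr_ge0 // => j _; case: (HC j).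
Qed.

End Torus.

(** * Picard iteration *)

Section Flow.
Variable R : realType.

Lemma mvt_norm_bound (h dh : R -> R) (a b C : R) : a <= b ->
  {within `[a, b], continuous h} ->
  (forall s, a < s < b -> is_derive s (1 : R) h (dh s)) ->
  (forall s, a < s < b -> `|dh s| <= C) -> `|h b - h a| <= C * (b - a).
Proof.
rewrite le_eqVlt => /orP[/eqP-> _ _ _|ab ch dhs dhC]; first by rewrite !subrr normr0 mulr0.
have dhs' s : s \in `]a, b[%R -> is_derive s (1 : R) h (dh s).
  by rewrite in_itv /=; exact: dhs.
have [c cab ->] := MVT ab dhs' ch.
have ba0 : 0 <= b - a by rewrite subr_ge0 ltW.
rewrite normrM (ger0_norm ba0) ler_wpM2r //.
by apply: dhC; rewrite in_itv /= in cab.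
Qed.

(** For negative [t] the interval is empty and the value is 0; Picard iterates thus rest at their
    starting point before time 0 and are Lipschitz on the whole line. *)
Definition primitive (f : R -> R) (t : R) : R :=
  \int[lebesgue_measure]_(s in `[0, t]) f s.

Lemma primitive_le0 f t : t <= 0 -> primitive f t = 0.
Proof.
rewrite /primitive le_eqVlt => /orP[/eqP->|t0].
  by rewrite set_itv1 Rintegral_set1.
by rewrite set_itv_ge ?Rintegral_set0 // -leNgt bnd_simp.
Qed.

Lemma integrable_continuous_itv f (a b : R) : continuous f ->
  lebesgue_measure.-integrable `[a, b] (EFin \o f).
Proof.
move=> cf; apply: continuous_compact_integrable; first exact: segment_compact.
exact: continuous_subspaceT.
Qed.

Lemma is_derive_primitive f (t : R) : continuous f -> 0 < t ->
  is_derive t (1 : R) (primitive f) (f t).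
Proof.
move=> cf t0.
have tt : t < t + 1 by rewrite ltrDl.
have [] := @continuous_FTC1 R f (BLeft 0) t (t + 1) tt (integrable_continuous_itv 0 (t + 1) cf).
- by rewrite lte_fin.
- exact: cf.
by move=> D E; apply: DeriveDef; [exact: D|rewrite -E derive1E].
Qed.

Lemma primitive_bound f (M t : R) : continuous f -> (forall s, `|f s| <= M) -> 0 <= t ->
  `|primitive f t| <= M * t.
Proof.
move=> cf fM t0.
apply: (le_trans (le_normr_Rintegral _ _)) => //; first exact: integrable_continuous_itv.
have cn : continuous (fun s => `|f s|).
  move=> s; apply: (@continuous_comp _ _ _ f (fun r : R => `|r|)); first exact: cf.
  exact: norm_continuous.
apply: (le_trans (@le_Rintegral _ _ _ lebesgue_measure `[0, t]%classic (fun s => `|f s|) (fun=> M) _ _ _ _)) => //.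
- exact: (integrable_continuous_itv 0 t cn).
- exact/(@integrable_continuous_itv (fun=> M))/cst_continuous.
- rewrite Rintegral_cst //= lebesgue_measure_itv /= lte_fin.
  by case: ltrP => [|t0'] /=; rewrite ?subr0 // mulr0 mulr_ge0 // (le_trans _ (fM 0)).
Qed.

Lemma primitive_lipschitz f (M : R) : continuous f -> (forall s, `|f s| <= M) ->
  forall s t, `|primitive f s - primitive f t| <= M * `|s - t|.
Proof.
move=> cf fM.
have M0 : 0 <= M by rewrite (le_trans _ (fM 0)).
have H s t : s <= t -> `|primitive f t - primitive f s| <= M * (t - s).
  move=> st; have [s0|s0] := leP s 0.
    rewrite (primitive_le0 f s0) subr0; have [t0|t0] := leP t 0.
      by rewrite primitive_le0 // normr0 mulr_ge0 // subr_ge0.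
    apply: (le_trans (primitive_bound cf fM (ltW t0))).
    by rewrite ler_wpM2l // lerBrDr gerDl.
  apply: (@mvt_norm_bound _ f) => //.
  - apply: continuous_in_subspaceT => u; rewrite inE /= in_itv /= => /andP[su _].
    apply: differentiable_continuous; apply/derivable1_diffP.
    by have [] := is_derive_primitive cf (lt_le_trans s0 su).
  - by move=> u /andP[su _]; apply: is_derive_primitive => //; exact: lt_trans su.
move=> s t; have [st|/ltW ts] := leP s t.
  by rewrite distrC (distrC s) (ger0_norm (_ : 0 <= t - s)) ?subr_ge0 //; exact: H.
by rewrite (ger0_norm (_ : 0 <= s - t)) ?subr_ge0 //; exact: H.
Qed.

Lemma lipschitz_continuous1 (U W : normedModType R) (g : U -> W) (M : R) :
  (forall s t, `|g s - g t| <= M * `|s - t|) -> continuous g.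
Proof.
move=> gM s; apply/cvgrPdist_le => e e0.
have M0 : 0 < `|M| + 1 by rewrite ltr_wpDl.
have H : \forall t \near s, `|s - t| < e / (`|M| + 1).
  by apply/nbhs_ballP; exists (e / (`|M| + 1)); rewrite /= ?divr_gt0 // => t; rewrite -ball_normE.
apply: filterS H => t st; apply: (le_trans (gM s t)).
apply: (@le_trans _ _ ((`|M| + 1) * `|s - t|)).
  by rewrite ler_wpM2r // (le_trans (ler_norm M)) // lerDl.
by rewrite mulrC -ler_pdivlMr // ltW.
Qed.

Lemma le_geometric (a b C : R) : (forall n, a - b <= C * 2^-1 ^+ n) -> a <= b.
Proof.
move=> H; rewrite leNgt; apply/negP => ba.
have ab0 : 0 < a - b by rewrite subr_gt0.
(* [upper_nthrootP] gives [x < 2 ^+ n] as soon as [Num.bound x <= n]. *)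
have := Num.Theory.upper_nthrootP (leqnn (Num.bound (C / (a - b)))).
set n := Num.bound _; rewrite ltr_pdivrMr //.
have := H n; rewrite exprVn ler_pdivlMr ?exprn_gt0 // mulrC => h1 h2.
by have := le_lt_trans h1 h2; rewrite ltxx.
Qed.

Lemma primitive_continuous f (M : R) : continuous f -> (forall s, `|f s| <= M) ->
  continuous (primitive f).
Proof.
by move=> cf fM; exact: (@lipschitz_continuous1 R^o R^o _ M (primitive_lipschitz cf fM)).
Qed.

Lemma primitive_compare f g (M C t : R) : continuous f -> continuous g ->
  (forall s, `|f s| <= M) -> (forall s, `|g s| <= M) -> 0 <= t ->
  (forall s, 0 < s < t -> `|f s - g s| <= C) ->
  `|primitive f t - primitive g t| <= C * t.
Proof.
move=> cf cg fM gM t0 fg.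
have := @mvt_norm_bound (fun s => primitive f s - primitive g s) (fun s => f s - g s) 0 t C t0.
rewrite (primitive_le0 f (lexx 0)) (primitive_le0 g (lexx 0)) !subr0; apply => //.
  apply: continuous_subspaceT => s; apply: continuousB; exact: primitive_continuous.
move=> s /andP[s0 _]; apply: is_deriveB; exact: is_derive_primitive.
Qed.

(** The intervals of centre [u n] and radius [2 * C * 2^-n] are nested, because a step moves the
    centre by at most half the radius; the supremum of the left ends lies in all of them. *)
Lemma geometric_limit (u : nat -> R) (C : R) :
  (forall n, `|u n.+1 - u n| <= C * 2^-1 ^+ n) ->
  exists l, forall n, `|u n - l| <= 2 * C * 2^-1 ^+ n.
Proof.
move=> uC.
pose lo n := u n - 2 * C * 2^-1 ^+ n; pose hi n := u n + 2 * C * 2^-1 ^+ n.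
have loS n : lo n <= lo n.+1.
  rewrite /lo exprS; have := uC n; rewrite ler_norml => /andP[+ _].
  move: (2^-1 ^+ n) => q; lra.
have hiS n : hi n.+1 <= hi n.
  rewrite /hi exprS; have := uC n; rewrite ler_norml => /andP[_].
  move: (2^-1 ^+ n) => q; lra.
have C0 : 0 <= C by have := uC 0%N; rewrite expr0 mulr1; apply: le_trans.
have lohi n : lo n <= hi n.
  have : 0 <= 2 * C * 2^-1 ^+ n by rewrite !mulr_ge0 ?exprn_ge0.
  rewrite /lo /hi; lra.
have lom : {homo lo : m n / (m <= n)%N >-> m <= n}.
  by apply: homo_leq loS => //; exact: le_trans.
have him : {homo hi : m n / (m <= n)%N >-> n <= m}.
  by apply: homo_leq hiS => // x y z xy yz; exact: le_trans xy.
have lohi' m n : lo m <= hi n.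
  apply: (le_trans (lom _ _ (leq_maxl m n))); apply: (le_trans (lohi _)).
  exact/him/leq_maxr.
pose A := range lo.
have supA : has_sup A.
  by split; [exists (lo 0%N); exists 0%N|exists (hi 0%N) => _ [n _ <-]].
exists (sup A) => n; rewrite ler_norml.
have H1 : lo n <= sup A by apply: sup_upper_bound => //; exists n.
have H2 : sup A <= hi n by apply: ge_sup; [exists (lo 0%N); exists 0%N|move=> _ [m _ <-]].
move: H1 H2; rewrite /lo /hi; lra.
Qed.

Variables (d : nat).
Local Notation V := 'rV[R]_d.

Lemma is_derive_row (c : R -> V) (s : R) (v : V) :
  (forall i, is_derive s (1 : R) (fun t => c t 0 i) (v 0 i)) -> is_derive s (1 : R) c v.
Proof.
move=> H; have D : derivable c s 1.
  by apply/derivable_mxP => i j; rewrite ord1; case: (H j).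
apply: DeriveDef => //; apply/rowP => i; rewrite derive_mx // mxE.
by case: (H i).
Qed.

(** The field is globally Lipschitz, so [tau] can be chosen before [x]. Only existence is
    claimed. *)
Lemma Picard (X : V -> V) (M : R) : fieldB X -> (forall x, `|X x| <= M) ->
  exists2 tau : R, 0 < tau & forall x, exists c : R -> V, [/\ c 0 = x,
    forall s, 0 < s < tau -> is_derive s (1 : R) c (X (c s)) &
    forall s t, `|c s - c t| <= M * `|s - t|].
Proof.
move=> fX XM; have [K K0 XK] := fieldB_lipschitz fX.
(* Makes the Picard map [P] a contraction of ratio 1/2 on [[0, tau]]; [K + 1] keeps the denominator
   positive when [K = 0]. *)
pose tau : R := (2 * (K + 1))^-1; have K10 : 0 < K + 1 by rewrite ltr_wpDl.
have tau0 : 0 < tau by rewrite invr_gt0 mulr_gt0.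
have Ktau : K * tau <= 2^-1.
  rewrite /tau invfM mulrCA ler_piMr // ler_pdivrMr // mul1r lerDl //.
have M0 : 0 <= M by rewrite (le_trans _ (XM 0)).
exists tau => // x.
have cX : continuous X by exact: (@lipschitz_continuous1 V V X K XK).
pose P (c : R -> V) : R -> V := fun t => x + \row_i primitive (fun s => X (c s) 0 i) t.
pose lip (c : R -> V) := forall s t, `|c s - c t| <= M * `|s - t|.
have ccomp c i : lip c -> continuous (fun s => X (c s) 0 i).
  move=> lc s; apply: (@continuous_comp _ _ _ (X \o c) (fun y : V => y 0 i)).
    apply: continuous_comp; first exact: (lipschitz_continuous1 lc).
    exact: cX.
  exact: coord_continuous.
have bcomp (c : R -> V) i s : `|X (c s) 0 i| <= M.
  by apply: (le_trans (rV_norm_coord _ _)).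
have Plip c : lip c -> lip (P c).
  move=> lc s t; rewrite /P opprD addrACA subrr add0r.
  apply: rV_norm_le => [|i]; first by rewrite mulr_ge0.
  by rewrite !mxE; apply: primitive_lipschitz => //; exact: ccomp.
have Pcmp c c' (C t : R) : lip c -> lip c' -> 0 <= t -> t <= tau -> 0 <= C ->
    (forall s, 0 < s < t -> `|c s - c' s| <= C) -> `|P c t - P c' t| <= C / 2.
  move=> lc lc' t0 tt C0 cc; rewrite /P opprD addrACA subrr add0r.
  apply: rV_norm_le => [|i]; first by rewrite divr_ge0.
  rewrite !mxE; apply: (@le_trans _ _ (K * C * t)).
    apply: (@primitive_compare _ _ M) => //; try exact: ccomp.
    move=> s /cc H; apply: (@le_trans _ _ `|X (c s) - X (c' s)|).
      by have := rV_norm_coord (X (c s) - X (c' s)) i; rewrite !mxE.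
    by apply: (le_trans (XK _ _)); rewrite ler_wpM2l.
  rewrite mulrAC mulrC ler_wpM2l //; apply: le_trans Ktau.
  by rewrite ler_wpM2l.
pose c n := iter n P (fun=> x).
have lc n : lip (c n).
  by elim: n => [s t|n IHn]; [rewrite subrr normr0 mulr_ge0|exact: Plip].
have cst0 n t : t <= 0 -> c n t = x.
  case: n => // n t0; rewrite /c /= /P; apply/rowP => i.
  by rewrite !mxE primitive_le0 // addr0.
have cdiff n t : 0 <= t -> t <= tau -> `|c n.+1 t - c n t| <= M * tau * 2^-1 ^+ n.
  elim: n t => [|n IHn] t t0 tt.
    rewrite mulr1 (_ : c 0%N t = c 1%N 0); last by rewrite (cst0 1%N).
    by apply: (le_trans (lc 1%N t 0)); rewrite subr0 ger0_norm // ler_wpM2l.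
  have -> : M * tau * 2^-1 ^+ n.+1 = M * tau * 2^-1 ^+ n / 2 by rewrite exprSr mulrA.
  apply: (Pcmp _ _ _ _ (lc n.+1) (lc n) t0 tt).
    by rewrite mulr_ge0 ?exprn_ge0 // mulr_ge0 // ltW.
  by move=> s /andP[s0 st]; apply: IHn; [exact: ltW|exact: le_trans (ltW st) tt].
(* The iterates are known to converge on [[0, tau]] only; reading them at clamped times defines a
   limit that is Lipschitz on the whole line. *)
pose clamp (t : R) := Num.max 0 (Num.min t tau).
have clamp0 t : 0 <= clamp t by rewrite le_max lexx.
have clampt t : clamp t <= tau by rewrite ge_max ltW //= ge_min lexx orbT.
have clampE t : 0 <= t -> t <= tau -> clamp t = t.
  by move=> t0 tt; rewrite /clamp min_l // max_r.
have clampL s t : `|clamp s - clamp t| <= `|s - t|.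
  have H a b : a <= b -> `|clamp b - clamp a| <= `|b - a|.
    move=> ab; rewrite (ger0_norm (_ : 0 <= b - a)) ?subr_ge0 //.
    rewrite /clamp; case: (lerP b tau) => bt; case: (lerP a tau) => at_;
      case: (lerP 0 b) => b0; case: (lerP 0 a) => a0; rewrite ?(max_r (ltW tau0)) ler_norml; lra.
  by have [/H|/ltW/H//] := leP s t; rewrite distrC (distrC s).
have [t|g Hg] := @choice R V (fun t v => forall n, `|c n (clamp t) - v| <= 2 * (M * tau) * 2^-1 ^+ n).
  have [i|l Hl] := @choice 'I_d R (fun i l => forall n, `|c n (clamp t) 0 i - l| <= 2 * (M * tau) * 2^-1 ^+ n).
    apply: (@geometric_limit (fun n => c n (clamp t) 0 i)) => n.
    apply: le_trans (cdiff n _ (clamp0 t) (clampt t)).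
    by have := rV_norm_coord (c n.+1 (clamp t) - c n (clamp t)) i; rewrite !mxE.
  exists (\row_i l i) => n; apply: rV_norm_le => [|i].
    by rewrite mulr_ge0 ?exprn_ge0 // mulr_ge0 // mulr_ge0 // ltW.
  by rewrite !mxE.
have lg : lip g.
  move=> s t; apply: (@le_geometric _ _ (4 * (M * tau))) => n.
  rewrite lerBlDl; apply: (le_trans (ler_distD (c n (clamp t)) _ _)).
  have := ler_distD (c n (clamp s)) (g s) (c n (clamp t)).
  rewrite (distrC (g s) (c n (clamp s))) => h1; have h2 := Hg s n; have h3 := Hg t n.
  have h4 : `|c n (clamp s) - c n (clamp t)| <= M * `|s - t|.
    by apply: (le_trans (lc n _ _)); rewrite ler_wpM2l.
  lra.
have gE t : 0 <= t -> t <= tau -> g t = P g t.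
  move=> t0 tt; apply/subr0_eq/eqP; rewrite -normr_le0.
  apply: (@le_geometric _ _ (2 * (M * tau))) => n; rewrite subr0.
  apply: (le_trans (ler_distD (c n.+1 t) _ _)).
  have h1 := Hg t n.+1; rewrite clampE // distrC exprS in h1.
  have h2 : `|c n.+1 t - P g t| <= (2 * (M * tau) * 2^-1 ^+ n) / 2.
    apply: (Pcmp _ _ _ _ (lc n) lg t0 tt); first by rewrite mulr_ge0 ?exprn_ge0 // mulr_ge0 // mulr_ge0 // ltW.
    move=> s /andP[s0 st]; have := Hg s n; rewrite clampE //; first exact: ltW.
    by apply: le_trans tt; exact: ltW.
  by move: h1 h2; clear; lra.
exists g; split; last exact: lg.
  rewrite (gE 0 (lexx 0) (ltW tau0)) /P -[RHS]addr0; congr (_ + _).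
  by apply/rowP => i; rewrite !mxE primitive_le0.
move=> s /andP[s0 st].
have Pg : is_derive s (1 : R) (P g) (X (g s)).
  apply: is_derive_row => i.
  have -> : (fun t => P g t 0 i) = (fun t => x 0 i + primitive (fun s => X (g s) 0 i) t).
    by apply/funext => t; rewrite !mxE.
  rewrite -[X (g s) 0 i]add0r; apply: is_deriveD.
  by apply: is_derive_primitive => //; exact: ccomp.
apply: near_eq_is_derive Pg => //.
have : \forall t \near s, 0 < t < tau.
  by apply: (@near_in_itvoo R 0 tau); rewrite in_itv /= s0.
by apply: filterS => t /andP[t0 tt]; rewrite gE // ltW.
Qed.

End Flow.

(** * Operators on smooth functions and truncated exponentials *)

Section Operators.
Variables (R : realType) (d : nat).
Local Notation V := 'rV[R]_d.

Definition smoothB_pred : {pred V -> R} := fun g : V -> R => `[< smoothB g >].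

Lemma smoothB_submod_closed : submod_closed smoothB_pred.
Proof.
split; first by apply/asboolP; exact: smoothB_cst.
move=> c g h /asboolP sg /asboolP sh; apply/asboolP.
by apply: smoothBD => //; exact: smoothBZ.
Qed.

HB.instance Definition _ := GRing.isSubmodClosed.Build R (V -> R) smoothB_pred smoothB_submod_closed.

Record smooth_fct := SmoothFct { sval_fct :> V -> R ; sval_fctP : sval_fct \in smoothB_pred }.
HB.instance Definition _ := [isSub for sval_fct].
HB.instance Definition _ := [Choice of smooth_fct by <:].
HB.instance Definition _ := [SubChoice_isSubLmodule of smooth_fct by <:].

Lemma smooth_fctB (g : smooth_fct) : smoothB g.
Proof. by have /asboolP := sval_fctP g. Qed.

Definition mk_smooth (g : V -> R) (sg : smoothB g) : smooth_fct :=
  SmoothFct (introT (asboolP _) sg : g \in smoothB_pred).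

Definition linop_pred : {pred smooth_fct -> smooth_fct} :=
  fun A : smooth_fct -> smooth_fct => `[< linear A >].

Lemma linop_zmod_closed : zmod_closed linop_pred.
Proof.
split; first by apply/asboolP => c g h; rewrite /= scaler0 addr0.
move=> A B /asboolP lA /asboolP lB; apply/asboolP => c g h.
rewrite !fctE lA lB scalerBr opprD !addrA; congr (_ + _).
by rewrite addrAC.
Qed.

HB.instance Definition _ := GRing.isZmodClosed.Build (smooth_fct -> smooth_fct) linop_pred linop_zmod_closed.

(** Composition is the product of this noncommutative ring, so that [{poly linop}] holds the formal
    expansions in time of flows. *)
Record linop := LinOp { linop_fun :> smooth_fct -> smooth_fct ; linop_funP : linop_fun \in linop_pred }.
HB.instance Definition _ := [isSub for linop_fun].
HB.instance Definition _ := [Choice of linop by <:].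
HB.instance Definition _ := [SubChoice_isSubZmodule of linop by <:].

Lemma linop_linear (A : linop) : linear A.
Proof. by have /asboolP := linop_funP A. Qed.

Definition mk_linop (A : smooth_fct -> smooth_fct) (lA : linear A) : linop :=
  LinOp (introT (asboolP _) lA : A \in linop_pred).

Lemma linop_id_linear : linear (@id smooth_fct). Proof. by []. Qed.
Definition linop_one := mk_linop linop_id_linear.

Lemma linop_comp_linear (A B : linop) : linear (A \o B).
Proof. by move=> c g h /=; rewrite !linop_linear. Qed.
Definition linop_mul (A B : linop) := mk_linop (linop_comp_linear A B).

Lemma linop_eq (A B : linop) : (forall g x, A g x = B g x) -> A = B.
Proof. by move=> AB; apply/val_inj/funext => g; apply/val_inj/funext => x; exact: AB. Qed.

Lemma linopDE (A B : linop) g x : (A + B) g x = A g x + B g x.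
Proof. by []. Qed.

Lemma linopD (A : linop) g h : A (g + h) = A g + A h.
Proof. by have := linop_linear A 1 g h; rewrite !scale1r. Qed.

Lemma linop_mulA : associative linop_mul. Proof. by move=> A B C; exact: linop_eq. Qed.
Lemma linop_mul1 : left_id linop_one linop_mul. Proof. by move=> A; exact: linop_eq. Qed.
Lemma linop_mulr1 : right_id linop_one linop_mul. Proof. by move=> A; exact: linop_eq. Qed.
Lemma linop_mulDl : left_distributive linop_mul +%R. Proof. by move=> A B C; exact: linop_eq. Qed.
Lemma linop_mulDr : right_distributive linop_mul +%R.
Proof. by move=> A B C; apply: linop_eq => g x /=; rewrite linopD. Qed.
Lemma linop_one_neq0 : linop_one != 0.
Proof.
apply/eqP => /(congr1 (fun A : linop => A (mk_smooth (smoothB_cst d (1:R))) 0)) /= /eqP.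
by rewrite oner_eq0.
Qed.

HB.instance Definition _ := GRing.Zmodule_isNzRing.Build linop
  linop_mulA linop_mul1 linop_mulr1 linop_mulDl linop_mulDr linop_one_neq0.

Lemma linopME (A B : linop) g : (A * B) g = A (B g).
Proof. by []. Qed.

Lemma linop_scal_linear (c : R) : linear (fun g : smooth_fct => c *: g).
Proof. by move=> a g h; rewrite scalerDr !scalerA mulrC. Qed.
(** Real scalars as central elements of the ring: an expansion is evaluated at time [t] by
    substituting [linop_scal t] for the indeterminate. *)
Definition linop_scal (c : R) := mk_linop (linop_scal_linear c).

Lemma linop_scalE c g x : linop_scal c g x = c * g x.
Proof. by []. Qed.

Lemma linopZ (A : linop) c g : A (c *: g) = c *: A g.
Proof.
have A0 : A 0 = 0 by have := linop_linear A (-1) 0 0; rewrite !scaleN1r addNr addNr.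
by have := linop_linear A c g 0; rewrite A0 !addr0.
Qed.

Lemma linop_scalC c (A : linop) : GRing.comm (linop_scal c) A.
Proof.
apply: linop_eq => g x; rewrite !linopME.
by rewrite -[LHS]/((c *: A g) x) -linopZ.
Qed.

Lemma linop_scalD c c' : linop_scal (c + c') = linop_scal c + linop_scal c'.
Proof. by apply: linop_eq => g x; rewrite linopDE !linop_scalE mulrDl. Qed.

Lemma linop_scalM c c' : linop_scal (c * c') = linop_scal c * linop_scal c'.
Proof. by apply: linop_eq => g x; rewrite linopME !linop_scalE mulrA. Qed.

Lemma linop_scal1 : linop_scal 1 = 1.
Proof. by apply: linop_eq => g x; rewrite linop_scalE mul1r. Qed.

Lemma Lie_op_linear (X : V -> V) (fX : fieldB X) :
  linear (fun g => mk_smooth (Lie_der_smoothB fX (smooth_fctB g))).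
Proof.
move=> c g h; apply/val_inj/funext => x /=.
rewrite -[RHS]/(c * Lie_der X g x + Lie_der X h x) /Lie_der.
rewrite deriveD ?deriveZ //.
- by apply: smoothB_derivable; exact: smooth_fctB.
- by apply: derivableZ; apply: smoothB_derivable; exact: smooth_fctB.
- by apply: smoothB_derivable; exact: smooth_fctB.
Qed.

Definition Lie_op (X : V -> V) (fX : fieldB X) : linop := mk_linop (Lie_op_linear fX).

Lemma Lie_opE (X : V -> V) (fX : fieldB X) g x : Lie_op fX g x = Lie_der X g x.
Proof. by []. Qed.

Lemma Lie_op_bracket (X Y : V -> V) (fX : fieldB X) (fY : fieldB Y)
    (fXY : fieldB (lie_bracket X Y)) :
  Lie_op fXY = Lie_op fX * Lie_op fY - Lie_op fY * Lie_op fX.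
Proof.
apply: linop_eq => g x; rewrite Lie_opE Lie_der_bracket //; exact: smooth_fctB.
Qed.

End Operators.

(** * Commutators of series modulo powers of the indeterminate *)

Section TruncatedSeries.
Variable A : nzRingType.
Implicit Types p q r s : {poly A}.

(** Reads [p = O('X^n)]. As ['X] commutes with everything, the multiples of ['X^n] form a two-sided
    ideal. *)
Definition divX (n : nat) p := exists r, p = r * 'X^n.

Lemma divXD n p q : divX n p -> divX n q -> divX n (p + q).
Proof. by move=> [r ->] [s ->]; exists (r + s); rewrite mulrDl. Qed.

Lemma divXN n p : divX n p -> divX n (- p).
Proof. by move=> [r ->]; exists (- r); rewrite mulNr. Qed.

Lemma divXB n p q : divX n p -> divX n q -> divX n (p - q).
Proof. by move=> dp dq; apply: divXD => //; exact: divXN. Qed.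

Lemma divXM m n p q : divX m p -> divX n q -> divX (m + n) (p * q).
Proof.
move=> [r ->] [s ->]; exists (r * s).
by rewrite -mulrA (mulrA 'X^m) -[in 'X^m * s]commr_polyXn -!mulrA -exprD.
Qed.

Lemma divX_le m n p : (m <= n)%N -> divX n p -> divX m p.
Proof. by move=> mn [r ->]; exists (r * 'X^(n - m)); rewrite -mulrA -exprD subnK. Qed.

Lemma divX_0 p : divX 0 p.
Proof. by exists p; rewrite mulr1. Qed.

Lemma divXMl n p q : divX n q -> divX n (p * q).
Proof. exact: (divXM (divX_0 p)). Qed.

Lemma divXMr n p q : divX n p -> divX n (p * q).
Proof. by move=> dp; have := divXM dp (divX_0 q); rewrite addn0. Qed.

Lemma divX_coef n p : (forall k, (k < n)%N -> p`_k = 0) -> divX n p.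
Proof.
move=> p0; exists (drop_poly n p); rewrite -{1}(poly_take_drop n p).
rewrite [X in X + _](_ : _ = 0) ?add0r //.
by apply/polyP => k; rewrite coef_take_poly coef0; case: ifP => // /p0.
Qed.

(** Reads [p = 1 + x 'X^l + O('X^(l+1))]. *)
Definition leads (l : nat) (x : A) p := divX l.+1 (p - 1 - x%:P * 'X^l).

Lemma leads_divX l x p : leads l x p -> divX l (p - 1).
Proof.
move=> lp; rewrite -(subrK (x%:P * 'X^l) (p - 1)); apply: divXD; last by exists x%:P.
exact: divX_le lp.
Qed.

(* With D := p q - q p = x y X^(a+b) - y x X^(a+b) + ..., one has
   p q p' q' = q (p p') q' + D p' q', where the first term is 1 modulo X^N. *)
Lemma leads_commutator N a b x y p p' q q' :
  (0 < a)%N -> (0 < b)%N -> (a + b < N)%N ->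
  leads a x p -> leads b y q -> divX 1 (p' - 1) -> divX 1 (q' - 1) ->
  divX N (p * p' - 1) -> divX N (q * q' - 1) ->
  leads (a + b) (x * y - y * x) (p * q * p' * q').
Proof.
move=> a0 b0 abN lp lq dp' dq' pp qq.
pose P := p - 1; pose Q := q - 1.
have dP : divX a P by exact: leads_divX lp.
have dQ : divX b Q by exact: leads_divX lq.
have xyX (u v : A) m n : (u * v)%:P * 'X^(m + n) = (u%:P * 'X^m) * (v%:P * 'X^n).
  by rewrite polyCM exprD -!mulrA; congr (_ * _); rewrite mulrA (commr_polyXn v%:P m) -mulrA.
have prod (u v : A) m n (S T : {poly A}) : divX m S -> divX n T ->
    divX m.+1 (S - u%:P * 'X^m) -> divX n.+1 (T - v%:P * 'X^n) ->
    divX (m + n).+1 (S * T - (u * v)%:P * 'X^(m + n)).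
  move=> dS dT dS1 dT1; rewrite xyX.
  have -> : S * T - (u%:P * 'X^m) * (v%:P * 'X^n) =
     (S - u%:P * 'X^m) * T + (u%:P * 'X^m) * (T - v%:P * 'X^n).
    by rewrite mulrBl mulrBr addrA subrK.
  apply: divXD; first exact: (divXM dS1 dT).
  by rewrite -addnS; apply: divXM => //; exists u%:P.
pose D := P * Q - Q * P.
have dD : divX (a + b) D.
  by apply: divXB; [exact: divXM|rewrite addnC; exact: divXM].
have dD1 : divX (a + b).+1 (D - (x * y - y * x)%:P * 'X^(a + b)).
  rewrite polyCB mulrBl /D opprD addrACA -opprD; apply: divXB; first exact: prod.
  by rewrite addnC; exact: prod.
have PQE (u v : {poly A}) : (u - 1) * (v - 1) = u * v - (u + v - 1).
  by rewrite mulrBl mulrBr mul1r mulr1 -!addrA -opprD.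
have DE : p * q = q * p + D.
  by rewrite /D /P /Q !PQE (addrC q p); move: (p + q - 1) => c; rewrite opprB subrKA addrC subrK.
clearbody D.
have E : p * q * p' * q' - 1 - (x * y - y * x)%:P * 'X^(a + b) =
   (q * (p * p' - 1) * q' + (q * q' - 1)) + (D * (p' * q' - 1)
   + (D - (x * y - y * x)%:P * 'X^(a + b))).
  rewrite !addrA; congr (_ - _).
  rewrite (mulrBr q) mulr1 (mulrBl q') subrK (mulrBr D) mulr1 -addrA subrK.
  by rewrite DE !mulrDl !mulrA addrAC.
rewrite /leads E; apply: divXD.
  apply: (@divX_le _ N) => //; apply: divXD => //.
  by apply: divXMr; exact: divXMl.
apply: divXD => //; rewrite -addn1; apply: divXM => //.
rewrite (_ : p' * q' - 1 = (p' - 1) * q' + (q' - 1)); last by rewrite mulrBl mul1r addrA subrK.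
by apply: divXD => //; exact: divXMr.
Qed.

(** The second series inverts the first modulo ['X^N]. Both are needed to form the next commutator,
    and the second realizes the opposite direction. *)
Definition leading_pair N l x (p p' : {poly A}) :=
  [/\ leads l x p, leads l (- x) p', divX N (p * p' - 1) & divX N (p' * p - 1)].

Lemma divX_conj N p p' q q' : divX N (p * p' - 1) -> divX N (q * q' - 1) ->
  divX N (q * (p * p') * q' - 1).
Proof.
move=> pp qq; rewrite (_ : _ - 1 = q * (p * p' - 1) * q' + (q * q' - 1)).
  by apply: divXD => //; apply: divXMr; exact: divXMl.
by rewrite mulrBr mulr1 mulrBl addrA subrK.
Qed.

(** The inverse of a commutator is the commutator in the other order; the products collapse from the
    inside, one inverse pair after the other. *)
Lemma leading_pair_commutator N a b x y p p' q q' :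
  (0 < a)%N -> (0 < b)%N -> (a + b < N)%N ->
  leading_pair N a x p p' -> leading_pair N b y q q' ->
  leading_pair N (a + b) (x * y - y * x) (p * q * p' * q') (q * p * q' * p').
Proof.
move=> a0 b0 abN [lp lp' pp p'p] [lq lq' qq q'q].
have dp' : divX 1 (p' - 1) by apply: divX_le (leads_divX lp').
have dq' : divX 1 (q' - 1) by apply: divX_le (leads_divX lq').
split.
- exact: leads_commutator pp qq.
- by rewrite opprB addnC; apply: leads_commutator qq pp => //; rewrite addnC.
- have := divX_conj (divX_conj (divX_conj q'q p'p) qq) pp.
  by rewrite !mulrA.
- have := divX_conj (divX_conj (divX_conj p'p q'q) pp) qq.
  by rewrite !mulrA.
Qed.

End TruncatedSeries.

(** * Truncated exponentials of operators *)

Section Exponential.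
Variables (R : realType) (d : nat).
Local Notation A := (linop R d).
Local Notation sc := (@linop_scal R d).

Definition exp_trunc (N : nat) (x : A) : {poly A} :=
  \poly_(k < N) (sc (k`!%:R^-1) * x ^+ k).

(** Up to the factor [k!] this is the binomial expansion of [(1 - 1) ^+ k]; it is the coefficient of
    degree [k] in the product of the exponentials of X and -X. *)
Lemma sum_fact_inv_alternating k : (0 < k)%N ->
  \sum_(j < k.+1) (j`!%:R^-1 * ((k - j)`!%:R^-1 * (-1) ^+ (k - j))) = 0 :> R.
Proof.
move=> k0.
have f0 n : (n`!)%:R != 0 :> R by rewrite pnatr_eq0 -lt0n fact_gt0.
have : ((1 : R) - 1) ^+ k = 0 by rewrite subrr expr0n gtn_eqF.
rewrite addrC exprDn => E.
apply: (mulfI (f0 k)); rewrite mulr0 -[RHS]E mulr_sumr; apply: eq_bigr => j _.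
have jk : (j <= k)%N by rewrite -ltnS.
rewrite expr1n mulr1 -mulr_natr -(bin_fact jk) !natrM.
by field; rewrite !f0.
Qed.

(** Below degree [N], truncation does not affect the coefficients of the product of the two
    exponentials, and powers of [x] commute with each other. *)
Lemma exp_trunc_inv N x : divX N (exp_trunc N x * exp_trunc N (- x) - 1).
Proof.
apply: divX_coef => k kN; rewrite coefB coefM coef1.
have -> : \sum_(j < k.+1) (exp_trunc N x)`_j * (exp_trunc N (- x))`_(k - j) =
    sc (\sum_(j < k.+1) (j`!%:R^-1 * ((k - j)`!%:R^-1 * (-1) ^+ (k - j)))) * x ^+ k.
  rewrite (big_morph sc (@linop_scalD R d) (_ : sc 0 = 0)); last first.
    by apply: linop_eq => g z; rewrite linop_scalE mul0r.
  rewrite mulr_suml; apply: eq_bigr => j _.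
  have jk : (j <= k)%N by rewrite -ltnS.
  rewrite !coef_poly (leq_ltn_trans jk kN) (leq_ltn_trans (leq_subr j k) kN).
  have sN : (- x) ^+ (k - j) = sc ((-1) ^+ (k - j)) * x ^+ (k - j).
    have scN n : sc ((-1) ^+ n) = (-1) ^+ n.
      elim: n => [|n IHn]; first by rewrite !expr0 linop_scal1.
      rewrite !exprS linop_scalM IHn; congr (_ * _).
      by apply: linop_eq => g z; rewrite linop_scalE mulN1r.
    by rewrite scN -exprNn.
  rewrite sN !linop_scalM -!mulrA; congr (_ * _).
  have cx u v : x ^+ j * (sc u * v) = sc u * (x ^+ j * v).
    by rewrite (mulrA (x ^+ j)) -(linop_scalC u) mulrA.
  by rewrite !cx -exprD subnKC.
case: k kN => [|k] kN.
  by rewrite big_ord1 subn0 fact0 expr0 invr1 !mulr1 linop_scal1 subrr.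
rewrite sum_fact_inv_alternating // subr0.
by apply: linop_eq => g z; rewrite linopME linop_scalE mul0r.
Qed.

Lemma leads_exp_trunc N x : (1 < N)%N -> leads 1 x (exp_trunc N x).
Proof.
move=> N1; apply: divX_coef => -[|[|//]] _.
  rewrite !coefB coef_poly (ltnW N1) coef1 coefCM coefXn mulr0 subr0.
  by rewrite fact0 invr1 linop_scal1 mul1r subrr.
rewrite !coefB coef_poly N1 coef1 coefCM coefXn subr0 mulr1.
by rewrite invr1 linop_scal1 mul1r subrr.
Qed.

Lemma leading_pair_exp N x : (1 < N)%N ->
  leading_pair N 1 x (exp_trunc N x) (exp_trunc N (- x)).
Proof.
move=> N1; split; try exact: leads_exp_trunc; first exact: exp_trunc_inv.
by rewrite -{2}(opprK x); exact: exp_trunc_inv.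
Qed.

Lemma horner_exp_trunc N x t g z :
  (exp_trunc N x).[sc t] g z = \sum_(k < N) t ^+ k / k`!%:R * ((x ^+ k) g z).
Proof.
have lin_sum n (F : 'I_n -> A) : (\sum_(k < n) F k) g z = \sum_(k < n) F k g z.
  by elim/big_rec2: _ => // k u v _ <-.
rewrite (@horner_coef_wide _ N) ?size_poly // lin_sum; apply: eq_bigr => k _.
rewrite coef_poly ltn_ord.
have -> : sc t ^+ k = sc (t ^+ k).
  elim: (k : nat) => [|n IHn]; first by rewrite !expr0 linop_scal1.
  by rewrite !exprS IHn linop_scalM.
have scx (y : A) u v : sc u * y * sc v = sc (v * u) * y.
  by rewrite -mulrA -linop_scalC mulrA -linop_scalM mulrC.
by rewrite scx linopME linop_scalE.
Qed.

End Exponential.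

(** * Taylor expansion of test functions along flows *)

Section FlowExpansion.
Variables (R : realType) (d : nat).
Local Notation V := 'rV[R]_d.
Local Notation sc := (@linop_scal R d).
Implicit Types (g : smooth_fct R d) (p q : {poly linop R d}).

(** The remainder of order [N.+1] for [g] has as derivative the remainder of order [N] for
    [Lie_op fX g], so the same constant passes through the induction. It is chosen before the curve
    and hence is uniform in the starting point. *)
Lemma flow_Taylor (X : V -> V) (fX : fieldB X) N g :
  exists2 C : R, 0 <= C & forall (c : R -> V) (T : R), 0 <= T -> continuous c ->
    (forall s : R, 0 < s < T -> is_derive s (1 : R) c (X (c s))) ->
    `|g (c T) - \sum_(k < N.+1) T ^+ k / k`!%:R * ((Lie_op fX ^+ k) g (c 0))| <= C * T ^+ N.+1.
Proof.
have Dgc (h : smooth_fct R d) c (T : R) : (forall s : R, 0 < s < T -> is_derive s (1 : R) c (X (c s))) ->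
    forall s : R, 0 < s < T -> is_derive s (1 : R) (h \o c) (Lie_op fX h (c s)).
  move=> Dc s /Dc Ds; apply: is_derive_along => //.
  by apply: smoothB_differentiable; exact: smooth_fctB.
have Cgc (h : smooth_fct R d) c : continuous c -> continuous (h \o c : R -> R).
  move=> cc s; apply: continuous_comp; first exact: cc.
  exact/smoothB_cont/smooth_fctB.
elim: N g => [|N IHN] g.
  have [C HC] := Lie_der_bounded fX (smooth_fctB g).
  exists C => [|c T T0 cc Dc]; first by apply: le_trans (HC 0).
  rewrite big_ord1 expr0 fact0 divr1 mul1r expr1.
  rewrite -[X in C * X](subr0 T).
  apply: (@mvt_norm_bound _ (g \o c) (fun s => Lie_op fX g (c s))) => //.
  - exact/continuous_subspaceT/Cgc.
  - by move=> s _; exact: HC.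
have [C C0 HC] := IHN (Lie_op fX g).
exists C => // c T T0 cc Dc.
pose a k := (Lie_op fX ^+ k) g (c 0).
pose q := \poly_(k < N.+2) (a k / k`!%:R).
have qE s : q.[s] = \sum_(k < N.+2) s ^+ k / k`!%:R * a k.
  by rewrite horner_poly; apply: eq_bigr => k _; rewrite mulrC mulrA mulrAC.
have dqE s : q^`().[s] = \sum_(k < N.+1) s ^+ k / k`!%:R * a k.+1.
  have -> : q^`() = \poly_(k < N.+1) (a k.+1 / k`!%:R).
    apply/polyP => k; rewrite coef_deriv !coef_poly ltnS; case: ifP => _; last by rewrite mul0rn.
    rewrite factS natrM -(mulr_natr (_ / _)) invfM -!mulrA; congr (_ * _).
    by rewrite mulrC mulfK // pnatr_eq0.
  by rewrite horner_poly; apply: eq_bigr => k _; rewrite mulrC mulrA mulrAC.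
rewrite -qE.
have g0 : g (c 0) - q.[0] = 0.
  rewrite horner_coef0 coef_poly /= /a expr0 fact0 divr1.
  by rewrite -[X in X - _]/((1 : linop R d) g (c 0)) subrr.
have := @mvt_norm_bound _ (fun s => (g \o c) s - q.[s])
  (fun s => Lie_op fX g (c s) - q^`().[s]) 0 T (C * T ^+ N.+1) T0.
rewrite /= g0 !subr0 -mulrA -exprSr; apply.
- apply: continuous_subspaceT => s.
  apply: (@continuousB _ R^o _ (g \o c : R -> R) (fun s : R => q.[s])); first exact: Cgc.
  exact: continuous_horner.
- by move=> s sT; apply: is_deriveB; exact: (Dgc g c T Dc s sT).
- move=> s /andP[s0 sT]; rewrite dqE.
  have -> : \sum_(k < N.+1) s ^+ k / k`!%:R * a k.+1 =
            \sum_(k < N.+1) s ^+ k / k`!%:R * ((Lie_op fX ^+ k) (Lie_op fX g) (c 0)).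
    by apply: eq_bigr => k _; rewrite /a exprSr.
  apply: (le_trans (HC c s (ltW s0) cc _)).
    by move=> u /andP[u0 us]; apply: Dc; rewrite u0 (lt_trans us).
  by rewrite ler_wpM2l //; apply: lerXn2r; rewrite ?nnegrE //; exact: ltW.
Qed.

Variable tau : R.
Hypothesis tau1 : tau <= 1.

(* Testing a map E t against smooth functions turns the composition of flows into
   multiplication of operators (expands_comp), and no differentiability of E t in
   the initial point is ever needed. *)
Definition expands (N : nat) (E : R -> V -> V) p := forall g, exists2 C : R, 0 <= C &
  forall t x, 0 <= t -> t <= tau -> `|g (E t x) - p.[sc t] g x| <= C * t ^+ N.

Lemma linop_sumE (n : nat) (F : 'I_n -> linop R d) g x :
  (\sum_(k < n) F k) g x = \sum_(k < n) F k g x.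
Proof. by elim/big_rec2: _ => // k u v _ <-. Qed.

Lemma linop_scX t k : sc t ^+ k = sc (t ^+ k).
Proof.
elim: k => [|n IHn]; first by rewrite !expr0 linop_scal1.
by rewrite !exprS IHn linop_scalM.
Qed.

Lemma horner_linopE p t g x :
  p.[sc t] g x = \sum_(k < size p) t ^+ k * (p`_k g x).
Proof.
rewrite horner_coef linop_sumE; apply: eq_bigr => k _.
by rewrite linop_scX -linop_scalC.
Qed.

Lemma horner_linop_apply p q t g x :
  p.[sc t] (q.[sc t] g) x = \sum_(k < size q) t ^+ k * (p.[sc t] (q`_k g) x).
Proof.
rewrite (horner_coef q).
rewrite -[LHS]/((p.[sc t] * \sum_(i < size q) q`_i * sc t ^+ i) g x) mulr_sumr linop_sumE.
apply: eq_bigr => k _; rewrite linop_scX -(linop_scalC _ q`_k) mulrA -linop_scalC -mulrA.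
by [].
Qed.

Lemma expands_comp N E F p q : expands N E p -> expands N F q ->
  expands N (fun t x => F t (E t x)) (p * q).
Proof.
move=> Ep Fq g; have [C C0 HC] := Fq g.
have [i|D HD] := @choice 'I_(size q) R (fun i D => 0 <= D /\ forall t x, 0 <= t -> t <= tau ->
   `|q`_i g (E t x) - p.[sc t] (q`_i g) x| <= D * t ^+ N).
  by have [D D0 HD] := Ep (q`_i g); exists D.
exists (C + \sum_i D i); first by rewrite addr_ge0 // sumr_ge0 // => i _; case: (HD i).
move=> t x t0 tt.
apply: (le_trans (ler_distD (q.[sc t] g (E t x)) _ _)); rewrite mulrDl lerD //.
  exact: HC.
rewrite hornerM_comm; last exact: linop_scalC.
rewrite -[X in _ - X]/(p.[sc t] (q.[sc t] g) x) horner_linop_apply horner_linopE -sumrB.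
apply: (le_trans (ler_norm_sum _ _ _)); rewrite mulr_suml; apply: ler_sum => i _.
rewrite -mulrBr normrM ger0_norm ?exprn_ge0 //.
(* The weights [t ^+ i] are at most 1, as [t <= tau <= 1]. *)
apply: le_trans ((HD i).2 t x t0 tt); rewrite ler_piMl // exprn_ile1 //.
exact: le_trans tau1.
Qed.

End FlowExpansion.

(** * Local controllability *)

Section BracketMoves.
Variables (R : realType) (d m : nat).
Local Notation V := 'rV[R]_d.
Local Notation sc := (@linop_scal R d).
Variable f : 'I_m -> V -> V.
Hypothesis ff : forall i, fieldB (f i).

Fixpoint word_length (w : bracket_word m) : nat :=
  match w with BGen _ => 1 | BBr w1 w2 => word_length w1 + word_length w2 end.

Lemma word_length_gt0 w : (0 < word_length w)%N.
Proof. by elim: w => //= w1 h1 w2 h2; rewrite addn_gt0 h1. Qed.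

Lemma fieldB_beval w : fieldB (beval f w).
Proof. by elim: w => [i|w1 h1 w2 h2] /=; [exact: ff|exact: fieldB_lie_bracket]. Qed.

Definition signed_field (i : 'I_m) (b : bool) (y : V) : V := if b then f i y else - f i y.

Lemma fieldBN (X : V -> V) : fieldB X -> fieldB (fun x => - X x).
Proof.
move=> fX i; have [bX sX] := fX i.
have E : (fun x => (-1) * X x 0 i) = (fun x => (- X x) 0 i).
  by apply/funext => x; rewrite mxE mulN1r.
have : bounded_fct (fun x => (-1) * X x 0 i) /\ smoothB (fun x => (-1) * X x 0 i).
  split; last exact: smoothBZ.
  by apply: bounded_fctM => //; exact: bounded_fct_cst.
by rewrite E.
Qed.

Lemma Lie_opN (X : V -> V) (fX : fieldB X) (fN : fieldB (fun x => - X x)) :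
  Lie_op fN = - Lie_op fX.
Proof.
apply: linop_eq => g x; have dg := smoothB_differentiable (smooth_fctB g) x.
rewrite -[RHS]/(- Lie_der X g x) Lie_opE /Lie_der !(derive_coord_sum _ dg) -sumrN.
by apply: eq_bigr => j _; rewrite mxE mulNr.
Qed.

Lemma fieldB_signed i b : fieldB (signed_field i b).
Proof. by case: b; [exact: ff|exact/fieldBN/ff]. Qed.

Lemma Lie_op_signed i b :
  Lie_op (fieldB_signed i b) = if b then Lie_op (ff i) else - Lie_op (ff i).
Proof.
case: b; first exact: linop_eq.
exact: (@Lie_opN (f i) (ff i)).
Qed.

(** [S t x y] stands for reachability of [y] from [x] in time [t]; the instance used later is
    [steer]. *)
Variables (S : R -> V -> V -> Prop) (tau : R).
Hypothesis tau0 : 0 < tau.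
Hypothesis tau1 : tau <= 1.
Hypothesis S_trans : forall s t x y z, S s x y -> S t y z -> S (s + t) x z.
Hypothesis S_gen : forall i b (t : R) x, 0 <= t -> t <= tau ->
  exists c : R -> V, [/\ c 0 = x, continuous c, S t x (c t) &
    forall s : R, 0 < s < t -> is_derive s (1 : R) c (signed_field i b (c s))].

(** Each pair [(t, x)] selects its own integral curve and [E t x] is its end point. Curves selected
    for different times may be unrelated: the constant of [flow_Taylor] serves all of them. *)
Lemma gen_expands i b N : exists2 E : R -> V -> V,
  expands tau N.+1 E (exp_trunc N.+1 (Lie_op (fieldB_signed i b))) &
  forall t x, 0 <= t -> t <= tau -> S t x (E t x).
Proof.
have [tx|E HE] := @choice (R * V)%type V (fun tx y => 0 <= tx.1 -> tx.1 <= tau ->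
  exists c : R -> V, [/\ c 0 = tx.2, continuous c, S tx.1 tx.2 y, c tx.1 = y &
    forall s, 0 < s < tx.1 -> is_derive s (1 : R) c (signed_field i b (c s))]).
  have [t0|] := boolP (0 <= tx.1); last by exists 0.
  have [tt|] := boolP (tx.1 <= tau); last by exists 0.
  have [c [c0 cc cS cD]] := S_gen i b tx.2 t0 tt.
  by exists (c tx.1) => _ _; exists c.
exists (fun t x => E (t, x)) => [g|t x t0 tt]; last by have [c []] := HE (t, x) t0 tt.
have [C C0 HC] := flow_Taylor (fieldB_signed i b) N g.
exists C => // t x t0 tt.
have [c [/= c0 cc cS cE cD]] := HE (t, x) t0 tt.
by rewrite horner_exp_trunc -cE -c0; exact: HC.
Qed.

(** [n] counts the elementary moves, each lasting [t]. The precision [N] is fixed in advance for all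
    subwords, because inverses hold modulo ['X^N] only. *)
Lemma word_expands w N : (word_length w < N)%N ->
  exists (n : nat) (E E' : R -> V -> V) (p p' : {poly linop R d}),
  [/\ expands tau N E p, expands tau N E' p',
      leading_pair N (word_length w) (Lie_op (fieldB_beval w)) p p' &
      forall t x, 0 <= t -> t <= tau -> S (n%:R * t) x (E t x) /\ S (n%:R * t) x (E' t x)].
Proof.
elim: w N => [i|w1 IH1 w2 IH2] N /= wN.
  case: N wN => // N N1.
  have [E HE SE] := gen_expands i true N.
  have [E' HE' SE'] := gen_expands i false N.
  exists 1%N, E, E', (exp_trunc N.+1 (Lie_op (ff i))), (exp_trunc N.+1 (- Lie_op (ff i))).
  rewrite !Lie_op_signed in HE HE'; split => //.
    have -> : Lie_op (fieldB_beval (BGen i)) = Lie_op (ff i) by exact: linop_eq.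
    exact: leading_pair_exp.
  by move=> t x t0 tt; rewrite mul1r; split; [exact: SE|exact: SE'].
have [|n1 [E1 [E1' [p1 [p1' [X1 X1' L1 S1]]]]]] := IH1 N.
  by apply: leq_ltn_trans wN; exact: leq_addr.
have [|n2 [E2 [E2' [p2 [p2' [X2 X2' L2 S2]]]]]] := IH2 N.
  by apply: leq_ltn_trans wN; exact: leq_addl.
exists (n1 + n2 + n1 + n2)%N.
exists (fun t x => E2' t (E1' t (E2 t (E1 t x)))).
exists (fun t x => E1' t (E2' t (E1 t (E2 t x)))).
exists (p1 * p2 * p1' * p2'), (p2 * p1 * p2' * p1'); split.
- by do 3!(apply: expands_comp => //).
- by do 3!(apply: expands_comp => //).
- have -> : Lie_op (fieldB_beval (BBr w1 w2)) =
    Lie_op (fieldB_beval w1) * Lie_op (fieldB_beval w2) -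
    Lie_op (fieldB_beval w2) * Lie_op (fieldB_beval w1).
    exact: (Lie_op_bracket (fieldB_beval w1) (fieldB_beval w2) (fieldB_beval (BBr w1 w2))).
  by apply: leading_pair_commutator => //; exact: word_length_gt0.
- move=> t x t0 tt.
  have H1 y := S1 t y t0 tt; have H2 y := S2 t y t0 tt.
  have S4 a b c e y0 y1 y2 y3 y4 : S a y0 y1 -> S b y1 y2 -> S c y2 y3 -> S e y3 y4 ->
      S (a + b + c + e) y0 y4.
    by move=> h1 h2 h3 h4; exact: S_trans (S_trans (S_trans h1 h2) h3) h4.
  split; rewrite !natrD !mulrDl.
    exact: S4 (H1 _).1 (H2 _).1 (H1 _).2 (H2 _).2.
  rewrite (_ : _ + _ = n2%:R * t + n1%:R * t + n2%:R * t + n1%:R * t); last first.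
    by move: (_ * t) (_ * t) => u v; ring.
  exact: S4 (H2 _).1 (H1 _).1 (H2 _).2 (H1 _).2.
Qed.

Lemma horner_mulXn (A : nzRingType) (p : {poly A}) n x : (p * 'X^n).[x] = p.[x] * x ^+ n.
Proof.
elim: n => [|n IHn]; first by rewrite !expr0 !mulr1.
by rewrite !exprSr !mulrA hornerMX IHn.
Qed.

(** Testing the expansion against the coordinates reads off the displacement. The coefficients of
    the remainder, applied to a coordinate, are continuous but possibly unbounded, hence a bound
    near [x0] only. *)
Lemma leads_displacement l (X : V -> V) (fX : fieldB X) p E (x0 : V) : (0 < l)%N ->
  leads l (Lie_op fX) p -> expands tau l.+1 E p ->
  exists C : R, 0 <= C /\ \forall x \near x0, forall t : R, 0 <= t -> t <= tau ->
    `|E t x - x - t ^+ l *: X x| <= C * t ^+ l.+1.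
Proof.
move=> l0 [r lp] Ep.
pose e (i : 'I_d) := mk_smooth (smoothB_coord R i).
have [i|C HC] := @choice 'I_d R (fun i C => 0 <= C /\ forall t x, 0 <= t -> t <= tau ->
    `|e i (E t x) - p.[sc t] (e i) x| <= C * t ^+ l.+1).
  by have [C C0 HC] := Ep (e i); exists C.
have pE i t x : p.[sc t] (e i) x = x 0 i + t ^+ l * X x 0 i + t ^+ l.+1 * (r.[sc t] (e i) x).
  have -> : p = 1 + (Lie_op fX)%:P * 'X^l + r * 'X^(l.+1).
    by rewrite -lp -(addrA p) -opprD [RHS]addrCA subrr addr0.
  rewrite !hornerD !horner_mulXn !hornerC !linop_scX -!linop_scalC !linopDE !linopME !linop_scalE.
  by rewrite Lie_opE /Lie_der /= derive_coord.
pose D : R := \sum_(i < d) \sum_(k < size r) (`|r`_k (e i) x0| + 1).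
have D0 : 0 <= D by apply: sumr_ge0 => i _; apply: sumr_ge0 => k _; rewrite addr_ge0.
exists (\sum_i C i + D); split.
  by rewrite addr_ge0 // sumr_ge0 // => i _; case: (HC i).
have near_r : \forall x \near x0, forall (i : 'I_d) (k : 'I_(size r)),
    `|r`_k (e i) x| <= `|r`_k (e i) x0| + 1.
  apply: (@filter_forall V 'I_d (fun i x => forall k : 'I_(size r),
    `|r`_k (e i) x| <= `|r`_k (e i) x0| + 1) (nbhs x0) _) => i.
  apply: (@filter_forall V 'I_(size r) (fun k x =>
    `|r`_k (e i) x| <= `|r`_k (e i) x0| + 1) (nbhs x0) _) => k.
  have := @smoothB_cont _ _ _ (smooth_fctB (r`_k (e i))) x0.
  move=> /cvgrPdist_le /(_ 1 ltr01); apply: filterS => x; rewrite distrC => H.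
  by rewrite -(subrK (r`_k (e i) x0) (r`_k (e i) x)) addrC (le_trans (ler_normD _ _)) // lerD.
apply: filterS near_r => x Hx t t0 tt.
have C0 : 0 <= \sum_i C i by rewrite sumr_ge0 // => i _; case: (HC i).
apply: rV_norm_le => [|i]; first by rewrite mulr_ge0 ?exprn_ge0 // addr_ge0.
rewrite !mxE.
have -> : E t x 0 i - x 0 i - t ^+ l * X x 0 i =
   (e i (E t x) - p.[sc t] (e i) x) + t ^+ l.+1 * (r.[sc t] (e i) x).
  by rewrite pE /= !opprD !addrA subrK.
apply: (le_trans (ler_normD _ _)); rewrite mulrDl lerD //.
  apply: (le_trans ((HC i).2 t x t0 tt)); rewrite ler_wpM2r ?exprn_ge0 //.
  by rewrite (bigD1 i) //= lerDl sumr_ge0 // => j _; case: (HC j).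
rewrite normrM ger0_norm ?exprn_ge0 // mulrC ler_wpM2r ?exprn_ge0 //.
rewrite horner_linopE /D (bigD1 i) //= -[X in X <= _]addr0 lerD //; last first.
  by apply: sumr_ge0 => j _; apply: sumr_ge0 => k _; rewrite addr_ge0.
apply: (le_trans (ler_norm_sum _ _ _)); apply: ler_sum => k _.
rewrite normrM ger0_norm ?exprn_ge0 //; apply: le_trans (Hx i k).
by rewrite ler_piMl // exprn_ile1 // (le_trans tt).
Qed.

(** The field is frozen at [x0], so that successive moves have fixed directions. The sign of [a]
    decides between the move [E] and its inverse [E']. *)
Lemma word_move w : exists2 kappa : R, 0 <= kappa & forall (x0 : V) (eta : R), 0 < eta ->
  exists2 r : R, 0 < r & forall (t a : R) x, 0 <= t -> t <= r -> `|a| = t ^+ word_length w ->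
    `|x - x0| < r ->
    exists2 x', S (kappa * t) x x' & `|x' - x - a *: beval f w x0| <= eta * `|a|.
Proof.
set l := word_length w; have l0 : (0 < l)%N by exact: word_length_gt0.
have [n [E [E' [p [p' [HE HE' [lp lp' _ _] HS]]]]]] := word_expands (ltnSn l).
exists n%:R => // x0 eta eta0.
have [C [C0 HC]] := leads_displacement x0 l0 lp HE.
have fN := fieldBN (fieldB_beval w).
have LN : Lie_op fN = - Lie_op (fieldB_beval w) by exact: Lie_opN.
rewrite -LN in lp'.
have [C' [C'0 HC']] := leads_displacement x0 l0 lp' HE'.
have eta2 : 0 < eta / 2 by rewrite divr_gt0.
have [K K0 HK] := fieldB_lipschitz (fieldB_beval w).
have : nbhs x0 ([set x | forall t : R, 0 <= t -> t <= tau ->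
    `|E t x - x - t ^+ l *: beval f w x| <= C * t ^+ l.+1] `&`
  [set x | forall t : R, 0 <= t -> t <= tau ->
    `|E' t x - x - t ^+ l *: - beval f w x| <= C' * t ^+ l.+1]) by exact: filterI.
move=> /nbhs_ballP[r1 /= r10 H1].
(* Dominates the two displacement constants and the Lipschitz constant of the bracket; [r] then
   makes each of these errors at most [eta / 2]. *)
pose M := C + C' + K + 1.
have M0 : 0 < M by rewrite /M ltr_wpDl // !addr_ge0.
pose r := Num.min (Num.min r1 tau) (eta / 2 / M).
have r0 : 0 < r by rewrite !lt_min r10 tau0 divr_gt0.
exists r => // t a x t0 tr ta xr.
have [rr1 rtau rM] : [/\ r <= r1, r <= tau & r <= eta / 2 / M].
  by rewrite /r !ge_min !lexx ?orbT.
have tt : t <= tau by exact: le_trans rtau.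
have [|Hx Hx'] := H1 x.
  by rewrite -ball_normE /= distrC (lt_le_trans xr).
have small (D u : R) : 0 <= D -> D <= M -> 0 <= u -> u <= r -> D * u <= eta / 2.
  move=> D0 DM u0 ur; apply: (@le_trans _ _ (M * (eta / 2 / M))).
    by apply: ler_pM => //; exact: le_trans rM.
  by rewrite mulrCA mulfV ?mulr1 // gt_eqF.
have near0 : `|beval f w x - beval f w x0| <= eta / 2.
  apply: (le_trans (HK _ _)); apply: small => //; last exact: ltW.
  by rewrite /M; lra.
have conclude (F : R -> V -> V) (D : R) (X : V -> V) (e : R) : 0 <= D -> D <= M ->
    `|F t x - x - t ^+ l *: X x| <= D * t ^+ l.+1 -> t ^+ l *: X x = a *: beval f w x ->
    `|F t x - x - a *: beval f w x0| <= eta * `|a|.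
  move=> D0 DM FD XE.
  apply: (le_trans (ler_distD (a *: beval f w x) _ _)).
  rewrite -scalerBr normrZ (splitr eta) mulrDl; apply: lerD; last first.
    by rewrite mulrC ler_wpM2r.
  rewrite -XE; apply: (le_trans FD); rewrite exprS mulrA ta ler_wpM2r ?exprn_ge0 //.
  exact: small.
have [a0|a0] := leP 0 a.
  exists (E t x); first exact: (HS t x t0 tt).1.
  apply: (conclude E C (beval f w)) => //; [by rewrite /M; lra|exact: Hx|].
  by rewrite -ta ger0_norm.
exists (E' t x); first exact: (HS t x t0 tt).2.
apply: (conclude E' C' (fun x => - beval f w x)) => //; [by rewrite /M; lra|exact: Hx'|].
by rewrite -ta ltr0_norm // scaleNr scalerN opprK.
Qed.

End BracketMoves.

(** * Exact connection of nearby points *)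

Section LocalControllability.
Variables (R : realType) (d m : nat).
Local Notation V := 'rV[R]_d.
Variable f : 'I_m -> V -> V.
Hypothesis ff : forall i, fieldB (f i).
Hypothesis fH : Hormander f.
Variables (S : R -> V -> V -> Prop) (tau : R).
Hypothesis tau0 : 0 < tau.
Hypothesis tau1 : tau <= 1.
Hypothesis S_refl : forall x, S 0 x x.
Hypothesis S_trans : forall s t x y z, S s x y -> S t y z -> S (s + t) x z.
Hypothesis S_gen : forall i b (t : R) x, 0 <= t -> t <= tau ->
  exists c : R -> V, [/\ c 0 = x, continuous c, S t x (c t) &
    forall s : R, 0 < s < t -> is_derive s (1 : R) c (signed_field f i b (c s))].
Hypothesis S_limit : forall (x : nat -> V) (t : nat -> R) y K D,
  (forall n, 0 <= t n <= K * 2^-1 ^+ n) -> (forall n, S (t n) (x n) (x n.+1)) ->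
  (forall n, `|y - x n| <= D * 2^-1 ^+ n) ->
  exists2 T, 0 <= T <= 2 * K & S T (x 0%N) y.

(** The inverse of one plus the sum of the inverses works, also for an empty index type. *)
Lemma pos_lower_bound (I : finType) (r : I -> R) : (forall i, 0 < r i) ->
  exists2 r0 : R, 0 < r0 & forall i, r0 <= r i.
Proof.
move=> rpos; have s0 : 0 < 1 + \sum_i (r i)^-1.
  by rewrite ltr_wpDr // sumr_ge0 // => i _; rewrite invr_ge0 ltW.
exists (1 + \sum_i (r i)^-1)^-1; first by rewrite invr_gt0.
move=> i; rewrite -[leRHS]invrK lef_pV2 ?posrE ?invr_gt0 //.
rewrite (bigD1 i) //= addrCA lerDl addr_ge0 // sumr_ge0 // => j _.
by rewrite invr_ge0 ltW.
Qed.

(** Directions are frozen at [x0], so the errors simply add up. The budget in the hypothesis on [x]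
    keeps every intermediate point inside the ball where moves are available. *)
Lemma moves_seq (ws : 'I_d -> bracket_word m) (kappa : 'I_d -> R) (x0 : V) (eta r : R)
    (t a : 'I_d -> R) : 0 <= eta ->
  (forall j x, `|x - x0| < r ->
    exists2 x', S (kappa j * t j) x x' & `|x' - x - a j *: beval f (ws j) x0| <= eta * `|a j|) ->
  forall js x, `|x - x0| + \sum_(j <- js) (`|beval f (ws j) x0| + eta) * `|a j| < r ->
  exists2 x', S (\sum_(j <- js) kappa j * t j) x x' &
    `|x' - x - \sum_(j <- js) a j *: beval f (ws j) x0| <= eta * \sum_(j <- js) `|a j|.
Proof.
move=> eta0 step; elim=> [|j js IHjs] x.
  by move=> _; exists x; rewrite !big_nil ?subr0 ?subrr ?normr0 ?mulr0.
rewrite !big_cons => xr.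
have S0 : 0 <= \sum_(j <- js) (`|beval f (ws j) x0| + eta) * `|a j|.
  by apply: sumr_ge0 => k _; rewrite mulr_ge0 ?addr_ge0.
have A0 : 0 <= (`|beval f (ws j) x0| + eta) * `|a j| by rewrite mulr_ge0 ?addr_ge0.
have [|x1 S1 E1] := step j x; first by lra.
have d1 : `|x1 - x| <= (`|beval f (ws j) x0| + eta) * `|a j|.
  rewrite -(subrK (a j *: beval f (ws j) x0) (x1 - x)).
  apply: (le_trans (ler_normD _ _)); rewrite normrZ mulrDl addrC lerD //.
  by rewrite mulrC.
have [|x2 S2 E2] := IHjs x1.
  have := ler_distD x x1 x0; lra.
exists x2; first exact: S_trans S1 S2.
rewrite mulrDr; apply: le_trans (lerD E1 E2); apply: le_trans (ler_normD _ _).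
rewrite le_eqVlt; apply/orP; left; apply/eqP; congr (`|_|).
move: (a j *: _) (\sum_(_ <- _) _) => u v.
by apply/rowP => i; rewrite !mxE; ring.
Qed.

Lemma row_full_coords (M : 'M[R]_d) : row_full M ->
  exists2 C : R, 0 <= C & forall v : V, exists2 a : 'I_d -> R,
    v = \sum_j a j *: row j M & forall j, `|a j| <= C * `|v|.
Proof.
move=> fM; pose P := pinvmx M.
pose C := \sum_(i < d) \sum_(j < d) `|P i j|.
have C0 : 0 <= C by apply: sumr_ge0 => i _; exact: sumr_ge0.
exists C => // v; exists (fun j => (v *m P) 0 j).
  by rewrite -mulmx_sum_row mulmxKpV // submx_full.
move=> j; rewrite mxE; apply: (le_trans (ler_norm_sum _ _ _)).
rewrite /C mulr_suml; apply: ler_sum => i _.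
rewrite normrM mulrC; apply: ler_pM => //; last exact: rV_norm_coord.
by rewrite (bigD1 j) //= lerDl; exact: sumr_ge0.
Qed.

(* Expand y - x in the bracket frame at x0 and realize each component by a word
   move; the errors of these moves are small enough to halve s. *)
Lemma newton_step (x0 : V) : exists (l : nat) (K rho : R), [/\ (0 < l)%N, 0 <= K, 0 < rho &
  forall s x y, 0 <= s -> s <= rho -> `|x - x0| < rho -> `|y - x| <= s ^+ l ->
    exists x' T, [/\ 0 <= T <= K * s, S T x x' & `|y - x'| <= (s / 2) ^+ l]].
Proof.
have [ws full] := fH x0.
have [C C0 HC] := row_full_coords full.
have [j|kappa Hk] := @choice 'I_d R (fun j kappa => 0 <= kappa /\
    forall (x0 : V) (eta : R), 0 < eta ->
    exists2 r : R, 0 < r & forall (t a : R) x, 0 <= t -> t <= r ->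
    `|a| = t ^+ word_length (ws j) -> `|x - x0| < r ->
    exists2 x', S (kappa * t) x x' & `|x' - x - a *: beval f (ws j) x0| <= eta * `|a|).
  by have [kap k0 Hkap] := word_move ff tau0 tau1 S_trans S_gen (ws j); exists kap.
(* One exponent above all word lengths: for [s <= 1], a coefficient of size [C * s ^+ l] needs a
   move parameter of at most [(C + 1) * s]. The successor keeps [l] positive when [d = 0]. *)
pose l := (\sum_j word_length (ws j)).+1.
have lj j : (word_length (ws j) <= l)%N by rewrite /l (bigD1 j) //= leqW // leq_addr.
(* The total error is at most [eta * d * C * s ^+ l], which has to be at most [(s / 2) ^+ l]. *)
pose eta := 2^-1 ^+ l / (d%:R * C + 1).
have dC : 0 < d%:R * C + 1 by rewrite ltr_wpDl // mulr_ge0.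
have eta0 : 0 < eta by rewrite divr_gt0 // exprn_gt0.
have [j|r Hr] := @choice 'I_d R (fun j r => 0 < r /\ forall (t a : R) x, 0 <= t -> t <= r ->
    `|a| = t ^+ word_length (ws j) -> `|x - x0| < r ->
    exists2 x', S (kappa j * t) x x' & `|x' - x - a *: beval f (ws j) x0| <= eta * `|a|).
  by have [r r0 H] := (Hk j).2 x0 eta eta0; exists r.
have [r0 r00 Hr0] := pos_lower_bound (fun j => (Hr j).1).
pose B := \sum_(j < d) (`|beval f (ws j) x0| + eta) * C.
have B0 : 0 <= B by apply: sumr_ge0 => j _; rewrite mulr_ge0 // addr_ge0 // ltW.
(* Keeps all move parameters and all distances to [x0] below [r0]. *)
pose rho := Num.min 1 (r0 / (2 * (B + C + 1))).
have BC : 0 < B + C + 1 by rewrite ltr_wpDl // addr_ge0.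
have rho0 : 0 < rho by rewrite lt_min ltr01 divr_gt0 // mulr_gt0.
have rho1 : rho <= 1 by rewrite ge_min lexx.
have rhor : (B + C + 1) * rho <= r0 / 2.
  apply: (@le_trans _ _ ((B + C + 1) * (r0 / (2 * (B + C + 1))))).
    by rewrite ler_wpM2l ?(ltW BC) // ge_min lexx orbT.
  have WE (W u : R) : 0 < W -> W * (u / (2 * W)) = u / 2.
    by move=> W0; field; rewrite gt_eqF.
  by rewrite WE.
exists l, ((C + 1) * \sum_j kappa j), rho; split => //.
  by rewrite mulr_ge0 ?addr_ge0 // sumr_ge0 // => j _; case: (Hk j).
move=> s x y s0 srho xrho yx.
have s1 : s <= 1 by exact: le_trans rho1.
have [a aE aC] := HC (y - x).
have aCs j : `|a j| <= C * s ^+ l by apply: (le_trans (aC j)); rewrite ler_wpM2l.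
pose t j := `|a j| `^ ((word_length (ws j))%:R^-1).
have t0 j : 0 <= t j by exact: powR_ge0.
have wl j : (word_length (ws j))%:R != 0 :> R by rewrite pnatr_eq0 -lt0n word_length_gt0.
have tE j : `|a j| = t j ^+ word_length (ws j).
  by rewrite -powR_mulrn // /t -powRrM mulVf // powRr1.
have tC j : t j <= (C + 1) * s.
  have wj := word_length_gt0 (ws j).
  rewrite -(ler_pXn2r wj) ?nnegrE // -?tE; last by rewrite mulr_ge0 // addr_ge0.
  apply: (le_trans (aCs j)); rewrite exprMn; apply: ler_pM => //; first exact: exprn_ge0.
    apply: (@le_trans _ _ (C + 1)); first by rewrite lerDl.
    by rewrite -{1}(expr1 (C + 1)); apply: ler_weXn2l => //; rewrite lerDr.
  by apply: ler_wiXn2l.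
have sl : s ^+ l <= s by rewrite exprS ler_piMr // exprn_ile1.
have tr j : t j <= r j.
  apply: (le_trans (tC j)); apply: le_trans (Hr0 j).
  apply: (@le_trans _ _ ((B + C + 1) * rho)); last by apply: (le_trans rhor); lra.
  apply: ler_pM => //; [by rewrite addr_ge0|lra].
have step j z : `|z - x0| < r0 -> exists2 x', S (kappa j * t j) z x' &
    `|x' - z - a j *: beval f (ws j) x0| <= eta * `|a j|.
  by move=> zr; apply: (Hr j).2 => //; exact: lt_le_trans (Hr0 j).
have [|x' Sx' Ex'] := moves_seq (ltW eta0) step (js := index_enum 'I_d) (x := x).
  apply: (@le_lt_trans _ _ (`|x - x0| + B * s)); last first.
    have : B * s <= B * rho by rewrite ler_wpM2l.
    have : 0 <= C * rho by rewrite mulr_ge0 // ltW.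
    lra.
  rewrite lerD2l /B mulr_suml; apply: ler_sum => j _; rewrite -mulrA ler_wpM2l //.
    by rewrite addr_ge0 // ltW.
  by apply: (le_trans (aCs j)); rewrite ler_wpM2l.
exists x', (\sum_j kappa j * t j); split => //.
  rewrite sumr_ge0 /=; last by move=> j _; rewrite mulr_ge0 //; case: (Hk j).
  rewrite mulrAC mulrC mulr_suml; apply: ler_sum => j _; rewrite ler_wpM2l //.
  by case: (Hk j).
have sumE : \sum_j a j *: beval f (ws j) x0 = y - x.
  by rewrite aE; apply: eq_bigr => j _; congr (_ *: _); apply/rowP => k; rewrite !mxE.
rewrite sumE in Ex'.
rewrite distrC (_ : x' - y = x' - x - (y - x)); last by rewrite opprB addrA subrK.
apply: (le_trans Ex'); apply: (@le_trans _ _ (eta * (d%:R * C * s ^+ l))).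
  rewrite ler_wpM2l ?(ltW eta0) //; apply: (@le_trans _ _ (\sum_(j < d) C * s ^+ l)).
    by apply: ler_sum => j _.
  by rewrite sumr_const card_ord -(mulr_natl (C * s ^+ l)) mulrA.
rewrite exprMn mulrA [leRHS]mulrC ler_wpM2r ?exprn_ge0 //.
rewrite /eta mulrAC -mulrA ler_piMr ?exprn_ge0 // ler_pdivrMr // mul1r lerDl //.
Qed.

Theorem local_control (x0 : V) (e : R) : 0 < e -> exists2 delta : R, 0 < delta &
  forall x y, `|x - x0| < delta -> `|y - x0| < delta ->
    exists2 T, 0 <= T <= e & S T x y.
Proof.
move=> e0; have [l [K [rho [l0 K0 rho0 step]]]] := newton_step x0.
(* The iterates stay within [s ^+ l] of [y] and [s ^+ l / 2] bounds the distance of [y] to [x0], so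
   [rho / 2] keeps them in the domain of [step]. The last bound makes the total time [2 * K * s] at
   most [e]. *)
pose s := Num.min (Num.min (rho / 2) 1) (e / (2 * (K + 1))).
have K1 : 0 < K + 1 by rewrite ltr_wpDl.
have s0 : 0 < s by rewrite !lt_min ltr01 !divr_gt0 // mulr_gt0.
have [srho s1 se] : [/\ s <= rho / 2, s <= 1 & s <= e / (2 * (K + 1))].
  by rewrite /s !ge_min !lexx ?orbT.
have sl : s ^+ l <= s.
  by case: l l0 {step} => // l _; rewrite exprS ler_piMr ?(ltW s0) // exprn_ile1 // ltW.
pose delta := s ^+ l / 2.
have sl0 : 0 < s ^+ l by exact: exprn_gt0.
have delta0 : 0 < delta by rewrite divr_gt0.
exists delta => // x y xd yd.
pose q n : R := s * 2^-1 ^+ n.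
have q0 n : 0 <= q n by rewrite mulr_ge0 ?exprn_ge0 // ltW.
have qs n : q n <= s.
  by rewrite ler_piMr ?(ltW s0) // exprn_ile1 // invf_le1 ?ler1n.
have ql n : q n ^+ l <= q n.
  case: l l0 {step sl delta sl0 delta0 xd yd} => // l _.
  by rewrite exprS ler_piMr // exprn_ile1 // (le_trans (qs n)).
(* Turns [step] into a function that can be iterated; the default [(0, 0)] is returned when the
   distance to [y] is too large. *)
have [nx|F HF] := @choice (nat * V)%type (V * R)%type (fun nx xT =>
   `|y - nx.2| <= q nx.1 ^+ l ->
   [/\ 0 <= xT.2 <= K * q nx.1, S xT.2 nx.2 xT.1 & `|y - xT.1| <= q nx.1.+1 ^+ l]).
  have [yx|] := boolP (`|y - nx.2| <= q nx.1 ^+ l); last by exists (0, 0).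
  have [||x' [T [TK ST yx']]] := step (q nx.1) nx.2 y (q0 _) _ _ yx.
  - by rewrite (le_trans (qs _)) // (le_trans srho) // ler_pdivrMr // ler_peMr ?ler1n // ltW.
  - have h1 := ler_distD y nx.2 x0; rewrite (distrC nx.2 y) in h1.
    have h2 : q nx.1 ^+ l <= s ^+ l by apply: lerXn2r; rewrite ?nnegrE // ltW.
    move: yd; rewrite /delta; lra.
  by exists (x', T) => _; split => //=; rewrite /q exprSr mulrA.
pose z := fix z n := if n is n'.+1 then (F (n', z n')).1 else x.
have zq n : `|y - z n| <= q n ^+ l.
  elim: n => [|n IHn]; last by have [] := HF (n, z n) IHn.
  rewrite /q expr0 mulr1 /=; have := ler_distD x0 y x; rewrite (distrC x0).
  move: xd yd; rewrite /delta; lra.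
have [] := @S_limit z (fun n => (F (n, z n)).2) y (K * s) s.
- by move=> n; rewrite -mulrA; have [] := HF (n, z n) (zq n).
- by move=> n; have [] := HF (n, z n) (zq n).
- by move=> n; apply: (le_trans (zq n)).
move=> T /andP[T0 TK] ST; exists T => //; rewrite T0 (le_trans TK) //.
apply: (@le_trans _ _ (2 * (K + 1) * s)).
  by rewrite mulrA ler_wpM2r ?(ltW s0) // ler_wpM2l // lerDl.
by rewrite mulrC -ler_pdivlMr // mulr_gt0.
Qed.

End LocalControllability.

(** * Trajectories on the line and their cost *)

Section LebesgueTools.
Variable R : realType.
Local Notation leb := (@lebesgue_measure R).

Lemma measurable_addr (c : R) : measurable_fun [set: R] (fun s : R => s + c).
Proof.
by apply: continuous_measurable_fun => s; apply: cvgD; [exact: cvg_id|exact: cvg_cst].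
Qed.

Lemma preimage_addr_measurable (c : R) (A : set R) : measurable A ->
  measurable ((fun s : R => s + c) @^-1` A).
Proof.
by move=> mA; rewrite -[X in measurable X]setTI; exact: measurable_addr.
Qed.

(** The image measure under translation agrees with Lebesgue measure on half-open intervals, which
    determine it. *)
Lemma lebesgue_shift (c : R) (A : set R) : measurable A ->
  leb ((fun s => s + c) @^-1` A) = leb A.
Proof.
move=> mA; pose mu := pushforward leb (fun s : R => s + c).
pose muM : {measure set (measurableTypeR R) -> \bar R} :=
  @measure_function_pushforward__canonical__measure_function_Measure _ _
    (measurableTypeR R) (measurableTypeR R) R leb _ (measurable_addr c).
have H X : ocitv X -> leb X = muM X; last first.
  by rewrite (@lebesgue_measure_unique R muM H A mA).
move=> [[a b] _ <-] /=.
rewrite -[RHS]/(leb ((fun s : R => s + c) @^-1` `]a, b]%classic)).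
have -> : (fun s : R => s + c) @^-1` `]a, b]%classic = `](a - c), (b - c)]%classic.
  by apply/seteqP; split => s /=; rewrite !in_itv /= ltrBlDr lerBrDr.
rewrite !lebesgue_measure_itv /= !lte_fin ltrD2r; case: ifP => // _.
by rewrite -!EFinD; congr (_%:E); ring.
Qed.

Lemma ae_shift (c : R) (P : R -> Prop) : {ae leb, forall s, P s} ->
  {ae leb, forall s, P (s + c)}.
Proof.
move=> [A [mA A0 PA]]; exists ((fun s : R => s + c) @^-1` A); split.
- exact: preimage_addr_measurable.
- by rewrite lebesgue_shift.
- by move=> s /= nP; apply: PA.
Qed.

Lemma ae_neq (a : R) : {ae leb, forall s, s <> a}.
Proof.
exists [set a]; split => //; first exact: lebesgue_measure_set1.
by move=> s /= /contrapT.
Qed.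

Lemma ae_and (P Q : R -> Prop) : {ae leb, forall s, P s} -> {ae leb, forall s, Q s} ->
  {ae leb, forall s, P s /\ Q s}.
Proof.
by move=> aP aQ; apply: (negligibleS _ (negligibleU aP aQ)) => s /= /not_andP.
Qed.

Lemma ae_impl (P Q : R -> Prop) : (forall s, P s -> Q s) -> {ae leb, forall s, P s} ->
  {ae leb, forall s, Q s}.
Proof. by move=> PQ; apply: negligibleS => s /= nQ Ps; apply/nQ/PQ. Qed.

Lemma ae_all (P : nat -> R -> Prop) : (forall n, {ae leb, forall s, P n s}) ->
  {ae leb, forall s, forall n, P n s}.
Proof.
move=> aP; have := negligible_bigcup aP; apply: negligibleS.
by move=> s /= /existsNP[n nP]; exists n.
Qed.

Definition integr (h : R -> R) := leb.-integrable [set: R] (EFin \o h).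
Definition Rint (h : R -> R) : R := \int[leb]_(s in [set: R]) h s.

Lemma integr_measurable h : integr h -> measurable_fun [set: R] h.
Proof. by move=> /measurable_int/measurable_EFinP. Qed.

Lemma integrD h k : integr h -> integr k -> integr (fun s => h s + k s).
Proof. by move=> ih ik; exact: (integrableD measurableT ih ik). Qed.

Lemma integralRD h k : integr h -> integr k ->
  Rint (fun s => h s + k s) = Rint h + Rint k.
Proof. by move=> ih ik; exact: RintegralD. Qed.

Lemma pushforward_shift_eq (c : R) (f : R -> \bar R) :
  (\int[@pushforward _ _ (measurableTypeR R) (measurableTypeR R) R leb
     (fun s : R => (s + c)%R)]_s f s = \int[leb]_s f s)%E.
Proof.
pose muM : {measure set (measurableTypeR R) -> \bar R} :=
  @measure_function_pushforward__canonical__measure_function_Measure _ _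
    (measurableTypeR R) (measurableTypeR R) R leb _ (measurable_addr c).
apply: (@eq_measure_integral _ (measurableTypeR R) R setT leb muM) => A mA _.
exact: lebesgue_shift.
Qed.

Lemma integr_shift (c : R) h : integr h -> integr (fun s => h (s + c)).
Proof.
move=> ih; have mh := integr_measurable ih.
have mhc : measurable_fun [set: R] (fun s => h (s + c)).
  by apply: (measurableT_comp mh); exact: measurable_addr.
apply/integrableP; split; first exact/measurable_EFinP.
have /integrableP[_] := ih; apply: le_lt_trans.
have E := @ge0_integral_pushforward _ _ (measurableTypeR R) (measurableTypeR R) R _
  (measurable_addr c) leb setT (fun s => `|(h s)%:E|%E).
rewrite pushforward_shift_eq in E; rewrite E //.
by apply: measurableT_comp => //; exact/measurable_EFinP.
Qed.

Lemma integral_shift (c : R) h : integr h -> Rint (fun s => h (s + c)) = Rint h.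
Proof.
move=> ih; rewrite /Rint /Rintegral; congr fine.
have E := @integral_pushforward _ _ (measurableTypeR R) (measurableTypeR R) R _
  (measurable_addr c) leb setT (fun s => (h s)%:E).
have mh : measurable_fun [set: R] (fun s => (h s)%:E).
  exact: (measurable_int _ ih).
rewrite pushforward_shift_eq in E; rewrite (E mh) //.
exact: (integr_shift c ih).
Qed.

Lemma integr_restrict (A : set R) h : measurable A -> integr h ->
  integr (fun s => if s \in A then h s else 0).
Proof.
move=> mA ih.
have : leb.-integrable [set: R] ((EFin \o h) \_ A).
  refine (iffLR (@integrable_mkcond _ (measurableTypeR R) R leb A (EFin \o h) mA) _).
  exact: (@integrableS _ (measurableTypeR R) R leb setT A _ measurableT mA (@subsetT _ _) ih).
by apply: eq_integrable => // s _; rewrite /= patchE; case: ifP.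
Qed.

Lemma le_integralR h k : integr h -> integr k -> (forall s, h s <= k s) ->
  Rint h <= Rint k.
Proof. by move=> ih ik hk; apply: le_Rintegral. Qed.

Lemma integral_indic (a b c : R) : a <= b ->
  integr (fun s => if a <= s < b then c else 0) /\
  Rint (fun s => if a <= s < b then c else 0) = c * (b - a).
Proof.
move=> ab.
have mA : measurable (`[a, b[%classic : set R) by [].
have E : EFin \o (fun s => if a <= s < b then c else 0) = (cst c%:E) \_ (`[a, b[%classic : set R).
  apply/funext => s; rewrite patchE /= mem_setE /= in_itv /=.
  by case: ifP.
split.
  rewrite /integr E; refine (iffLR (@integrable_mkcond _ (measurableTypeR R) R leb _ (cst c%:E) mA) _).
  have ic := @integrable_continuous_itv R (fun=> c) a b (@cst_continuous _ _ c).
  apply: (@integrableS _ (measurableTypeR R) R leb `[a, b]%classic `[a, b[%classic) ic => //.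
  by move=> s /=; rewrite !in_itv /= => /andP[-> /ltW ->].
rewrite /Rint /Rintegral.
have -> : (\int[leb]_(s in [set: R]) (if (a <= s < b)%R then c else 0)%:E =
           \int[leb]_(s in `[a, b[%classic) (cst c%:E) s)%E.
  by rewrite [RHS]integral_mkcond -E.
have mu_ab : leb (`[a, b[%classic : set R) = (b - a)%:E.
  rewrite lebesgue_measure_itv /= lte_fin; case: ltP => [_|ba]; first by rewrite -EFinB.
  have -> : a = b by apply/eqP; rewrite eq_le ab.
  by rewrite subrr.
have I := @integral_cst _ (measurableTypeR R) R leb _ mA c%:E.
by rewrite [X in fine X]I; rewrite [X in (_ * X)%E]mu_ab.
Qed.

Lemma measurable_fun_ray (D : set R) (h : R -> R) : measurable D ->
  (forall a, measurable (D `&` h @^-1` [set y | a < y])) -> measurable_fun D h.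
Proof.
move=> mD H; apply: (measurability (@RGenOInfty.G R)) => //.
  exact: RGenOInfty.measurableE.
move=> _ [_ [a ->] <-]; rewrite (_ : `]a, +oo[%classic = [set y | a < y]); first exact: H.
by apply/seteqP; split => y /=; rewrite in_itv /= andbT.
Qed.

Section Composition.
Variables (d m : nat).
Local Notation V := 'rV[R]_d.
Local Notation U := 'rV[R]_m.

(** The open set where [Phi] exceeds [a] is a union of countably many boxes with rational centres,
    and the preimage of a box is a finite intersection of preimages of intervals by the
    coordinates. *)
Lemma measurable_continuous_comp (D : set R) (Phi : V * U -> R) (h : R -> V) (k : R -> U) :
  measurable D -> continuous Phi ->
  (forall i, measurable_fun D (fun s => h s 0 i)) ->
  (forall i, measurable_fun D (fun s => k s 0 i)) ->
  measurable_fun D (fun s => Phi (h s, k s)).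
Proof.
move=> mD cPhi mh mk; apply: measurable_fun_ray => // a.
pose Idx := (nat * ('rV[int]_d * 'rV[int]_m))%type.
pose r (n : nat) : R := (n.+1)%:R^-1.
pose box (j : Idx) : set (V * U) := [set p : V * U |
  (forall i, `|p.1 0 i - (j.2.1 0 i)%:~R * r j.1| < r j.1) /\
  (forall i, `|p.2 0 i - (j.2.2 0 i)%:~R * r j.1| < r j.1)].
pose good (j : Idx) : bool := `[< box j `<=` [set p | a < Phi p] >].
have r0 n : 0 < r n by rewrite invr_gt0.
have mbox (j : Idx) : measurable (D `&` [set s | box j (h s, k s)]).
  have mray (e : R -> R) (b c : R) : measurable_fun D e ->
      measurable (D `&` [set s | `|e s - b| < c]).
    move=> me; rewrite (_ : [set s | `|e s - b| < c] = e @^-1` `]b - c, b + c[%classic).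
      exact: me.
    by apply/seteqP; split => s /=; rewrite in_itv /= ltr_distl.
  have -> : D `&` [set s | box j (h s, k s)] =
    (D `&` \bigcap_(i in [set: 'I_d]) (D `&` [set s | `|h s 0 i - (j.2.1 0 i)%:~R * r j.1| < r j.1]))
    `&` (D `&` \bigcap_(i in [set: 'I_m]) (D `&` [set s | `|k s 0 i - (j.2.2 0 i)%:~R * r j.1| < r j.1])).
    apply/seteqP; split => s /=.
      move=> [Ds [H1 H2]]; split; split => // i _; split => //; [exact: H1|exact: H2].
    by move=> [[Ds H1] [_ H2]]; split => //; split => i; [exact: (H1 i I).2|exact: (H2 i I).2].
  apply: measurableI; apply: measurableI => //; apply: fin_bigcap_measurable => //= i _.
    exact: mray.
  exact: mray.
have -> : D `&` (fun s => Phi (h s, k s)) @^-1` [set y | a < y] =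
  \bigcup_(j in [set: Idx]) (if good j then D `&` [set s | box j (h s, k s)] else set0).
  apply/seteqP; split => s /=; last first.
    by move=> [j _]; rewrite /good; case: asboolP => // gj [Ds bs]; split => //; exact: gj bs.
  move=> [Ds as_].
  have : nbhs (h s, k s) [set p | a < Phi p].
    by have /cvgr_gt/(_ a as_) := cPhi (h s, k s).
  move=> /nbhs_ballP[e /= e0 He].
  (* Two points of a box of half-side [r n] are less than [2 * r n] apart in each coordinate. *)
  have [n _ Hn] := near_infty_natSinv_lt (PosNum (divr_gt0 e0 (ltr0n R 2))).
  have rn : r n < e / 2 by exact: (Hn n (leqnn n)).
  pose j : Idx := (n, (\row_i Num.floor (h s 0 i * n.+1%:R), \row_i Num.floor (k s 0 i * n.+1%:R))).
  have near_floor (c : R) : `|c - (Num.floor (c * n.+1%:R))%:~R * r n| < r n.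
    have H1 := Num.Theory.floor_le (c * n.+1%:R); have H2 := Num.Theory.lt_succ_floor (c * n.+1%:R).
    rewrite ger0_norm; last by rewrite subr_ge0 ler_pdivrMr.
    by rewrite ltrBlDr -{1}(mul1r (r n)) -mulrDl ltr_pdivlMr // addrC; rewrite intrD in H2.
  have bj : box j (h s, k s) by split => i /=; rewrite mxE.
  exists j => //; rewrite /good; case: asboolP => [_|[]]; first by split.
  move=> p [H1 H2]; apply: He.
  have close n' (v w : 'rV[R]_n') (z : 'rV[int]_n') :
     (forall i, `|v 0 i - (z 0 i)%:~R * r n| < r n) -> (forall i, `|w 0 i - (z 0 i)%:~R * r n| < r n) ->
     `|v - w| < e.
    move=> Hv Hw; apply: (@le_lt_trans _ _ (2 * r n)); last by rewrite mulrC -ltr_pdivlMr.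
    apply: rV_norm_le => [|i]; first by rewrite mulr_ge0 // ltW.
    rewrite !mxE; apply: (le_trans (ler_distD ((z 0 i)%:~R * r n) _ _)).
    by rewrite mulrDl mul1r lerD // ltW // distrC.
  have [/= Hh Hk] := bj.
  split; rewrite /= -ball_normE /=; [exact: close Hh H1|exact: close Hk H2].
apply: countable_bigcupT_measurable; first exact: countableP.
by move=> j; case: (good j).
Qed.

End Composition.
End LebesgueTools.

(** * Concatenation and splitting of controlled paths *)

Section Trajectories.
Variables (R : realType) (d m : nat).
Local Notation V := 'rV[R]_d.
Local Notation U := 'rV[R]_m.
Local Notation leb := (@lebesgue_measure R).

(** A nondecreasing 1-Lipschitz [phi] sends ordered intervals to ordered intervals of no larger
    total length. It serves for translations and for freezing a path at a given time. *)
Lemma abs_cont_reparam (g : R -> V) (phi : R -> R) (a b a' b' : R) :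
  (forall s t, a <= s -> s <= t -> t <= b -> phi s <= phi t /\ phi t - phi s <= t - s) ->
  (forall s, a <= s -> s <= b -> a' <= phi s <= b') ->
  abs_cont g a' b' -> abs_cont (g \o phi) a b.
Proof.
move=> mono into ac e /ac[del del0 H]; exists del => // n s t st disj small.
apply: (H n (phi \o s) (phi \o t)) => /=.
- move=> k; have [as_ [st_ tb]] := st k.
  have [mst _] := mono _ _ as_ st_ tb.
  have /andP[h1 _] := into _ as_ (le_trans st_ tb).
  by have /andP[_ h2] := into _ (le_trans as_ st_) tb.
- move=> k l kl; have [ak [stk _]] := st k; have [_ [stl tb]] := st l.
  by have [] := mono _ _ (le_trans ak stk) (disj _ _ kl) (le_trans stl tb).
- apply: le_lt_trans small; apply: ler_sum => k _; have [as_ [st_ tb]] := st k.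
  by have [] := mono _ _ as_ st_ tb.
Qed.

Lemma abs_contD (g h : R -> V) (a b : R) : abs_cont g a b -> abs_cont h a b ->
  abs_cont (fun s => g s + h s) a b.
Proof.
move=> ag ah e e0; have e2 : 0 < e / 2 by rewrite divr_gt0.
have [d1 d10 H1] := ag _ e2; have [d2 d20 H2] := ah _ e2.
exists (Num.min d1 d2); first by rewrite lt_min d10.
move=> n s t st disj; rewrite lt_min => /andP[small1 small2].
rewrite (splitr e); apply: le_lt_trans (ltrD (H1 n s t st disj small1) (H2 n s t st disj small2)).
rewrite -big_split /=; apply: ler_sum => k _.
by apply: le_trans (ler_normD _ _); rewrite opprD addrACA.
Qed.

Lemma lipschitz_abs_cont (g : R -> V) (M a b : R) :
  (forall s t, `|g s - g t| <= M * `|s - t|) -> abs_cont g a b.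
Proof.
move=> gM e e0; have M0 : 0 < `|M| + 1 by rewrite ltr_wpDl.
exists (e / (`|M| + 1)); first by rewrite divr_gt0.
move=> n s t st disj; rewrite ltr_pdivlMr // => small.
apply: le_lt_trans small; rewrite mulr_suml; apply: ler_sum => k _.
have [_ [st_ _]] := st k.
apply: (le_trans (gM _ _)); rewrite (ger0_norm (_ : 0 <= t k - s k)) ?subr_ge0 // mulrC.
by rewrite ler_wpM2l ?subr_ge0 // (le_trans (ler_norm M)) // lerDl.
Qed.

Lemma abs_cont_cst (x : V) (a b : R) : abs_cont (fun=> x) a b.
Proof. by apply: (@lipschitz_abs_cont _ 0) => s t; rewrite subrr normr0 mul0r. Qed.

Lemma is_derive_translate (g : R -> V) (c s : R) v : is_derive (s + c) (1 : R) g v ->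
  is_derive s (1 : R) (fun t => g (t + c)) v.
Proof.
move=> [dg vE].
have E : (fun h : R => h^-1 *: (((fun t => g (t + c)) \o shift s) (h *: (1 : R)) - g (s + c))) =
  (fun h : R => h^-1 *: ((g \o shift (s + c)) (h *: (1 : R)) - g (s + c))).
  by apply/funext => h /=; rewrite addrA.
by apply: DeriveDef; [rewrite /derivable E|rewrite -vE /derive E].
Qed.

Variable f : 'I_m -> V -> V.

Lemma Fu0 x : Fu f x 0 = 0.
Proof. by rewrite /Fu big1 // => i _; rewrite mxE scale0r. Qed.

(* Paths live on the whole line and rest at their end points, so that translation
   and addition suffice to concatenate them. *)
Definition traj_ends (T : R) (x y : V) (g : R -> V) (u : R -> U) : Prop :=
  [/\ 0 <= T, forall s, s <= 0 -> g s = x, forall s, T <= s -> g s = y &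
      forall s, ~~ (0 <= s < T) -> u s = 0].

Definition traj_regular (g : R -> V) (u : R -> U) : Prop :=
  [/\ forall a b, abs_cont g a b,
      forall i, measurable_fun [set: R] (fun s => u s 0 i),
      forall i, integr (fun s => (u s 0 i) ^+ 2) &
      {ae leb, forall s, is_derive s (1 : R) g (Fu f (g s) (u s))}].

Definition traj T x y g u := traj_ends T x y g u /\ traj_regular g u.

(** At every time at least one of the two paths rests at the junction point [y], which the
    subtraction removes. *)
Definition cat_path (T : R) (y : V) (g1 g2 : R -> V) : R -> V :=
  fun s => g1 s + g2 (s - T) - y.
Definition cat_ctrl (T : R) (u1 u2 : R -> U) : R -> U := fun s => u1 s + u2 (s - T).

Lemma cat_before T1 T2 x y z g1 u1 g2 u2 s :
  traj_ends T1 x y g1 u1 -> traj_ends T2 y z g2 u2 -> s < T1 ->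
  [/\ g2 (s - T1) = y, u2 (s - T1) = 0, cat_path T1 y g1 g2 s = g1 s &
      cat_ctrl T1 u1 u2 s = u1 s].
Proof.
move=> [T10 g1x g1y u10] [T20 g2y g2z u20] sT.
have e1 : g2 (s - T1) = y by apply: g2y; rewrite subr_le0 ltW.
have e2 : u2 (s - T1) = 0 by apply: u20; rewrite subr_ge0 leNgt sT.
by split; rewrite // /cat_path /cat_ctrl ?e1 ?e2 ?addrK ?addr0.
Qed.

Lemma cat_after T1 T2 x y z g1 u1 g2 u2 s :
  traj_ends T1 x y g1 u1 -> traj_ends T2 y z g2 u2 -> T1 <= s ->
  [/\ g1 s = y, u1 s = 0, cat_path T1 y g1 g2 s = g2 (s - T1) &
      cat_ctrl T1 u1 u2 s = u2 (s - T1)].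
Proof.
move=> [T10 g1x g1y u10] [T20 g2y g2z u20] sT.
have e1 : g1 s = y by exact: g1y.
have e2 : u1 s = 0 by apply: u10; rewrite (ltNge s) sT andbF.
by split; rewrite // /cat_path /cat_ctrl ?e1 ?e2 ?add0r // addrC addrA addNr add0r.
Qed.

Lemma traj_ends_cat T1 T2 x y z g1 u1 g2 u2 :
  traj_ends T1 x y g1 u1 -> traj_ends T2 y z g2 u2 ->
  traj_ends (T1 + T2) x z (cat_path T1 y g1 g2) (cat_ctrl T1 u1 u2).
Proof.
move=> e1 e2; have [T10 g1x g1y u10] := e1; have [T20 g2y g2z u20] := e2.
split; first by rewrite addr_ge0.
- move=> s s0; rewrite /cat_path g1x // g2y ?addrK //.
  by rewrite subr_le0 (le_trans s0).
- move=> s sT; have sT1 : T1 <= s by apply: le_trans sT; rewrite lerDl.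
  have [_ _ -> _] := cat_after e1 e2 sT1.
  by apply: g2z; rewrite lerBrDl.
- move=> s; rewrite negb_and -ltNge -leNgt => /orP[s0|sT].
    have [|_ _ _ ->] := @cat_before _ _ _ _ _ _ _ _ _ s e1 e2.
      exact: lt_le_trans T10.
    by apply: u10; rewrite leNgt s0.
  have sT1 : T1 <= s by apply: le_trans sT; rewrite lerDl.
  have [_ _ _ ->] := cat_after e1 e2 sT1.
  have sT2 : T2 <= s - T1 by rewrite lerBrDl.
  by apply: u20; rewrite (ltNge _ T2) sT2 andbF.
Qed.

Lemma traj_cat T1 T2 x y z g1 u1 g2 u2 : traj T1 x y g1 u1 -> traj T2 y z g2 u2 ->
  traj (T1 + T2) x z (cat_path T1 y g1 g2) (cat_ctrl T1 u1 u2).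
Proof.
move=> [e1 [ac1 mu1 iu1 ae1]] [e2 [ac2 mu2 iu2 ae2]]; split; first exact: traj_ends_cat.
split.
- move=> a b; apply: abs_contD; last exact: abs_cont_cst.
  apply: abs_contD => //.
  apply: (@abs_cont_reparam g2 (fun s => s - T1) a b (a - T1) (b - T1)) => //.
    by move=> s t _ st _; rewrite lerD2r opprB addrA subrK.
  by move=> s as_ sb; rewrite !lerD2r as_.
- move=> i; rewrite (_ : (fun s => _) = (fun s => u1 s 0 i + u2 (s - T1) 0 i)); last first.
    by apply/funext => s; rewrite mxE.
  apply: measurable_funD => //.
  exact: (measurableT_comp (mu2 i) (measurable_addr (- T1))).
- move=> i; rewrite (_ : (fun s => _) =
    (fun s => (u1 s 0 i) ^+ 2 + (u2 (s - T1) 0 i) ^+ 2)); last first.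
    apply/funext => s; rewrite mxE; have [sT|sT] := ltP s T1.
      have [_ -> _ _] := cat_before e1 e2 sT.
      by rewrite mxE expr0n /= !addr0.
    have [_ -> _ _] := cat_after e1 e2 sT.
    by rewrite mxE expr0n /= !add0r.
  by apply: integrD => //; exact: (integr_shift (- T1) (iu2 i)).
- apply: ae_impl (ae_and ae1 (ae_shift (- T1) ae2)) => s [D1 D2].
  (* One of the two controls vanishes, so its velocity is 0; the final [- 0] is the derivative of
     the constant [y]. *)
  have -> : Fu f (cat_path T1 y g1 g2 s) (cat_ctrl T1 u1 u2 s) =
    Fu f (g1 s) (u1 s) + Fu f (g2 (s - T1)) (u2 (s - T1)) - 0.
    have [sT|sT] := ltP s T1.
      have [_ -> -> ->] := cat_before e1 e2 sT.
      by rewrite Fu0 addr0 subr0.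
    have [_ -> -> ->] := cat_after e1 e2 sT.
    by rewrite Fu0 add0r subr0.
  apply: is_deriveB; apply: is_deriveD; exact: is_derive_translate.
Qed.

(** Freezing the time with [min] and [max] leaves a path on the whole line, absolutely continuous by
    [abs_cont_reparam]. *)
Definition left_path (T : R) (g : R -> V) : R -> V := fun s => g (Num.min s T).
Definition left_ctrl (T : R) (u : R -> U) : R -> U := fun s => if s < T then u s else 0.
Definition right_path (T : R) (g : R -> V) : R -> V := fun s => g (Num.max s 0 + T).
Definition right_ctrl (T : R) (u : R -> U) : R -> U := fun s => if 0 <= s then u (s + T) else 0.

Lemma near_lt (s T : R) : s < T -> \forall t \near s, t < T.
Proof. by move=> sT; exact: lt_nbhsl. Qed.

Lemma near_gt (s T : R) : T < s -> \forall t \near s, T < t.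
Proof. by move=> sT; exact: lt_nbhsr. Qed.

Lemma traj_split T1 T2 x z g u : 0 <= T1 -> 0 <= T2 -> traj (T1 + T2) x z g u ->
  traj T1 x (g T1) (left_path T1 g) (left_ctrl T1 u) /\
  traj T2 (g T1) z (right_path T1 g) (right_ctrl T1 u).
Proof.
move=> T10 T20 [[_ gx gz u0] [ac mu iu aeg]]; split; split.
- split => //.
  + by move=> s s0; rewrite /left_path min_l ?(le_trans s0) // gx.
  + by move=> s sT; rewrite /left_path min_r.
  + move=> s nsT; rewrite /left_ctrl; case: ifP => // sT; apply: u0.
    by move: nsT; rewrite sT andbT => /negbTE ->.
- split.
  + move=> a b; apply: (@abs_cont_reparam g (fun s => Num.min s T1) a b
      (Num.min a T1) (Num.min b T1)) => //.
      move=> s t _ st _; split; first by rewrite le_min !ge_min st lexx orbT.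
      by case: (leP t T1) => tT; case: (leP s T1) => sT; lra.
    by move=> s as_ sb; rewrite !le_min !ge_min as_ sb lexx !orbT.
  + move=> i; rewrite (_ : (fun s => _) = (fun s => if s < T1 then u s 0 i else 0)); last first.
      by apply/funext => s; rewrite /left_ctrl; case: ifP => // _; rewrite mxE.
    apply: measurable_fun_ifT => //; exact: measurable_fun_ltr.
  + move=> i; have := @integr_restrict R `]-oo, T1[%classic _ _ (iu i).
    rewrite (_ : (fun s => if s \in _ then _ else _) = (fun s => (left_ctrl T1 u s 0 i) ^+ 2)).
      by apply; exact: measurable_itv.
    apply/funext => s; rewrite /left_ctrl mem_setE /= in_itv /=.
    by case: ifP => // _; rewrite mxE expr0n.
  + apply: ae_impl (ae_and aeg (ae_neq T1)) => s [D sT].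
    rewrite /left_ctrl; case: ltP => [lt|ge].
      rewrite {2}/left_path min_l ?ltW //; apply: near_eq_is_derive D.
      by apply: filterS (near_lt lt) => t tT; rewrite /left_path min_l // ltW.
    have gt : T1 < s by rewrite lt_neqAle ge andbT; apply/eqP => E; exact: sT.
    rewrite Fu0; apply: (near_eq_is_derive _ (is_derive_cst (g T1) s (1 : R))).
    by apply: filterS (near_gt gt) => t tT; rewrite /left_path min_r // ltW.
- split => //.
  + by move=> s s0; rewrite /right_path max_r // add0r.
  + move=> s sT; rewrite /right_path max_l ?(le_trans T20) //.
    by apply: gz; rewrite addrC lerD2r.
  + move=> s nsT; rewrite /right_ctrl; case: ifP => // s0; apply: u0.
    by move: nsT; rewrite s0 /= -leNgt => sT; rewrite negb_and -leNgt (addrC s) lerD2l sT orbT.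
- split.
  + move=> a b; apply: (@abs_cont_reparam g (fun s => Num.max s 0 + T1) a b
      (Num.max a 0 + T1) (Num.max b 0 + T1)) => //.
      move=> s t _ st _; split.
        by rewrite lerD2r ge_max !le_max st lexx !orbT.
      by case: (leP t 0) => t0; case: (leP s 0) => s0; lra.
    by move=> s as_ sb; rewrite !lerD2r !ge_max !le_max as_ sb lexx !orbT.
  + move=> i; rewrite (_ : (fun s => _) = (fun s => if 0 <= s then u (s + T1) 0 i else 0)); last first.
      by apply/funext => s; rewrite /right_ctrl; case: ifP => // _; rewrite mxE.
    apply: measurable_fun_ifT => //; first exact: measurable_fun_ler.
    exact: (measurableT_comp (mu i) (measurable_addr T1)).
  + move=> i; have := @integr_restrict R `[0, +oo[%classic _ _ (integr_shift T1 (iu i)).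
    rewrite (_ : (fun s => if s \in _ then _ else _) = (fun s => (right_ctrl T1 u s 0 i) ^+ 2)).
      by apply; exact: measurable_itv.
    apply/funext => s; rewrite /right_ctrl mem_setE /= in_itv /= andbT.
    by case: ifP => // _; rewrite mxE expr0n.
  + apply: ae_impl (ae_and (ae_shift T1 aeg) (ae_neq 0)) => s [D s0].
    rewrite /right_ctrl; case: leP => [ge|lt].
      have gt : 0 < s by rewrite lt_neqAle ge andbT; apply/eqP => E; exact: s0.
      rewrite {2}/right_path max_l //.
      apply: (near_eq_is_derive _ (is_derive_translate D)).
      by apply: filterS (near_gt gt) => t t0; rewrite /right_path max_l // ltW.
    rewrite Fu0; apply: (near_eq_is_derive _ (is_derive_cst (g T1) s (1 : R))).
    by apply: filterS (near_lt lt) => t t0; rewrite /right_path max_r ?add0r // ltW.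
Qed.

End Trajectories.

(** * Reachability at a given cost, compared with admissible pairs *)

Section Reachability.
Variables (R : realType) (d m : nat).
Local Notation V := 'rV[R]_d.
Local Notation U := 'rV[R]_m.
Local Notation leb := (@lebesgue_measure R).

Lemma abs_cont_continuous (g : R -> V) : (forall a b, abs_cont g a b) -> continuous g.
Proof.
move=> ac s; apply/cvgrPdist_lt => e e0.
have [del del0 H] := ac (s - 1) (s + 1) e e0.
have N : \forall t \near s, `|s - t| < Num.min del 1.
  by apply/nbhs_ballP; exists (Num.min del 1) => //=; rewrite lt_min del0 ltr01.
apply: filterS N => t; rewrite lt_min => /andP[td t1].
have one (a b : R) : s - 1 <= a -> a <= b -> b <= s + 1 -> b - a < del -> `|g b - g a| < e.
  move=> h1 h2 h3 h4; have := H 1%N (fun=> a) (fun=> b); rewrite !big_ord1; apply => //.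
  by move=> k l; rewrite !ord1 ltnn.
have := t1; rewrite ltr_distl => /andP[t11 t12].
have [st|ts] := leP s t.
  rewrite distrC; apply: one => //; [lra|lra|].
  by apply: le_lt_trans td; rewrite distrC ler_norm.
by apply: one; [lra|exact: ltW|lra|apply: le_lt_trans td; exact: ler_norm].
Qed.

Variables (f : 'I_m -> V -> V) (L : V -> U -> R).
Hypothesis fper : forall i, Zd_periodic (f i).
Hypothesis Lper : Zd_periodic L.
Hypothesis Lcont : continuous (fun p : V * U => L p.1 p.2).
Variable K2 : R.
Hypothesis Lbound : forall x u, - K2 <= L x u.

(** [L] need not vanish on a resting path, hence the cut-off; the interval is half-open so that the
    payments of consecutive pieces add up without overlap. *)
Definition pay (T : R) (g : R -> V) (u : R -> U) : R -> R :=
  fun s => if 0 <= s < T then L (g s) (u s) else 0.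

(** End points are compared in R^d; congruence modulo Z^d enters with [treach]. *)
Definition reach (T : R) (x y : V) (c : R) : Prop := exists g u,
  [/\ traj f T x y g u, integr (pay T g u) & Rint (pay T g u) = c].

Lemma reach_ge0 T x y c : reach T x y c -> 0 <= T.
Proof. by move=> [g [u [[[]]]]]. Qed.

Lemma reach_cat T1 T2 x y z c1 c2 : reach T1 x y c1 -> reach T2 y z c2 ->
  reach (T1 + T2) x z (c1 + c2).
Proof.
move=> [g1 [u1 [t1 i1 <-]]] [g2 [u2 [t2 i2 <-]]].
exists (cat_path T1 y g1 g2), (cat_ctrl T1 u1 u2).
have e1 := t1.1; have e2 := t2.1.
have E : pay (T1 + T2) (cat_path T1 y g1 g2) (cat_ctrl T1 u1 u2) =
  (fun s => pay T1 g1 u1 s + pay T2 g2 u2 (s + - T1)).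
  apply/funext => s; rewrite /pay; have [sT|sT] := ltP s T1.
    have [_ _ -> ->] := cat_before e1 e2 sT.
    rewrite andbT (_ : 0 <= s - T1 = false) /= ?addr0; last by rewrite subr_ge0 leNgt sT.
    by rewrite (lt_le_trans sT) ?andbT // lerDl; case: e2.
  have [_ _ -> ->] := cat_after e1 e2 sT.
  rewrite andbF add0r subr_ge0 sT /= ltrBlDl (_ : 0 <= s) //.
  by apply: le_trans sT; case: e1.
have i2' := integr_shift (- T1) i2.
split; first exact: traj_cat.
  by rewrite E; exact: integrD.
by rewrite E integralRD // integral_shift.
Qed.

Lemma reach_split T1 T2 x z c : 0 <= T1 -> 0 <= T2 -> reach (T1 + T2) x z c ->
  exists y c1 c2, [/\ reach T1 x y c1, reach T2 y z c2 & c = c1 + c2].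
Proof.
move=> T10 T20 [g [u [t i <-]]].
have [t1 t2] := traj_split T10 T20 t.
have i1 : integr (pay T1 (left_path T1 g) (left_ctrl T1 u)).
  have := @integr_restrict R `]-oo, T1[%classic _ (measurable_itv _) i.
  congr integr; apply/funext => s.
  rewrite mem_setE /= in_itv /= /pay /left_path /left_ctrl; case: ifP => sT; last by rewrite ?sT andbF.
  by rewrite min_l ?(ltW sT) // ?sT (lt_le_trans sT) ?lerDl.
have i2 : integr (pay T2 (right_path T1 g) (right_ctrl T1 u)).
  have := @integr_restrict R `[0, +oo[%classic _ (measurable_itv _) (integr_shift T1 i).
  congr integr; apply/funext => s.
  rewrite mem_setE /= in_itv /= andbT /pay /right_path /right_ctrl; case: ifP => s0 //=.
  by rewrite max_l // addr_ge0 //= (addrC s) ltrD2l.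
exists (g T1), (Rint (pay T1 (left_path T1 g) (left_ctrl T1 u))),
  (Rint (pay T2 (right_path T1 g) (right_ctrl T1 u))); split.
- by exists (left_path T1 g), (left_ctrl T1 u).
- by exists (right_path T1 g), (right_ctrl T1 u).
rewrite -(integral_shift (- T1) i2) -integralRD //; last exact: (integr_shift (- T1) i2).
congr Rint; apply/funext => s.
rewrite /pay /left_path /left_ctrl /right_path /right_ctrl.
have [sT|sT] := ltP s T1.
  rewrite (_ : 0 <= s - T1 = false) /= ?addr0 ?andbT; last by rewrite subr_ge0 leNgt sT.
  by rewrite (lt_le_trans sT) ?lerDl // ?andbT.
by rewrite andbF add0r subr_ge0 sT /= max_l ?subr_ge0 // subrK ltrBlDl (le_trans T10 sT).
Qed.

Lemma reach_lower T x y c : reach T x y c -> - (K2 * T) <= c.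
Proof.
move=> [g [u [[[T0 _ _ _] _] i <-]]].
have [ii Ei] := integral_indic (- K2) T0.
rewrite -mulNr -{1}(subr0 T) -Ei; apply: le_integralR => // s.
by rewrite /pay; case: ifP.
Qed.

Lemma reach_translate T x y c (z : 'rV[int]_d) : reach T x y c ->
  reach T (x + intvec R z) (y + intvec R z) c.
Proof.
move=> [g [u [[[T0 gx gy u0] [ac mu iu aeg]] i E]]].
exists (fun s => g s + intvec R z), u.
have pE : pay T (fun s => g s + intvec R z) u = pay T g u.
  by apply/funext => s; rewrite /pay Lper.
split; rewrite ?pE //; split.
  by split => // s hs; [rewrite gx|rewrite gy].
split => //.
  by move=> a b; apply: abs_contD => //; exact: abs_cont_cst.
apply: ae_impl aeg => s D.
rewrite (_ : Fu f (g s + intvec R z) (u s) = Fu f (g s) (u s) + 0).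
  by apply: is_deriveD.
by rewrite addr0; apply: eq_bigr => j _; rewrite fper.
Qed.

(** The negative part is bounded on a set of finite measure, so its integral is finite; an integral
    below [+oo] then forces the positive part to be finite as well. *)
Lemma integrable_bounded_below (A : set R) (h : R -> R) (C : R) : measurable A ->
  (leb A < +oo)%E -> measurable_fun A h -> (forall s, A s -> - C <= h s) ->
  (\int[leb]_(s in A) (h s)%:E < +oo)%E -> leb.-integrable A (EFin \o h).
Proof.
move=> mA fA mh hC intlt.
have mEh : measurable_fun A (EFin \o h) by exact/measurable_EFinP.
have negfin : (\int[leb]_(s in A) (EFin \o h)^\- s < +oo)%E.
  apply: (@le_lt_trans _ _ (\int[leb]_(s in A) (cst `|C|%:E s))%E).
    apply: ge0_le_integral => //=.
    - exact: measurable_funeneg.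
    - move=> s As; rewrite funenegE /= -EFin_max lee_fin ge_max normr_ge0 andbT.
      by have := hC s As; have := ler_norm C; lra.
  by rewrite integral_cst // lte_mul_pinfty.
have posfin : (\int[leb]_(s in A) (EFin \o h)^\+ s < +oo)%E.
  have aux (p n : \bar R) : (n < +oo -> 0 <= n -> p - n < +oo -> p < +oo)%E.
    case: p => [p| |] //; first by rewrite ltry.
    by case: n => [n| |].
  apply: aux negfin _ _; first by apply: integral_ge0 => s _; exact: funeneg_ge0.
  by rewrite -integralE.
apply/integrableP; split => //.
under eq_integral do rewrite -[X in `|X|%E]/((EFin \o h) _) -/((abse \o (EFin \o h)) _) fune_abse.
rewrite ge0_integralD //; [exact: lte_add_pinfty|exact: measurable_funepos|exact: measurable_funeneg].
Qed.

(** Admissibility constrains a pair on [[0, T]] only, so the path is frozen and the control cut off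
    outside. The lower bound on [L] turns a cost below [+oo] into an integrable one. *)
Lemma reach_of_admissible (T : R) (g : R -> V) (u : R -> U) : 0 <= T -> admissible f T g u ->
  (cost L T g u < +oo)%E -> exists2 c, cost L T g u = c%:E & reach T (g 0) (g T) c.
Proof.
move=> T0 [acg [uL2 aeg]] fincost.
pose gc (s : R) := g (Num.max 0 (Num.min s T)).
pose uc (s : R) : U := if 0 <= s < T then u s else 0.
have clampE (s : R) : 0 <= s -> s <= T -> Num.max 0 (Num.min s T) = s.
  by move=> s0 sT; rewrite min_l // max_r.
have mco : measurable (`[0, T[%classic : set R) by exact: measurable_itv.
have mcc : measurable (`[0, T]%classic : set R) by exact: measurable_itv.
have sub : (`[0, T[%classic : set R) `<=` (`[0, T]%classic : set R).
  by move=> s /=; rewrite !in_itv /= => /andP[-> /ltW ->].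
have acgc a b : abs_cont gc a b.
  apply: (@abs_cont_reparam _ _ g (fun s => Num.max 0 (Num.min s T)) a b 0 T) => //.
    move=> s t _ st _; split.
      rewrite ge_max !le_max lexx /=; apply/orP; right.
      by rewrite le_min !ge_min st lexx orbT.
    by case: (leP t T) => tT; case: (leP s T) => sT; case: (leP 0 t) => t0;
      case: (leP 0 s) => s0; rewrite ?(max_r T0); lra.
  by move=> s _ _; rewrite le_max lexx /= ge_max T0 ge_min lexx orbT.
have mu_co i : measurable_fun `[0, T[%classic (fun s => u s 0 i).
  exact: measurable_funS mcc sub (uL2 i).1.
have ucE i : (fun s => uc s 0 i) = (fun s => u s 0 i) \_ `[0, T[%classic.
  apply/funext => s; rewrite patchE mem_setE /= in_itv /= /uc.
  by case: ifP => // _; rewrite mxE.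
have tr : traj f T (g 0) (g T) gc uc.
  split; split => //.
  - by move=> s s0; rewrite /gc min_l ?(le_trans s0) // max_l.
  - by move=> s sT; rewrite /gc min_r // max_r.
  - by move=> s; rewrite /uc => /negbTE ->.
  - by move=> i; rewrite ucE; apply/(measurable_restrictT _ mco).
  - move=> i; have [mui intu] := uL2 i.
    have iu : leb.-integrable `[0, T]%classic (EFin \o (fun s => u s 0 i ^+ 2)).
      apply/integrableP; split; first by apply/measurable_EFinP; exact: measurable_funX.
      by under eq_integral do rewrite /= ger0_norm ?sqr_ge0 //.
    have := iffLR (@integrable_mkcond _ (measurableTypeR R) R leb _ _ mco)
      (@integrableS _ (measurableTypeR R) R leb _ _ _ mcc mco sub iu).
    rewrite /integr; congr (_.-integrable _ _); apply/funext => s.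
    rewrite patchE mem_setE /= in_itv /= /uc; case: ifP => // _.
    by rewrite mxE expr0n.
  - apply: ae_impl (ae_and aeg (ae_and (ae_neq 0) (ae_neq T))) => s [D [s0 sT]].
    rewrite /uc; case: ifPn => [/andP[s0' sT']|].
      have s0'' : 0 < s by rewrite lt_neqAle s0' andbT; apply/eqP => E; exact: s0.
      have [|dg gE] := D; first by rewrite /I0 /= in_itv /= s0' ltW.
      have -> : gc s = g s by rewrite /gc clampE // ltW.
      rewrite -gE.
      apply: near_eq_is_derive (derivableP dg).
      apply: filterS (filterI (near_gt s0'') (near_lt sT')) => t [t0 tT].
      by rewrite /gc clampE // ltW.
    rewrite negb_and -ltNge -leNgt => /orP[s0'|sT']; rewrite Fu0.
      apply: (near_eq_is_derive _ (is_derive_cst (g 0) s (1 : R))).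
      apply: filterS (near_lt s0') => t t0.
      by rewrite /gc min_l ?(le_trans (ltW t0)) // max_l // ltW.
    have sT'' : T < s by rewrite lt_neqAle sT' andbT; apply/eqP => E; exact: sT.
    apply: (near_eq_is_derive _ (is_derive_cst (g T) s (1 : R))).
    apply: filterS (near_gt sT'') => t tT.
    by rewrite /gc min_r ?(ltW tT) // max_r.
have cgc : continuous gc := abs_cont_continuous acgc.
have mg i : measurable_fun [set: R] (fun s => gc s 0 i).
  apply: continuous_measurable_fun => s.
  apply: (@continuous_comp _ _ _ gc (fun y : V => y 0 i)); first exact: cgc.
  exact: coord_continuous.
(* Measurability is obtained for the clamped path, which is continuous on the whole line, and
   transferred to [g] on the interval. *)
have mL : measurable_fun `[0, T]%classic (fun s => L (g s) (u s)).
  have : measurable_fun `[0, T]%classic (fun s => L (gc s) (u s)).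
    apply: (@measurable_continuous_comp R d m _ (fun p : V * U => L p.1 p.2) gc u) => //.
      by move=> i; exact: measurable_funTS.
    by move=> i; exact: (uL2 i).1.
  apply: eq_measurable_fun => s; rewrite mem_setE /= in_itv /= => /andP[s0 sT].
  by rewrite /gc clampE.
have iL : leb.-integrable `[0, T]%classic (EFin \o (fun s => L (g s) (u s))).
  apply: (@integrable_bounded_below _ _ K2) => //.
  by rewrite lebesgue_measure_itv /=; case: ifP => _; rewrite ?ltry // -EFinB ltry.
have iLco := @integrableS _ (measurableTypeR R) R leb _ _ _ mcc mco sub iL.
have payE : EFin \o pay T gc uc = (EFin \o (fun s => L (g s) (u s))) \_ `[0, T[%classic.
  apply/funext => s; rewrite patchE mem_setE /= in_itv /= /pay /uc.
  case: ifPn => // cond; have /andP[s0 sT] := cond; rewrite /gc clampE ?(ltW sT) //.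
  by rewrite cond.
have costE : cost L T g u = (\int[leb]_s (pay T gc uc s)%:E)%E.
  rewrite -[RHS]/(\int[leb]_s (EFin \o pay T gc uc) s)%E payE -integral_mkcond.
  rewrite /cost /I0; symmetry; apply: integral_itv_bndo_bndc.
  exact: (measurable_int _ iLco).
have ipay : integr (pay T gc uc).
  by rewrite /integr payE; exact: (iffLR (@integrable_mkcond _ (measurableTypeR R) R leb _ _ mco) iLco).
exists (Rint (pay T gc uc)); last by exists gc, uc.
rewrite costE /Rint /Rintegral fineK //.
exact: (@integrable_fin_num _ (measurableTypeR R) R leb _ measurableT _ ipay).
Qed.

Lemma admissible_of_reach T x y c : reach T x y c ->
  exists g u, [/\ admissible f T g u, g 0 = x, g T = y & cost L T g u = c%:E].
Proof.
move=> [g [u [[[T0 gx gy u0] [ac mu iu aeg]] ipay <-]]].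
have mcc : measurable (`[0, T]%classic : set R) by exact: measurable_itv.
have mco : measurable (`[0, T[%classic : set R) by exact: measurable_itv.
exists g, u; split; [|exact: gx|exact: gy|].
  split => //; split.
    move=> i; split; first exact: measurable_funTS.
    have := @integrable_lty _ (measurableTypeR R) R leb _ mcc _
      (@integrableS _ (measurableTypeR R) R leb _ _ _ measurableT mcc (@subsetT _ _) (iu i)).
    by [].
  by apply: ae_impl aeg => s [D1 D2] _; split.
have payE : EFin \o pay T g u = (EFin \o (fun s => L (g s) (u s))) \_ `[0, T[%classic.
  by apply/funext => s; rewrite patchE mem_setE /= in_itv /= /pay; case: ifP.
have iLco : leb.-integrable `[0, T[%classic (EFin \o (fun s => L (g s) (u s))).
  by apply: (iffRL (@integrable_mkcond _ (measurableTypeR R) R leb _ _ mco)); rewrite -payE.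
have fin := @integrable_fin_num _ (measurableTypeR R) R leb _ measurableT _ ipay.
rewrite /Rint /Rintegral fineK //.
rewrite -[RHS]/(\int[leb]_s (EFin \o pay T g u) s)%E payE -integral_mkcond.
rewrite /cost /I0; symmetry; apply: integral_itv_bndo_bndc.
exact: (measurable_int _ iLco).
Qed.

Lemma valueV_le T x y c : reach T x y c -> (valueV f L T x <= c%:E)%E.
Proof.
move=> /admissible_of_reach[g [u [ad g0 _ cE]]].
by apply: ereal_inf_lbound; exists g, u; rewrite cE.
Qed.

Lemma valueV_lt T x b : 0 <= T -> (valueV f L T x < b%:E)%E ->
  exists y c, c < b /\ reach T x y c.
Proof.
move=> T0 /ereal_inf_lt[_ [g [u [ad [g0 ->]]]] cb].
have [|c cE rc] := reach_of_admissible T0 ad; first exact: lt_trans cb (ltry _).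
by exists (g T), c; rewrite -lte_fin -cE -g0.
Qed.

Lemma actionA_le T x y z c : reach T x (y + intvec R z) c -> (actionA f L T x y <= c%:E)%E.
Proof.
move=> /admissible_of_reach[g [u [ad g0 gT cE]]].
apply: ereal_inf_lbound; exists g, u; rewrite cE; split => //; split => //; split => //.
by exists z.
Qed.

Lemma actionA_lt T x y b : 0 <= T -> (actionA f L T x y < b%:E)%E ->
  exists z c, c < b /\ reach T x (y + intvec R z) c.
Proof.
move=> T0 /ereal_inf_lt[_ [g [u [ad [g0 [[z gT] ->]]]]] cb].
have [|c cE rc] := reach_of_admissible T0 ad; first exact: lt_trans cb (ltry _).
by exists z, c; rewrite -lte_fin -cE -g0 -gT.
Qed.

End Reachability.

(** * Steering by piecewise flows *)

Section Steering.
Variables (R : realType) (d m : nat).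
Local Notation V := 'rV[R]_d.
Local Notation U := 'rV[R]_m.
Local Notation leb := (@lebesgue_measure R).
Variable f : 'I_m -> V -> V.
Hypothesis ff : forall i, fieldB (f i).

Definition signed_basis (i : 'I_m) (b : bool) : U := (-1) ^+ (~~ b) *: basis_vec R i.

Definition bang (u : U) : Prop := u = 0 \/ exists i b, u = signed_basis i b.

Lemma Fu_signed_basis x i b : Fu f x (signed_basis i b) = signed_field f i b x.
Proof.
rewrite /Fu (bigD1 i) //= big1 ?addr0 => [|j ji]; last first.
  by rewrite /signed_basis !mxE eqxx (negbTE ji) /= mulr0 scale0r.
rewrite /signed_basis !mxE !eqxx mulr1; case: b => /=.
  by rewrite expr0 scale1r.
by rewrite expr1 scaleN1r.
Qed.

Lemma bang_bound : exists2 M : R, 0 <= M & forall x i b, `|signed_field f i b x| <= M.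
Proof.
have [i|C HC] := @choice 'I_m R (fun i C => forall x, `|f i x| <= C).
  exact: fieldB_bounded.
exists (\sum_i `|C i|); first exact: sumr_ge0.
move=> x i b; apply: (@le_trans _ _ `|f i x|); first by case: b => //=; rewrite normrN.
apply: (le_trans (HC i x)); apply: (le_trans (ler_norm _)).
by rewrite (bigD1 i) //= lerDl; exact: sumr_ge0.
Qed.

Variable M : R.
Hypothesis M0 : 0 <= M.
Hypothesis fM : forall x i b, `|signed_field f i b x| <= M.

(** The common Lipschitz constant and the finite set of control values are recorded because they
    survive countable concatenation, and they imply the integrability required by [traj]. *)
Definition bang_traj (T : R) (x y : V) (g : R -> V) (u : R -> U) : Prop :=
  [/\ traj_ends T x y g u, forall s t, `|g s - g t| <= M * `|s - t|,
      forall s, bang (u s), forall i, measurable_fun [set: R] (fun s => u s 0 i) &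
      {ae leb, forall s, is_derive s (1 : R) g (Fu f (g s) (u s))}].

Lemma bang_coord (u : U) i : bang u -> (u 0 i) ^+ 2 <= 1.
Proof.
case=> [->|[j [b ->]]]; first by rewrite mxE expr0n.
rewrite !mxE exprMn -exprM mulnC exprM sqrrN expr1n expr1n mul1r.
by case: (_ && _); rewrite ?expr1n ?expr0n.
Qed.

Lemma bang_traj_traj T x y g u : bang_traj T x y g u -> traj f T x y g u.
Proof.
move=> [e lg bu mu aeg]; split => //; split => //.
  by move=> a b; exact: lipschitz_abs_cont lg.
move=> i; have [T0 _ _ u0] := e; have [i1 _] := integral_indic 1 T0.
apply: (@le_integrable _ (measurableTypeR R) R leb setT measurableT _ _ _ _ i1).
  by apply/measurable_EFinP; have mui := mu i; exact: measurable_funX.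
move=> s _; rewrite /= lee_fin ger0_norm ?sqr_ge0 //; case: ifPn => [_|s0].
  by rewrite normr1; exact: bang_coord.
by rewrite u0 // mxE expr0n normr0.
Qed.

Lemma bang_traj_cat T1 T2 x y z g1 u1 g2 u2 :
  bang_traj T1 x y g1 u1 -> bang_traj T2 y z g2 u2 ->
  bang_traj (T1 + T2) x z (cat_path T1 y g1 g2) (cat_ctrl T1 u1 u2).
Proof.
move=> b1 b2; have [ec [_ mc _ aec]] := traj_cat (bang_traj_traj b1) (bang_traj_traj b2).
have [e1 l1 v1 _ _] := b1; have [e2 l2 v2 _ _] := b2.
split => //; last first.
  move=> s; have [sT|sT] := ltP s T1.
    by have [_ _ _ ->] := cat_before e1 e2 sT.
  by have [_ _ _ ->] := cat_after e1 e2 sT.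
have H s t : s <= t -> `|cat_path T1 y g1 g2 s - cat_path T1 y g1 g2 t| <= M * (t - s).
  move=> st; have [tT|tT] := ltP t T1.
    have [_ _ -> _] := cat_before e1 e2 tT.
    have [_ _ -> _] := cat_before e1 e2 (le_lt_trans st tT).
    by apply: (le_trans (l1 s t)); rewrite distrC ger0_norm ?subr_ge0.
  have [_ _ -> _] := cat_after e1 e2 tT.
  have [sT|sT] := ltP s T1.
    have [_ _ -> _] := cat_before e1 e2 sT.
    have gy : g1 T1 = y by case: e1 => _ _ ->.
    have gy' : g2 0 = y by case: e2 => _ ->.
    have h1 := l1 s T1; have h2 := l2 0 (t - T1).
    rewrite gy (distrC s) (ger0_norm (_ : 0 <= T1 - s)) ?subr_ge0 ?(ltW sT) // in h1.
    rewrite gy' (distrC 0) subr0 (ger0_norm (_ : 0 <= t - T1)) ?subr_ge0 // in h2.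
    apply: (le_trans (ler_distD y _ _)); apply: (le_trans (lerD h1 h2)).
    by rewrite -mulrDr ler_wpM2l // addrC subrKA.
  have [_ _ -> _] := cat_after e1 e2 sT.
  apply: (le_trans (l2 _ _)); rewrite opprB addrA subrK distrC ger0_norm ?subr_ge0 //.
move=> s t; have [st|/ltW ts] := leP s t.
  by rewrite distrC (distrC s) (ger0_norm (_ : 0 <= t - s)) ?subr_ge0 // distrC; exact: H.
by rewrite distrC (ger0_norm (_ : 0 <= s - t)) ?subr_ge0 //; exact: H.
Qed.

(* Steering with controls in {0, +-e_i}: the running cost is bounded along such paths. *)
Definition steer T x y := exists g u, bang_traj T x y g u.

Lemma bang_traj_const T x : 0 <= T -> bang_traj T x x (fun=> x) (fun=> 0).
Proof.
move=> T0.
split.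
- by split.
- by move=> s t; rewrite subrr normr0 mulr_ge0.
- by move=> s; left.
- by move=> i; under eq_fun do rewrite mxE; exact: measurable_cst.
- by apply: aeW => s; rewrite Fu0; exact: is_derive_cst.
Qed.

Lemma steer_wait T x : 0 <= T -> steer T x x.
Proof. by move=> T0; exists (fun=> x), (fun=> 0); exact: bang_traj_const. Qed.

Lemma steer_trans s t x y z : steer s x y -> steer t y z -> steer (s + t) x z.
Proof.
by move=> [g1 [u1 H1]] [g2 [u2 H2]]; exists (cat_path s y g1 g2), (cat_ctrl s u1 u2);
  exact: bang_traj_cat.
Qed.

Lemma steer_gen : exists tau : R, [/\ 0 < tau, tau <= 1 & forall i b (t : R) x, 0 <= t -> t <= tau ->
  exists c : R -> V, [/\ c 0 = x, continuous c, steer t x (c t) &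
    forall s : R, 0 < s < t -> is_derive s (1 : R) c (signed_field f i b (c s))]].
Proof.
have [ib|tau Htau] := @choice ('I_m * bool)%type R (fun ib tau => 0 < tau /\
  forall x, exists c : R -> V, [/\ c 0 = x,
    forall s : R, 0 < s < tau -> is_derive s (1 : R) c (signed_field f ib.1 ib.2 (c s)) &
    forall s t, `|c s - c t| <= M * `|s - t|]).
  have [tau tau0 H] := Picard (fieldB_signed ff ib.1 ib.2) (fun x => fM x ib.1 ib.2).
  by exists tau.
have [r r0 rtau] := pos_lower_bound (fun ib => (Htau ib).1).
exists (Num.min r 1); split; [by rewrite lt_min r0 ltr01|by rewrite ge_min lexx orbT|].
move=> i b t x t0; rewrite le_min => /andP[tr _].
have [c [c0 cD cL]] := (Htau (i, b)).2 x.
have cD' (s : R) : 0 < s < t -> is_derive s (1 : R) c (signed_field f i b (c s)).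
  by move=> /andP[s0 st]; apply: cD; rewrite s0 (lt_le_trans st) // (le_trans tr) // rtau.
exists c; split => //; first exact: (lipschitz_continuous1 cL).
pose g (s : R) := c (Num.max 0 (Num.min s t)).
pose u (s : R) : U := if 0 <= s < t then signed_basis i b else 0.
exists g, u; split.
- split => //.
  + by move=> s s0; rewrite /g min_l ?(le_trans s0) // max_l.
  + by move=> s st; rewrite /g min_r // max_r.
  + by move=> s; rewrite /u => /negbTE ->.
- move=> s s'; apply: (le_trans (cL _ _)); rewrite ler_wpM2l //.
  have H (p q : R) : p <= q -> `|Num.max 0 (Num.min q t) - Num.max 0 (Num.min p t)| <= `|q - p|.
    move=> pq; rewrite (ger0_norm (_ : 0 <= q - p)) ?subr_ge0 // ler_norml.
    case: (leP q t) => qt; case: (leP p t) => pt; case: (leP 0 q) => q0;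
      case: (leP 0 p) => p0; rewrite ?(max_r t0); lra.
  by have [ss|/ltW ss] := leP s s'; [rewrite distrC (distrC s); exact: H|exact: H].
- by move=> s; rewrite /u; case: ifP => _; [right; exists i, b|left].
- move=> j; have [ii _] := integral_indic (signed_basis i b 0 j) t0.
  rewrite (_ : (fun s => u s 0 j) = (fun s => if 0 <= s < t then signed_basis i b 0 j else 0)).
    exact: integr_measurable ii.
  by apply/funext => s; rewrite /u; case: ifP => // _; rewrite mxE.
- apply: ae_impl (ae_and (ae_neq 0) (ae_neq t)) => s [s0 st].
  rewrite /u; case: ifPn => [/andP[s0' st']|].
    have s0'' : 0 < s by rewrite lt_neqAle s0' andbT; apply/eqP => E; exact: s0.
    rewrite Fu_signed_basis {2}/g min_l ?(ltW st') // max_r //.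
    apply: near_eq_is_derive (cD' s _); last by rewrite s0''.
    apply: filterS (filterI (near_gt s0'') (near_lt st')) => p [p0 pt].
    by rewrite /g min_l ?(ltW pt) // max_r // ltW.
  rewrite negb_and -ltNge -leNgt => /orP[s0'|st']; rewrite Fu0.
    apply: (near_eq_is_derive _ (is_derive_cst (c 0) s (1 : R))).
    apply: filterS (near_lt s0') => p p0.
    by rewrite /g min_l ?(le_trans (ltW p0)) // max_l // ltW.
  have st'' : t < s by rewrite lt_neqAle st' andbT; apply/eqP => E; exact: st.
  apply: (near_eq_is_derive _ (is_derive_cst (c t) s (1 : R))).
  apply: filterS (near_gt st'') => p tp.
  by rewrite /g min_r ?(ltW tp) // max_r.
Qed.

(** The partial concatenations [G n] agree before time [S n], so they stabilize at every time below
    the supremum [T] of the [S n]; from [T] on the limit path is set to [y]. *)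
Lemma steer_limit (x : nat -> V) (t : nat -> R) y K D :
  (forall n, 0 <= t n <= K * 2^-1 ^+ n) -> (forall n, steer (t n) (x n) (x n.+1)) ->
  (forall n, `|y - x n| <= D * 2^-1 ^+ n) ->
  exists2 T, 0 <= T <= 2 * K & steer T (x 0%N) y.
Proof.
move=> tK st yx.
have [n|gu Hgu] := @choice nat ((R -> V) * (R -> U))%type
    (fun n gu => bang_traj (t n) (x n) (x n.+1) gu.1 gu.2).
  by have [g [u H]] := st n; exists (g, u).
pose S n := \sum_(k < n) t k.
pose G := fix G n := if n is n'.+1 then cat_path (S n') (x n') (G n') (gu n').1 else fun=> x 0%N.
pose C := fix C n := if n is n'.+1 then cat_ctrl (S n') (C n') (gu n').2 else fun=> (0 : U).
have GC n : bang_traj (S n) (x 0%N) (x n) (G n) (C n).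
  elim: n => [|n IHn]; first by rewrite /S big_ord0; exact: bang_traj_const.
  by rewrite /S big_ord_recr; exact: bang_traj_cat.
have Send n : traj_ends (S n) (x 0%N) (x n) (G n) (C n) by case: (GC n).
have S_step n : S n <= S n.+1 by rewrite /S big_ord_recr lerDl; case/andP: (tK n).
have Smono : {homo S : k n / (k <= n)%N >-> k <= n}.
  by apply: homo_leq S_step => //; exact: le_trans.
have stable n k s : s < S n -> (n <= k)%N -> G k s = G n s /\ C k s = C n s.
  move=> sS; elim: k => [|k IHk]; first by rewrite leqn0 => /eqP ->.
  rewrite leq_eqVlt => /orP[/eqP -> //|nk]; have [E1 E2] := IHk nk.
  have sSk : s < S k by apply: lt_le_trans (Smono n k nk).
  have [e2 _ _ _ _] := Hgu k.
  by have [_ _ H1 H2] := cat_before (Send k) e2 sSk; rewrite /= H1 H2.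
have K0 : 0 <= K by have /andP[h1 h2] := tK 0%N; move: h2; rewrite expr0 mulr1; exact: le_trans.
have Sbound n : S n <= 2 * K - 2 * K * 2^-1 ^+ n.
  elim: n => [|n IHn]; first by rewrite /S big_ord0 expr0 mulr1 subrr.
  rewrite /S big_ord_recr /= -/(S n) exprS; have /andP[_ h] := tK n; lra.
have Sle n : S n <= 2 * K.
  apply: (le_trans (Sbound n)); rewrite gerBl mulr_ge0 ?exprn_ge0 // mulr_ge0 //.
have supS : has_sup (range S).
  by split; [exists (S 0%N); exists 0%N|exists (2 * K) => _ [n _ <-]].
pose T := sup (range S).
have ST n : S n <= T by apply: sup_upper_bound => //; exists n.
have T0 : 0 <= T by apply: le_trans (ST 0%N); rewrite /S big_ord0.
have TK : T <= 2 * K by apply: ge_sup; [exact: supS.1|move=> _ [n _ <-]].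
have below s : s < T -> exists n, s < S n.
  by move=> /(sup_gt supS.1)[_ [n _ <-] sn]; exists n.
exists T; first by rewrite T0 TK.
have [s|gc Hgc] := @choice R (V * U)%type (fun s p =>
    (forall n, s < S n -> p.1 = G n s /\ p.2 = C n s) /\ (T <= s -> p.1 = y /\ p.2 = 0)).
  have [sT|sT] := ltP s T.
    have [n sn] := below s sT; exists (G n s, C n s); split => //= k sk.
    have [nk|/ltnW kn] := leqP n k; first by have [-> ->] := stable _ _ _ sn nk.
    by have [-> ->] := stable _ _ _ sk kn.
  exists (y, 0); split => // n sn.
  by have := lt_le_trans sn (ST n); rewrite ltNge sT.
pose g s := (gc s).1; pose u s := (gc s).2.
have gE n s : s < S n -> g s = G n s by move=> /(Hgc s).1[].
have uE n s : s < S n -> u s = C n s by move=> /(Hgc s).1[].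
have gT s : T <= s -> g s = y by move=> /(Hgc s).2[].
have uT s : T <= s -> u s = 0 by move=> /(Hgc s).2[].
have D0 : 0 <= D by have := yx 0%N; rewrite expr0 mulr1; exact: le_trans.
have gL s s' : s <= s' -> `|g s - g s'| <= M * (s' - s).
  move=> ss; have lG n p q : p <= q -> `|G n p - G n q| <= M * (q - p).
    move=> pq; have [_ l _ _ _] := GC n.
    by apply: (le_trans (l p q)); rewrite distrC ger0_norm ?subr_ge0.
  have [sT'|sT'] := ltP s' T.
    have [n sn] := below _ sT'.
    by rewrite (gE n s) ?(le_lt_trans ss) // (gE n s') //; exact: lG.
  rewrite (gT s') //; have [sT|sT] := ltP s T; last first.
    by rewrite gT // subrr normr0 mulr_ge0 // subr_ge0.
  have [n sn] := below _ sT.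
  (* Across time [T]: the approximant [G k'] agrees with [g] at [s] and rests at [x k'] at [s'],
     which is within [D * 2^-k] of [y]. *)
  apply: (@le_geometric _ _ _ D) => k; rewrite lerBlDl.
  pose k' := maxn n k.
  have snk : s < S k' by apply: lt_le_trans (Smono _ _ (leq_maxl n k)).
  rewrite (gE k') //.
  have Gend : G k' s' = x k' by case: (Send k') => _ _ -> //; apply: le_trans sT'.
  apply: (le_trans (ler_distD (x k') _ _)); apply: lerD; last first.
    rewrite distrC; apply: (le_trans (yx k')); rewrite ler_wpM2l //.
    by apply: ler_wiXn2l (leq_maxr n k); rewrite ?invf_le1 ?ler1n.
  by rewrite -Gend; exact: lG.
have gLip s s' : `|g s - g s'| <= M * `|s - s'|.
  have [ss|/ltW ss] := leP s s'.
    by rewrite (distrC s) (ger0_norm (_ : 0 <= s' - s)) ?subr_ge0 //; exact: gL.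
  by rewrite distrC (ger0_norm (_ : 0 <= s - s')) ?subr_ge0 //; exact: gL.
have gneg s : s < 0 -> g s = x 0%N.
  move=> s0; rewrite (gE 0%N) //; first by rewrite /S big_ord0.
(* If [T = 0], the value at 0 was set to [y]; continuity from negative times shows that it is the
   initial point all the same. *)
have g0 : g 0 = x 0%N.
  apply/subr0_eq/eqP; rewrite -normr_le0; apply: (@le_geometric _ _ _ M) => n; rewrite subr0.
  have q0 : 0 < 2^-1 ^+ n :> R by rewrite exprn_gt0.
  rewrite -(gneg (- 2^-1 ^+ n)) ?oppr_lt0 //; apply: (le_trans (gLip _ _)).
  by rewrite sub0r opprK (ger0_norm (ltW q0)).
exists g, u; split => //.
- split => //.
  + by move=> s; rewrite le_eqVlt => /orP[/eqP ->|/gneg].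
  + move=> s; rewrite negb_and -ltNge -leNgt => /orP[s0|]; last exact: uT.
    by rewrite (uE 0%N) // /S big_ord0.
- move=> s; have [sT|sT] := ltP s T; last by rewrite uT //; left.
  by have [n sn] := below _ sT; rewrite (uE n) //; case: (GC n).
(* At each time the controls [C n] are eventually constant in [n], so the limit control is a
   pointwise limit of measurable functions. *)
- move=> i; apply: (@measurable_fun_cvg _ _ _ _ (fun n s => C n s 0 i)).
    by move=> n; case: (GC n).
  move=> s _; have [sT|sT] := ltP s T.
    have [n sn] := below _ sT; apply: cvg_near_cst.
    by exists n => // k /= nk; rewrite (uE n) //; have [_ ->] := stable _ _ _ sn nk.
  apply: cvg_near_cst; apply: nearW => n; rewrite uT //.
  by case: (Send n) => _ _ _ -> //; rewrite negb_and -leNgt (le_trans (ST n) sT) orbT.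
- have aeG n : {ae leb, forall s, is_derive s (1 : R) (G n) (Fu f (G n s) (C n s))}.
    by case: (GC n).
  apply: ae_impl (ae_and (ae_all aeG) (ae_neq T)) => s [Ds sT].
  have [lt|ge] := ltP s T.
    have [n sn] := below _ lt; rewrite (gE n) // (uE n) //.
    apply: near_eq_is_derive (Ds n).
    by apply: filterS (near_lt sn) => p pn; rewrite (gE n).
  have gt : T < s by rewrite lt_neqAle ge andbT; apply/eqP => E; exact: sT.
  rewrite uT // Fu0; apply: (near_eq_is_derive _ (is_derive_cst y s (1 : R))).
  by apply: filterS (near_gt gt) => p tp; rewrite gT // ltW.
Qed.

Hypothesis fH : Hormander f.

Theorem steer_local (x0 : V) (e : R) : 0 < e -> exists2 delta : R, 0 < delta &
  forall x y, `|x - x0| < delta -> `|y - x0| < delta ->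
    exists2 T, 0 <= T <= e & steer T x y.
Proof.
have [tau [tau0 tau1 gen]] := steer_gen.
exact: (local_control ff fH tau0 tau1 (fun x => steer_wait x (lexx 0)) steer_trans gen steer_limit).
Qed.

Variables (L : V -> U -> R).
Hypothesis Lper : Zd_periodic L.
Hypothesis Lcont : continuous (fun p : V * U => L p.1 p.2).

(** A bang control takes finitely many values, and for each of them [L] is continuous and periodic
    in [x], hence bounded. *)
Lemma bang_cost_bound : exists2 B : R, 0 <= B & forall x u, bang u -> `|L x u| <= B.
Proof.
have cL u : continuous (fun x => L x u).
  have cp : continuous (fun x : V => (x, u) : (V * U)%type).
    apply: (@lipschitz_continuous1 R V (V * U)%type _ 1) => s t; rewrite mul1r.
    by rewrite prod_normE /= ge_max subrr normr0 lexx normr_ge0.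
  by move=> x; exact: (cvg_comp _ _ (cp x) (@Lcont (x, u))).
have bL u : bounded_fct (fun x => L x u).
  by apply: periodic_bounded => // x z; rewrite Lper.
have [C0 H0] := bL 0.
have [ib|C HC] := @choice ('I_m * bool)%type R (fun ib C => forall x, `|L x (signed_basis ib.1 ib.2)| <= C).
  exact: bL.
exists (`|C0| + \sum_ib `|C ib|); first by rewrite addr_ge0 // sumr_ge0.
move=> x u [->|[i [b ->]]].
  by apply: (le_trans (H0 x)); apply: (le_trans (ler_norm _)); rewrite lerDl sumr_ge0.
apply: (le_trans (HC (i, b) x)); apply: (le_trans (ler_norm _)).
by rewrite (bigD1 (i, b)) //= addrCA lerDl addr_ge0 // sumr_ge0.
Qed.

Lemma reach_of_steer B T x y : (forall x u, bang u -> `|L x u| <= B) -> steer T x y ->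
  exists2 c, c <= B * T & reach f L T x y c.
Proof.
move=> LB [g [u H]]; have tr := bang_traj_traj H.
have [[T0 gx gy u0] lg bu mu aeg] := H.
have [iB EB] := integral_indic B T0.
have mg i : measurable_fun [set: R] (fun s => g s 0 i).
  apply: continuous_measurable_fun => s.
  apply: (@continuous_comp _ _ _ g (fun y : V => y 0 i)); last exact: coord_continuous.
  exact: (lipschitz_continuous1 lg).
have mL : measurable_fun [set: R] (fun s => L (g s) (u s)).
  exact: (@measurable_continuous_comp R d m _ (fun p : V * U => L p.1 p.2) g u).
have mco : measurable (`[0, T[%classic : set R) by exact: measurable_itv.
have mpay : measurable_fun [set: R] (pay L T g u).
  rewrite (_ : pay L T g u = (fun s => L (g s) (u s)) \_ `[0, T[%classic).
    by apply/(measurable_restrictT _ mco); exact: measurable_funTS.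
  by apply/funext => s; rewrite patchE mem_setE /= in_itv /= /pay; case: ifP.
have ipay : integr (pay L T g u).
  apply: (@le_integrable _ (measurableTypeR R) R leb setT measurableT _ _ _ _ iB).
    exact/measurable_EFinP.
  move=> s _; rewrite /= lee_fin /pay; case: ifP => // _.
  by apply: le_trans (ler_norm B); exact: LB.
exists (Rint (pay L T g u)); last by exists g, u.
rewrite -{2}(subr0 T) -EB; apply: le_integralR => // s.
by rewrite /pay; case: ifP => // _; apply: le_trans (ler_norm _) _; exact: LB.
Qed.

End Steering.

(** * Recurrence and the Aubry set *)

Section WeakKAM.
Variables (R : realType) (d : nat).
Local Notation V := 'rV[R]_d.

(** Compactness in the form of a near-covering along the right neighbourhoods of 0; the local radius
    [r] bounds both the distance to [x0] and [e]. *)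
Lemma cube_uniform (P : V -> R -> Prop) :
  (forall x0, exists2 r : R, 0 < r & forall x e, `|x - x0| < r -> 0 < e < r -> P x e) ->
  exists2 e : R, 0 < e & forall x, unit_cube x -> P x e.
Proof.
move=> H.
have ncov := (compact_near_coveringP (@unit_cube R d)).1 (@unit_cube_compact R d).
have N : \forall e \near (0 : R)^'+, forall x, unit_cube x -> P x e.
  apply: (ncov R (0^'+) (fun e x => P x e) _) => x0 _.
  have [r r0 Hr] := H x0.
  exists ([set x : V | `|x - x0| < r], [set e : R | 0 < e < r]); last first.
    by case=> x e [/= h1 h2]; exact: Hr.
  split => /=; last by near=> e; apply/andP; split; near: e; [exact: nbhs_right_gt|exact: nbhs_right_lt].
  by apply/nbhs_ballP; exists r => //= x; rewrite -ball_normE /= distrC.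
near (0 : R)^'+ => e; exists e; first by near: e; exact: nbhs_right_gt.
by near: e.
Unshelve. all: by end_near. Qed.

(** [M t x y b] stands for a path on the torus from [x] to [y], of duration [t] and cost at most
    [b]; the instance is [treach]. *)
Variable M : R -> V -> V -> R -> Prop.
Variables (K2 B : R).
Hypothesis B0 : 0 <= B.
Hypothesis M_le : forall t x y b b', M t x y b -> b <= b' -> M t x y b'.
Hypothesis M_cat : forall s t x y z b b', M s x y b -> M t y z b' -> M (s + t) x z (b + b').
Hypothesis M_split : forall (s t : R) x z b, 0 <= s -> 0 <= t -> M (s + t) x z b ->
  exists y b1 b2, [/\ M s x y b1, M t y z b2 & b = b1 + b2].
Hypothesis M_ge0 : forall t x y b, M t x y b -> 0 <= t.
Hypothesis M_lower : forall t x y b, M t x y b -> - (K2 * t) <= b.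
Hypothesis M_period : forall t x y b z z', M t x y b -> M t (x + intvec R z) (y + intvec R z') b.
Hypothesis M_wait : forall (t : R) x, 0 <= t -> M t x x (B * t).
Hypothesis M_local : forall (x0 : V) (e : R), 0 < e -> exists2 r : R, 0 < r &
  forall x y, `|x - x0| < r -> `|y - x0| < r -> exists2 t, 0 <= t <= e & M t x y (B * t).

Definition cube_rep (x : V) : V := x - intvec R (floor_vec x).

Lemma M_rep t x y b : M t (cube_rep x) (cube_rep y) b -> M t x y b.
Proof. by move=> /(M_period (floor_vec x) (floor_vec y)); rewrite !subrK. Qed.

Lemma rep_M t x y b : M t x y b -> M t (cube_rep x) (cube_rep y) b.
Proof.
by move=> /(M_period (- floor_vec x) (- floor_vec y)); rewrite !intvecN.
Qed.

(** The segment between the representatives in the unit cube is cut into [N] steps shorter than a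
    uniform radius, each travelled in time at most 1. *)
Lemma M_connect : exists2 W : R, 0 <= W &
  forall x y, exists2 t, 0 <= t <= W & M t x y (B * t).
Proof.
have [r r0 Hr] : exists2 r : R, 0 < r & forall x, unit_cube x ->
    forall y, `|y - x| < r -> exists2 t, 0 <= t <= 1 & M t x y (B * t).
  apply: (@cube_uniform (fun x r => forall y, `|y - x| < r -> exists2 t, 0 <= t <= 1 & M t x y (B * t))).
  move=> x0; have [r r0 Hr] := M_local x0 ltr01; exists (r / 2); first by rewrite divr_gt0.
  move=> x e xe /andP[_ er] y yx; apply: Hr; first by lra.
  by apply: (le_lt_trans (ler_distD x _ _)); lra.
have step x y : `|y - x| < r -> exists2 t, 0 <= t <= 1 & M t x y (B * t).
  move=> yx; have [|t t01 Mt] := Hr _ (sub_floor_vec_cube x) (y - intvec R (floor_vec x)).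
    by rewrite opprB addrA subrK.
  by exists t => //; have := M_period (floor_vec x) (floor_vec x) Mt; rewrite !subrK.
pose N := (Num.truncn r^-1).+1.
have N0 : 0 < N%:R :> R by rewrite ltr0n.
have Nr : N%:R^-1 < r.
  by rewrite -[ltRHS]invrK ltf_pV2 ?posrE ?invr_gt0 //; exact: truncnS_gt.
exists N%:R => // x y.
suff [t tN Mt] : exists2 t, 0 <= t <= N%:R & M t (cube_rep x) (cube_rep y) (B * t).
  by exists t => //; exact: M_rep.
set x' := cube_rep x; set y' := cube_rep y.
have xy1 : `|y' - x'| <= 1.
  have cx : unit_cube x' := sub_floor_vec_cube x; have cy : unit_cube y' := sub_floor_vec_cube y.
  apply: rV_norm_le => // i; have := cx i; have := cy i.
  by rewrite !mxE /= !in_itv /= => /andP[? ?] /andP[? ?]; rewrite ler_norml; apply/andP; split; lra.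
pose h := N%:R^-1 *: (y' - x').
have hr : `|h| < r.
  by rewrite normrZ gtr0_norm ?invr_gt0 //; apply: le_lt_trans Nr; rewrite ler_piMr // invr_ge0 ltW.
have chain k : exists2 t, 0 <= t <= k%:R & M t x' (x' + k%:R *: h) (B * t).
  elim: k => [|k [t /andP[t0 tk] Mt]].
    by exists 0; rewrite ?lexx // scale0r addr0; exact: M_wait.
  have [|s /andP[s0 s1] Ms] := step (x' + k%:R *: h) (x' + k.+1%:R *: h).
    by rewrite opprD addrACA subrr add0r -scalerBl -natrB // subSnn scale1r.
  by exists (t + s); [rewrite addr_ge0 //= -natr1 lerD|rewrite mulrDr; exact: M_cat Mt Ms].
have [t tN Mt] := chain N; exists t => //.
by have := Mt; rewrite /h scalerA divff ?gt_eqF // scale1r addrC subrK.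
Qed.

Definition loop_rates : set R := [set r | exists t x b, [/\ 0 < t, M t x x b & r = b / t]].
(** The critical value in the sense of Mañé, as the least mean cost of loops; [cbar_eq] is applied
    to it to identify it with [cbar]. *)
Definition crit : R := inf loop_rates.

Lemma loop_rates_has_inf : has_inf loop_rates.
Proof.
split; first by exists (B / 1), 1, 0, B; split=> //; rewrite -[B]mulr1; exact: M_wait.
exists (- K2) => _ [t [x [b [t0 Mb ->]]]].
by rewrite ler_pdivlMr // mulNr; exact: M_lower Mb.
Qed.

Lemma loop_lower t x b : M t x x b -> crit * t <= b.
Proof.
move=> Mb; have := M_ge0 Mb; rewrite le_eqVlt => /orP[/eqP t0|t0].
  by rewrite -t0 mulr0; have := M_lower Mb; rewrite -t0 mulr0 oppr0.
rewrite -ler_pdivlMr //; apply: ge_inf; first exact: loop_rates_has_inf.2.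
by exists t, x, b.
Qed.

Lemma path_lower : exists2 C : R, 0 <= C & forall t x y b, M t x y b -> crit * t - C <= b.
Proof.
(* Closing the path costs at most [B * W] and lengthens it by at most [W], which shifts [crit * t]
   by at most [|crit| * W]. *)
have [W W0 HW] := M_connect; exists ((`|crit| + B) * W); first by rewrite mulr_ge0 ?addr_ge0.
move=> t x y b Mb; have [s /andP[s0 sW] Ms] := HW y x.
have := loop_lower (M_cat Mb Ms); rewrite mulrDr.
have : `|crit * s| <= `|crit| * W by rewrite normrM (ger0_norm s0) ler_wpM2l.
have : B * s <= B * W by rewrite ler_wpM2l.
rewrite ler_norml => h1 /andP[h2 _] h3; lra.
Qed.

(** Travel to a nearly optimal loop, run it as often as time permits and wait for the remainder. The
    overhead is at most the constant [D], which [e / 2 * T] absorbs for large [T]. *)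
Lemma path_upper e : 0 < e -> exists T0 : R, forall T, T0 <= T -> forall x, exists y,
  M T x y ((crit + e) * T).
Proof.
move=> e0; have [W W0 HW] := M_connect.
have [_ [t [x0 [b [t0 Mb ->]]]] bt] := inf_adherent (divr_gt0 e0 (ltr0n R 2)) loop_rates_has_inf.
have {bt}bt : b <= (crit + e / 2) * t by rewrite -ler_pdivrMr // ltW.
have loop n : M (t * n%:R) x0 x0 (b * n%:R).
  elim: n => [|n IHn]; first by rewrite !mulr0 -[X in M _ _ _ X](mulr0 B); exact: M_wait.
  by rewrite -natr1 !mulrDr !mulr1; exact: M_cat IHn Mb.
pose D := (B + `|crit + e / 2|) * (W + t).
have D0 : 0 <= D by rewrite mulr_ge0 ?addr_ge0 // ltW.
exists (W + D * (2 / e)) => T TT x; exists x0.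
have [s /andP[s0 sW] Ms] := HW x x0.
have Ts : 0 <= T - s.
  rewrite subr_ge0; apply: (le_trans sW); apply: le_trans TT; rewrite lerDl.
  by rewrite mulr_ge0 // divr_ge0 // ltW.
pose n := Num.truncn ((T - s) / t); pose r := T - s - t * n%:R.
have /andP[n1 n2] : n%:R <= (T - s) / t < n.+1%:R by rewrite /n truncn_itv // divr_ge0 // ltW.
have r0 : 0 <= r by rewrite subr_ge0 mulrC -ler_pdivlMr.
have rt : r <= t.
  by rewrite lerBlDl -{2}(mulr1 t) -mulrDr natr1 mulrC -ler_pdivrMr // ltW.
have E : T = s + (t * n%:R + r) by rewrite /r (addrC (t * _)) subrK addrC subrK.
have := M_cat Ms (M_cat (loop n) (M_wait x0 r0)); rewrite -E => MT; apply: (M_le MT).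
have h1 : b * n%:R <= (crit + e / 2) * (t * n%:R) by rewrite mulrA ler_wpM2r.
have h2 : (crit + e / 2) * (t * n%:R) = (crit + e / 2) * T - (crit + e / 2) * (s + r).
  by rewrite /r; ring.
have h3 : - ((crit + e / 2) * (s + r)) <= `|crit + e / 2| * (W + t).
  apply: (le_trans (ler_norm _)); rewrite normrN normrM ler_wpM2l //.
  by rewrite (ger0_norm (addr_ge0 s0 r0)); exact: lerD.
have h4 : B * (s + r) <= B * (W + t) by rewrite ler_wpM2l // lerD.
have h5 : D <= e / 2 * T.
  rewrite mulrC -ler_pdivrMr ?divr_gt0 // invf_div; apply: le_trans TT.
  by rewrite lerDr.
by rewrite /D in h5; lra.
Qed.

Lemma M_pieces T1 N x y b : 0 <= T1 -> M (T1 * N%:R) x y b ->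
  exists (p : nat -> V) (bb : nat -> R),
  [/\ p 0%N = x, forall k, (k < N)%N -> M T1 (p k) (p k.+1) (bb k) & \sum_(k < N) bb k <= b].
Proof.
move=> T10; elim: N x b => [|N IHN] x b.
  (* With no piece the cost is 0 while [b] is only known to be nonnegative, hence the inequality in
     the conclusion. *)
  rewrite mulr0 => /M_lower; rewrite mulr0 oppr0 => b0.
  by exists (fun=> x), (fun=> 0); split => //; rewrite big_ord0.
rewrite -nat1r mulrDr mulr1 => /(M_split T10 _)[|w [b1 [b2 [M1 M2 ->]]]]; first by rewrite mulr_ge0.
have [p [bb [p0 Mp sb]]] := IHN _ _ M2.
exists (fun k => if k is k'.+1 then p k' else x), (fun k => if k is k'.+1 then bb k' else b1).
split => //; last by rewrite big_ord_recl lerD2l.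
by case=> [_|k kN]; [rewrite p0|exact: Mp].
Qed.

Lemma M_chain T1 N (p : nat -> V) (bb : nat -> R) :
  (forall k, (k < N)%N -> M T1 (p k) (p k.+1) (bb k)) ->
  forall j k, (j + k <= N)%N ->
    M (T1 * k%:R) (p j) (p (j + k)%N) (\sum_(i < k) bb (j + i)%N).
Proof.
move=> Mp j; elim=> [|k IHk] jk.
  by rewrite big_ord0 addn0 mulr0 -[X in M _ _ _ X](mulr0 B); exact: M_wait.
rewrite big_ord_recr -natr1 mulrDr mulr1 addnS; apply: M_cat; last by apply: Mp; rewrite -addnS.
by apply: IHk; apply: leq_trans jk; rewrite leq_add2l.
Qed.

(* Each return to the same cell raises the excess cost by at least [e]. *)
Lemma recurrence_count (I : finType) (cell : V -> I) T1 e C N p bb :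
  0 < T1 -> 0 <= C -> (forall t x y b, M t x y b -> crit * t - C <= b) ->
  (forall t x y b, M t x y b -> T1 <= t -> cell x = cell y -> crit * t + e <= b) ->
  0 <= e ->
  (forall k, (k < N)%N -> M T1 (p k) (p k.+1) (bb k)) ->
  e * N%:R <= #|I|%:R * (\sum_(k < N) bb k - crit * (T1 * N%:R) + C + C + e).
Proof.
move=> T10 C0 lowC lowe e0 Mp.
(* The excess of the cost over the critical rate after [n] pieces. *)
pose S n := \sum_(k < n) bb k - crit * (T1 * n%:R).
have Sdiff j k : S (j + k)%N - S j = \sum_(i < k) bb (j + i)%N - crit * (T1 * k%:R).
  by rewrite /S big_split_ord /= natrD; ring.
have SC j n : (j <= n)%N -> (n <= N)%N -> S j - C <= S n.
  move=> jn nN; rewrite -(subnKC jn) in nN *.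
  have := lowC _ _ _ _ (M_chain Mp nN); have := Sdiff j (n - j)%N; lra.
have Se j n : (j < n)%N -> (n <= N)%N -> cell (p j) = cell (p n) -> S j + e <= S n.
  move=> jn nN; rewrite -(subnKC (ltnW jn)) in nN * => cjn.
  have jn1 : T1 <= T1 * (n - j)%:R by rewrite ler_peMr ?(ltW T10) // ler1n subn_gt0.
  by have := lowe _ _ _ _ (M_chain Mp nN) jn1 cjn; have := Sdiff j (n - j)%N; lra.
pose cnt i n := (\sum_(k < n) (cell (p k) == i))%N.
have S0 : S 0%N = 0 by rewrite /S big_ord0 mulr0 mulr0 subrr.
(* [j] is the latest visit to cell [i]: the first visit has excess at least [- C], and each later
   one adds [e]. *)
have visit i n : (n <= N)%N -> cnt i n = 0%N \/ exists j, [/\ (j < n)%N, cell (p j) = i &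
    e * (cnt i n)%:R - e - C <= S j].
  elim: n => [|n IHn] nN; first by left; rewrite /cnt big_ord0.
  have := IHn (ltnW nN); rewrite /cnt big_ord_recr /= -/(cnt i n).
  have [ci|ci] := eqVneq (cell (p n)) i; last first.
    by rewrite addn0; case=> [->|[j [jn cj Sj]]]; [left|right; exists j; rewrite ltnS ltnW].
  case=> [->|[j [jn cj Sj]]]; right; exists n; split => //.
    by have := SC 0%N n (leq0n n) (ltnW nN); rewrite S0 add0n mulr1; lra.
  have := Se j n jn (ltnW nN); rewrite cj ci => /(_ erefl).
  by rewrite addn1 -natr1; lra.
(* From the last visit to the end the excess may drop by another [C]. *)
have bound i : e * (cnt i N)%:R <= S N + C + C + e.
  have [->|[j [jN _ Sj]]] := visit i N (leqnn N).
    by have := SC 0%N N (leq0n N) (leqnn N); rewrite S0 mulr0; lra.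
  by have := SC j N (ltnW jN) (leqnn N); lra.
have cntN : (\sum_i cnt i N = N)%N.
  rewrite exchange_big /= (eq_bigr (fun=> 1%N)) ?sum1_card ?card_ord // => k _.
  by rewrite (bigD1 (cell (p k))) //= eqxx big1 // => i /negbTE; rewrite eq_sym => ->.
rewrite -{1}cntN natr_sum mulr_sumr mulr_natl -sumr_const.
by apply: ler_sum => i _; exact: bound.
Qed.

(** There are [k.+1] indices per direction because the coordinates of [cube_rep x] are taken in the
    closed interval [[0, 1]]. *)
Definition grid_cell k (x : V) : {ffun 'I_d -> 'I_k.+1} :=
  [ffun i => inord (Num.truncn (k%:R * cube_rep x 0 i))].

Lemma grid_cell_close k x y : grid_cell k.+1 x = grid_cell k.+1 y ->
  `|cube_rep x - cube_rep y| <= k.+1%:R^-1.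
Proof.
move=> xy; apply: rV_norm_le; first by rewrite invr_ge0.
move=> i; have cx := sub_floor_vec_cube x i; have cy := sub_floor_vec_cube y i.
move: cx cy; rewrite /= !in_itv /= -!/(cube_rep _) => /andP[x0 x1] /andP[y0 y1].
have /(congr1 (fun c : {ffun 'I_d -> 'I_k.+2} => val (c i))) := xy; rewrite !ffunE /=.
have trunc_le (s : R) : 0 <= s -> s <= 1 -> (Num.truncn (k.+1%:R * s) < k.+2)%N.
  move=> s0 s1; rewrite ltnS -(ler_nat R); apply: (@le_trans _ _ (k.+1%:R * s)).
    by rewrite truncn_le mulr_ge0.
  by rewrite ler_piMr.
rewrite !inordK ?trunc_le // => E.
have k0 : 0 < k.+1%:R :> R by [].
have := truncn_itv (mulr_ge0 (ltW k0) x0); have := truncn_itv (mulr_ge0 (ltW k0) y0).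
rewrite E; set q := Num.truncn _; rewrite -[q.+1%:R]natr1 => /andP[a1 a2] /andP[b1 b2].
have -> : (cube_rep x - cube_rep y) 0 i = cube_rep x 0 i - cube_rep y 0 i by rewrite !mxE.
rewrite -div1r ler_pdivlMr // -[X in _ * X](gtr0_norm k0) -normrM ler_norml.
by apply/andP; split; lra.
Qed.

(** The point does not depend on [e] or [T0], so the negation supplies thresholds depending on [x];
    compactness makes them uniform before the count of recurrences is applied. *)
Theorem Aubry_point : exists x, forall e T0, 0 < e ->
  exists2 t, T0 <= t & M t x x (crit * t + e).
Proof.
apply: contrapT => /forallNP H.
have {}H x : exists e T0, 0 < e /\ forall t, T0 <= t -> ~ M t x x (crit * t + e).
  apply: contrapT => /forallNP G; apply: (H x) => e T0 e0.
  apply: contrapT => /forall2NP G'; apply: (G e); exists T0; split => // t tT Mt.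
  by have [] := G' t.
have [C C0 lowC] := path_lower.
have [r r0 Hr] : exists2 r : R, 0 < r & forall x, unit_cube x -> forall y z t b,
    `|y - x| < r -> `|z - x| < r -> r^-1 <= t -> M t y z b -> crit * t + r <= b.
  apply: (@cube_uniform (fun x r => forall y z t b,
    `|y - x| < r -> `|z - x| < r -> r^-1 <= t -> M t y z b -> crit * t + r <= b)) => x0.
  have [e [T0 [e0 noloop]]] := H x0.
  (* Closing a path from [y] to [z] through [x0] takes extra time [s + s']; its cost and the change
     of [crit * t] together amount to at most [Q * (s + s')], which is at most [e / 2]. *)
  pose Q := B + `|crit| + 1.
  have Q0 : 0 < Q by rewrite ltr_wpDl // addr_ge0.
  have eQ : 0 < e / (4 * Q) by rewrite divr_gt0 // mulr_gt0.
  have [r r0 Hr] := M_local x0 eQ.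
  have T00 : 0 < `|T0| + 1 by rewrite ltr_wpDl.
  exists (Num.min (r / 2) (Num.min (`|T0| + 1)^-1 (e / 2))).
    by rewrite !lt_min invr_gt0 T00 !divr_gt0.
  move=> x q; rewrite !lt_min => /andP[xr _] /and4P[q0 qr qT qe] y z t b yx zx qt Mt.
  have yx0 : `|y - x0| < r by apply: (le_lt_trans (ler_distD x _ _)); lra.
  have zx0 : `|z - x0| < r by apply: (le_lt_trans (ler_distD x _ _)); lra.
  have xx0 : `|x0 - x0| < r by rewrite subrr normr0.
  have [s /andP[s0 se] Ms] := Hr x0 y xx0 yx0.
  have [s' /andP[s'0 s'e] Ms'] := Hr z x0 zx0 xx0.
  have tT : T0 <= t.
    apply: le_trans qt; apply: (le_trans (ler_norm _)); apply: (@le_trans _ _ (`|T0| + 1)).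
      by rewrite lerDl.
    by rewrite -[leLHS]invrK lef_pV2 ?posrE ?invr_gt0 // ltW.
  have Mloop := M_cat Ms (M_cat Mt Ms').
  rewrite leNgt; apply/negP => bq; apply: (noloop _ _ (M_le Mloop _)).
    by rewrite (le_trans tT) // addrCA lerDl addr_ge0.
  have h : Q * (s + s') <= e / 2.
    have -> : e / 2 = Q * (e / (4 * Q) + e / (4 * Q)) by field; rewrite gt_eqF.
    by rewrite ler_pM2l // lerD.
  have h' : - (crit * (s + s')) <= `|crit| * (s + s').
    by apply: (le_trans (ler_norm _)); rewrite normrN normrM (ger0_norm (addr_ge0 s0 s'0)).
  move: h h'; rewrite /Q !mulrDl !mulrDr mul1r; lra.
pose k := Num.truncn r^-1.
have kr : k.+1%:R^-1 < r.
  by rewrite -[ltRHS]invrK ltf_pV2 ?posrE ?invr_gt0 //; exact: truncnS_gt.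
have rV0 : 0 < r^-1 by rewrite invr_gt0.
have recur t x y b : M t x y b -> r^-1 <= t -> grid_cell k.+1 x = grid_cell k.+1 y -> crit * t + r <= b.
  move=> /rep_M Mt rt /grid_cell_close xy.
  apply: (Hr _ (sub_floor_vec_cube x) _ _ _ _ _ _ rt Mt); first by rewrite subrr normr0.
  by rewrite distrC; apply: le_lt_trans kr.
pose I : finType := {ffun 'I_d -> 'I_k.+2}.
pose K : R := #|I|%:R.
have K0 : 0 < K by rewrite ltr0n; apply/card_gt0P; exists [ffun=> ord0].
(* At this rate a path of duration [N / r] has excess at most [r * N / (2 * K)]; multiplied by the
   [K] cells, this is half of the [r * N] that the count requires. *)
have rK : 0 < r ^+ 2 / (2 * K) by rewrite divr_gt0 ?exprn_gt0 // mulr_gt0.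
have [T0 up] := path_upper rK.
(* [N > Z] ensures both [T0 <= N / r] and [K * (C + C + r) < r * N / 2]. *)
pose Z := `|T0| * r + 2 * K * (C + C + r) / r + 1.
pose N := (Num.truncn Z).+1.
have ZN : Z < N%:R by exact: truncnS_gt.
have z1 : 0 <= `|T0| * r by rewrite mulr_ge0 // ltW.
have z2 : 0 <= 2 * K * (C + C + r) / r.
  by rewrite divr_ge0 ?(ltW r0) // mulr_ge0 ?mulr_ge0 ?(ltW K0) // !addr_ge0 // ltW.
have [|y My] := up (r^-1 * N%:R) _ 0.
  rewrite -ler_pdivrMl // invrK mulrC; apply: (le_trans _ (ltW ZN)).
  have : T0 * r <= `|T0| * r by rewrite ler_wpM2r ?(ltW r0) // ler_norm.
  rewrite /Z; lra.
have [p [bb [_ Mp sb]]] := M_pieces (ltW rV0) My.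
have := recurrence_count rV0 C0 lowC recur (ltW r0) Mp; rewrite -/K => cnt.
have ES : K * (r ^+ 2 / (2 * K) * (r^-1 * N%:R)) = r * N%:R / 2.
  by field; rewrite !gt_eqF.
have bad : r * N%:R <= r * N%:R / 2 + K * (C + C + r).
  apply: (le_trans cnt); rewrite -ES -mulrDr ler_wpM2l ?(ltW K0) //.
  move: sb; rewrite mulrDl; lra.
have : K * (C + C + r) < r * N%:R / 2.
  have -> : K * (C + C + r) = r / 2 * (2 * K * (C + C + r) / r).
    by field; rewrite gt_eqF.
  rewrite (mulrAC r N%:R) ltr_pM2l ?divr_gt0 //; apply: le_lt_trans ZN; rewrite /Z; lra.
lra.
Qed.

End WeakKAM.

(** * Paths modulo integer translations, critical value and Peierls barrier *)

Section ReachModulo.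
Variables (R : realType) (d m : nat).
Local Notation V := 'rV[R]_d.
Local Notation U := 'rV[R]_m.
Variables (f : 'I_m -> V -> V) (L : V -> U -> R).

(** The inequality makes the relation monotone in the cost bound, and the free translation [z] makes
    it periodic in each end point separately. *)
Definition treach (t : R) (x y : V) (b : R) : Prop :=
  exists z c, c <= b /\ reach f L t x (y + intvec R z) c.

Lemma treach_le t x y b b' : treach t x y b -> b <= b' -> treach t x y b'.
Proof. by move=> [z [c [cb H]]] bb; exists z, c; split => //; exact: le_trans bb. Qed.

Lemma treach_ge0 t x y b : treach t x y b -> 0 <= t.
Proof. by move=> [z [c [_ /reach_ge0]]]. Qed.

Lemma reach_treach t x y b : reach f L t x y b -> treach t x y b.
Proof. by move=> H; exists 0, b; rewrite intvec0 addr0. Qed.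

Lemma treach_split (s t : R) x y b : 0 <= s -> 0 <= t -> treach (s + t) x y b ->
  exists w b1 b2, [/\ treach s x w b1, treach t w y b2 & b = b1 + b2].
Proof.
move=> s0 t0 [z [c [cb /(reach_split s0 t0)[w [c1 [c2 [H1 H2 E]]]]]]].
(* The slack between [b] and the actual cost is given to the second piece. *)
exists w, c1, (b - c1); split; [exact: reach_treach| |by rewrite addrC subrK].
by exists z, c2; split => //; rewrite lerBrDl -E.
Qed.

Hypothesis fper : forall i, Zd_periodic (f i).
Hypothesis Lper : Zd_periodic L.

Lemma treach_cat s t x y w b b' : treach s x y b -> treach t y w b' -> treach (s + t) x w (b + b').
Proof.
move=> [z [c [cb H]]] [z' [c' [cb' H']]]; exists (z' + z), (c + c'); split; first exact: lerD.
by rewrite intvecD addrA; apply: (reach_cat H); exact: reach_translate.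
Qed.

Lemma treach_period t x y b z z' : treach t x y b ->
  treach t (x + intvec R z) (y + intvec R z') b.
Proof.
move=> [w [c [cb H]]]; exists (w + z - z'), c; split => //.
have := reach_translate fper Lper z H.
by rewrite !intvecD intvecN addrACA subrr addr0 addrA.
Qed.

Variables (K2 c : R).
Hypothesis Lcont : continuous (fun p : V * U => L p.1 p.2).
Hypothesis Lbound : forall x u, - K2 <= L x u.

Lemma treach_lower t x y b : treach t x y b -> - (K2 * t) <= b.
Proof. by move=> [z [e [eb /(reach_lower Lbound) H]]]; exact: le_trans eb. Qed.

(** For large [T] the value lies between [c * T - C] and [(c + e) * T]; this first shows that it is
    finite, then that its quotient by [T] is within [e] of [c] once [C <= e * T]. *)
Lemma cbar_eq (C : R) : (forall t x y b, treach t x y b -> c * t - C <= b) ->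
  (forall e : R, 0 < e -> exists T0 : R, forall T, T0 <= T -> exists y, treach T 0 y ((c + e) * T)) ->
  cbar f L = c%:E.
Proof.
move=> lowC up; apply: cvg_lim => //.
have rate (e : R) : 0 < e -> \forall T \near +oo%R,
    exists2 v, (valueV f L T 0 * T^-1%:E)%E = v%:E & `|c - v| <= e.
  move=> e0; have [T0 HT] := up e e0; near=> T.
  have T1 : 0 < T by near: T; apply: nbhs_pinfty_gt; exact: num_real.
  have TT : T0 <= T by near: T; apply: nbhs_pinfty_ge; exact: num_real.
  have CT : C <= e * T by rewrite -ler_pdivrMl //; near: T; apply: nbhs_pinfty_ge; exact: num_real.
  have [y [z [b [b1 /valueV_le b2]]]] := HT T TT.
  have ub : (valueV f L T 0 <= ((c + e) * T)%:E)%E by apply: (le_trans b2); rewrite lee_fin.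
  have lb : ((c * T - C)%:E <= valueV f L T 0)%E.
    rewrite leNgt; apply/negP => /(valueV_lt Lcont Lbound (ltW T1))[w [a [ac /reach_treach/lowC]]].
    by rewrite leNgt ac.
  move: ub lb; case: (valueV _ _ _ _) => // v; rewrite !lee_fin => ub lb.
  exists (v / T) => //; rewrite distrC ler_distl ler_pdivlMr // ler_pdivrMr //.
  by apply/andP; split; lra.
apply/fine_cvgP; split; first by apply: filterS (rate 1 ltr01) => T [v ->].
by apply/cvgrPdist_le => e /rate; apply: filterS => T [v /= ->].
Unshelve. all: by end_near. Qed.

Lemma peierls_eq0 x : cbar f L = c%:E -> (forall t b, treach t x x b -> c * t <= b) ->
  (forall e T0 : R, 0 < e -> exists2 t, T0 <= t & treach t x x (c * t + e)) ->
  peierls f L x x = 0%E.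
Proof.
move=> cE low up; rewrite /peierls limf_einfE cE; apply/eqP; rewrite eq_le; apply/andP; split.
  apply: ge_ereal_sup => _ [A [T0 [T0r HA]] <-]; apply/lee_addgt0Pr => e e0; rewrite add0e.
  (* A neighbourhood of [+oo] contains an open ray, so [t] must exceed [T0] strictly. *)
  have [t Tt [z [b [bt Hb]]]] := up e (T0 + 1) e0.
  apply: (@le_trans _ _ (actionA f L t x x - c%:E * t%:E)%E).
    apply: ereal_inf_lbound; exists t => //; apply: HA; apply: lt_le_trans Tt; rewrite ltrDl //.
  rewrite leeBlDr // -EFinM -EFinD; apply: (le_trans (actionA_le Hb)).
  by rewrite lee_fin addrC.
(* For the lower bound the single ray of positive times suffices, since loops never cost less than
   [c * t]. *)
apply: (@le_trans _ _ (ereal_inf ((fun t : R => (actionA f L t x x - c%:E * t%:E)%E) @` [set t | 0 < t]))).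
  apply: le_ereal_inf_tmp => _ [t t0 <-]; rewrite sube_ge0 // -EFinM leNgt; apply/negP.
  move=> /(actionA_lt Lcont Lbound (ltW t0))[z [b [bc H]]].
  suff /low : treach t x x b by rewrite leNgt bc.
  by exists z, b.
by apply: ereal_sup_ubound; exists [set t | 0 < t] => //; apply: nbhs_pinfty_gt; exact: num_real.
Qed.

End ReachModulo.

Theorem mainTheorem4 (R : realType) (d m : nat)
  (f : 'I_m -> 'rV[R]_d -> 'rV[R]_d) (L : 'rV[R]_d -> 'rV[R]_m -> R) :
  (1 <= m)%N -> (m <= d)%N ->
  (forall i, smooth (f i)) -> (forall i, Zd_periodic (f i)) ->
  Hormander f -> condF f -> condL L -> condS f L ->
  exists x : 'rV[R]_d, peierls f L x x = 0%E.
Proof.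
move=> _ _ fs fper fH _ [L2 [Lper [_ [sigma [K1 [K2 [_ [K10 coercive]]]]]]]] _.
have Lcont : continuous (fun p : 'rV[R]_d * 'rV[R]_m => L p.1 p.2) := (L2 [::] isT).1.
(* The power of the norm is nonnegative, so coercivity bounds [L] from below. *)
have Lbound x u : - K2 <= L x u.
  by apply: le_trans (coercive x u); rewrite lerDr mulr_ge0 ?powR_ge0 // ltW.
have ff i : fieldB (f i) by exact: periodic_smooth_fieldB.
have [M M0 fM] := bang_bound ff.
have [B B0 LB] := bang_cost_bound Lper Lcont.
have steered t x y : steer f M t x y -> treach f L t x y (B * t).
  by move=> /(reach_of_steer Lcont LB)[c cB H]; apply: treach_le cB; exact: reach_treach.
have wait (t : R) x : 0 <= t -> treach f L t x x (B * t).
  by move=> t0; apply: steered; exact: steer_wait.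
have loc (x0 : 'rV[R]_d) (e : R) : 0 < e -> exists2 r : R, 0 < r & forall x y, `|x - x0| < r -> `|y - x0| < r ->
    exists2 t, 0 <= t <= e & treach f L t x y (B * t).
  move=> /(steer_local ff M0 fM fH x0)[r r0 Hr]; exists r => // x y xr yr.
  by have [t te H] := Hr x y xr yr; exists t => //; exact: steered.
have cat := treach_cat fper Lper; have per := treach_period fper Lper.
have low := @treach_lower R d m f L K2 Lbound; have le := @treach_le R d m f L.
have ge0 := @treach_ge0 R d m f L.
have [C _ lowC] := path_lower B0 cat ge0 low per wait loc.
have [x Hx] := Aubry_point B0 le cat (@treach_split R d m f L) ge0 low per wait loc.
exists x; apply: (peierls_eq0 Lcont Lbound _ _ Hx); last first.
  by move=> t b; exact: (loop_lower ge0 low wait).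
apply: (cbar_eq Lcont Lbound lowC) => e e0.
have [T0 up] := path_upper B0 le cat low per wait loc e0.
by exists T0 => T /up; exact.
Qed.
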